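(* A map $Z : \mathcal{P}_o^3 \to \mathcal{K}_o^3$ is an $\mathrm{SL}(3)$ covariant Minkowski valuation if and only if there exist constants $a_1,a_2,b_1,b_2,c_1,c_2 \geq 0$ satisfying $a_1 \leq a_2$, $b_1 \leq b_2$, $a_2-a_1 \leq b_2$ and $b_2-b_1 \leq a_2$ such that $$ZP = c_1 M^+ P + c_2 M^- P + D_{a_1,a_2,b_1,b_2} P$$ for every $P \in \mathcal{P}_o^3$.
   Context: $\mathcal{K}_o^3$ denotes the set of convex bodies (compact convex sets) in $\mathbb{R}^3$ containing the origin $o$, and $\mathcal{P}_o^3$ the set of convex polytopes in $\mathbb{R}^3$ containing the origin. $+$ denotes Minkowski addition and $h_K(x)=\max\{x\cdot y:y\in K\}$ the support function. A map $Z:\mathcal{P}_o^3\to\mathcal{K}_o^3$ is a Minkowski valuation if $Z(K\cup L)+Z(K\cap L)=ZK+ZL$ whenever $K,L,K\cup L,K\cap L\in\mathcal{P}_o^3$; it is $\mathrm{SL}(3)$ covariant if $Z(\phi K)=\phi ZK$ for all $\phi\in\mathrm{SL}(3)$. The moment bodies are defined by $h_{M^+K}(x)=\int_K \max\{x\cdot y,0\}\,dy$, $h_{M^-K}(x)=\int_K \max\{-x\cdot y,0\}\,dy$ (Lebesgue measure on $\mathbb{R}^3$). For $P\in\mathcal{P}_o^3$, $\mathcal{E}_o(P)$ denotes the set of edges of $P$ containing the origin and $\mathcal{F}_o(P)$ the set of 2-dimensional faces of $P$ containing the origin. $D_{a_1,a_2,b_1,b_2}P$ is the convex body with support function $h =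 a_1 h_P + (a_2-a_1)\sum_{F\in\mathcal{F}_o(P)}h_F - (a_2-a_1)\sum_{E\in\mathcal{E}_o(P)}h_E + b_1 h_{-P} + (b_2-b_1)\sum_{F\in\mathcal{F}_o(P)}h_{-F} - (b_2-b_1)\sum_{E\in\mathcal{E}_o(P)}h_{-E}$ if $\dim P=3$; $h = (2a_2-a_1)h_P - (a_2-a_1)\sum_{E\in\mathcal{E}_o(P)}h_E + (2b_2-b_1)h_{-P} - (b_2-b_1)\sum_{E\in\mathcal{E}_o(P)}h_{-E}$ if $\dim P=2$; $h = a_1h_P + b_1h_{-P}$ if $\dim P\le 1$ (so $D_{a_1,a_2,b_1,b_2}\{o\}=\{o\}$). *)

(* Defs.v *)
From HB Require Import structures.
From mathcomp Require Import all_boot all_order all_algebra.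
From mathcomp Require Import all_classical all_reals all_analysis.
Set Implicit Arguments. Unset Strict Implicit. Unset Printing Implicit Defensive.
Import Order.TTheory GRing.Theory Num.Theory.
Import numFieldNormedType.Exports.
Local Open Scope classical_set_scope.
Local Open Scope ring_scope.

Section Defs.
Variable R : realType.

Definition vec := 'rV[R]_3.

Definition dot (x y : vec) : R := \sum_(i < 3) x ord0 i * y ord0 i.

Definition supp (K : set vec) (x : vec) : R := sup [set dot x y | y in K].

Definition body_of (h : vec -> R) : set vec := [set y | forall x, dot x y <= h x].

Definition convex (K : set vec) : Prop :=
  forall x y t, K x -> K y -> 0 <= t <= 1 -> K ((1 - t) *: x + t *: y).

Definition convex_body_o (K : set vec) : Prop := convex K /\ compact K /\ K 0.

Definition conv (s : seq vec) : set vec :=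
  [set x | exists w : 'I_(size s) -> R,
     (forall i, 0 <= w i) /\ \sum_i w i = 1 /\ x = \sum_i w i *: s`_i].

Definition polytope_o (P : set vec) : Prop := (exists s, P = conv s) /\ P 0.

Definition mink_add (A B : set vec) : set vec := [set a + b | a in A & b in B].
Definition dil (c : R) (A : set vec) : set vec := [set c *: a | a in A].
Definition negset (A : set vec) : set vec := [set - a | a in A].
Definition linimg (phi : 'M[R]_3) (A : set vec) : set vec := [set a *m phi | a in A].

Definition affdim_ge (A : set vec) (k : nat) : Prop :=
  exists (p0 : vec) (M : 'M[R]_(k, 3)),
    A p0 /\ (forall i, A (p0 + row i M)) /\ row_free M.
Definition affdim_eq (A : set vec) (k : nat) : Prop :=
  affdim_ge A k /\ ~ affdim_ge A k.+1.

Definition face (P F : set vec) : Prop :=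
  exists u : vec, u != 0 /\ F = [set y | P y /\ dot u y = supp P u].

Definition edges_o (P : set vec) : set (set vec) :=
  [set E | face P E /\ affdim_eq E 1 /\ E 0].
Definition facets_o (P : set vec) : set (set vec) :=
  [set F | face P F /\ affdim_eq F 2 /\ F 0].

Definition v3 (p : (R * R) * R) : vec :=
  \row_(j < 3) (if nat_of_ord j == 0%N then p.1.1
                else if nat_of_ord j == 1%N then p.1.2 else p.2).

Definition leb3 := ((@lebesgue_measure R \x @lebesgue_measure R) \x @lebesgue_measure R)%E.

Definition hMplus (K : set vec) (x : vec) : R :=
  fine (\int[leb3]_(p in [set p | K (v3 p)]) (Num.max (dot x (v3 p)) 0)%:E)%E.
Definition hMminus (K : set vec) (x : vec) : R :=
  fine (\int[leb3]_(p in [set p | K (v3 p)]) (Num.max (- dot x (v3 p)) 0)%:E)%E.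

Definition Mplus (K : set vec) : set vec := body_of (hMplus K).
Definition Mminus (K : set vec) : set vec := body_of (hMminus K).

Definition hD (a1 a2 b1 b2 : R) (P : set vec) (x : vec) : R :=
  if `[< affdim_ge P 3 >] then
    a1 * supp P x
    + (a2 - a1) * (\sum_(F \in facets_o P) supp F x)
    - (a2 - a1) * (\sum_(E \in edges_o P) supp E x)
    + b1 * supp (negset P) x
    + (b2 - b1) * (\sum_(F \in facets_o P) supp (negset F) x)
    - (b2 - b1) * (\sum_(E \in edges_o P) supp (negset E) x)
  else if `[< affdim_ge P 2 >] then
    (2 * a2 - a1) * supp P x
    - (a2 - a1) * (\sum_(E \in edges_o P) supp E x)
    + (2 * b2 - b1) * supp (negset P) x
    - (b2 - b1) * (\sum_(E \in edges_o P) supp (negset E) x)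
  else a1 * supp P x + b1 * supp (negset P) x.

Definition Dbody (a1 a2 b1 b2 : R) (P : set vec) : set vec := body_of (hD a1 a2 b1 b2 P).

Definition minkowski_valuation (Z : set vec -> set vec) : Prop :=
  forall K L, polytope_o K -> polytope_o L -> polytope_o (K `|` L) -> polytope_o (K `&` L) ->
    mink_add (Z (K `|` L)) (Z (K `&` L)) = mink_add (Z K) (Z L).

Definition SL3_covariant (Z : set vec -> set vec) : Prop :=
  forall (phi : 'M[R]_3), \det phi = 1 -> forall K, polytope_o K ->
    Z (linimg phi K) = linimg phi (Z K).

End Defs.

(* Main.v *)
(* The support function of a covariant Minkowski valuation is, at each x, a real valued
   functional z(P, x) satisfying z(P) + z(P ∩ n^⊥) = z(P ∩ {n >= 0}) + z(P ∩ {n <= 0}) for every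
   plane through o.  Cutting along planes through o turns P into simplices with a vertex at o,
   so such a functional is determined by its values on these simplices, where SL(3) covariance
   leaves only the volume V and the numbers y_i = x · v_i as variables.  In these variables the
   relation reads
     z(V; y1, y2, y3) + z(m, y3) = z(tV; y1, m, y3) + z((1-t)V; m, y2, y3), m = (1-t) y1 + t y2.
   For y = (0, 0, ±1) it is Cauchy's equation in V; positivity makes its solutions affine in V,
   and the slopes are the coefficients of the moment bodies.  The values on [0, e1] and on
   [0, e1, e2] at ±e1 are a_i and b_i, and once the combination of M^+, M^- and D with these
   coefficients is subtracted, the relation together with continuity leaves only 0.  The
   inequalities between the a_i and b_i are convexity of z(P, .) near two kinks, evaluated in
   the limit V -> 0.
   Conversely D is cut additive because the edges and facets at o of a half of P are the
   corresponding halves together with P ∩ n^⊥.  Its support function is sublinear because it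
   is locally so: at x the kink in direction d is
     a1 w(P_x) + (a2 - a1) K_x + b1 w(P_-x) + (b2 - b1) K_-x,
   where w is the width along d, P_x is the face in direction x and, if dim P = 3, K_x is the sum
   of w(F_x) over the facets F at o minus the sum of w(E_x) over the edges E at o. *)
From HB Require Import structures.
From mathcomp Require Import all_boot all_order all_algebra.
From mathcomp Require Import all_classical all_reals all_analysis.
From mathcomp Require Import measurable_realfun.
From mathcomp Require Import ring lra.
Require Import Defs.
Set Implicit Arguments. Unset Strict Implicit. Unset Printing Implicit Defensive.
Import Order.TTheory GRing.Theory Num.Theory.
Import numFieldNormedType.Exports.
Local Open Scope classical_set_scope.
Local Open Scope ring_scope.

(** The edge terms of [D] carry a minus sign, so its support function is not visibly a sum of convex
    ones; this is the obstacle of the converse. It is piecewise linear, and a continuous function on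
    a line that is locally convex is midpoint convex, so only one-sided slopes at nonzero x have to
    be compared. These are widths of faces, and edge widths are mostly charged to facets containing
    the edges. In the other direction a difference of support functions is not convex, so the
    subtraction takes place among functionals that are only cut additive, covariant, homogeneous and
    Lipschitz. On a lower-dimensional simplex the y_i do not determine x; a stretch of determinant 1
    together with homogeneity shows that the rest of x has no influence. The relation is then solved
    by choosing t with m = 0, or by reading it backwards from a simplex with a vanishing y_i. Cuts
    by planes through o yield the valuation property on all unions because, for a convex union,
    space can be divided into cones so fine that in each of them one of the two polytopes contains
    the other. *)

(** * Dot, cross and triple products in three-space *)

Section Vectors.
Variable R : realType.
Implicit Types (x y z u v w : vec R) (c t : R) (A K P : set (vec R)).

Definition o0 : 'I_3 := @Ordinal 3 0 isT.
Definition o1 : 'I_3 := @Ordinal 3 1 isT.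
Definition o2 : 'I_3 := @Ordinal 3 2 isT.

Lemma sum3E (V : nmodType) (f : 'I_3 -> V) : \sum_i f i = f o0 + f o1 + f o2.
Proof.
rewrite !big_ord_recl big_ord0 addr0 addrA.
by congr (f _ + f _ + f _); apply/val_inj.
Qed.

Lemma ord3P (Q : 'I_3 -> Prop) : Q o0 -> Q o1 -> Q o2 -> forall i, Q i.
Proof.
move=> q0 q1 q2 [[|[|[|//]]] i3].
- by have -> : Ordinal i3 = o0 by apply/val_inj.
- by have -> : Ordinal i3 = o1 by apply/val_inj.
- by have -> : Ordinal i3 = o2 by apply/val_inj.
Qed.

Lemma ordP0 (i : 'I_1) : i = ord0. Proof. exact: ord1. Qed.

Lemma vec_eq x y : x ord0 o0 = y ord0 o0 -> x ord0 o1 = y ord0 o1 ->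
  x ord0 o2 = y ord0 o2 -> x = y.
Proof. by move=> e0 e1 e2; apply/rowP; apply: ord3P. Qed.

Definition mkv (a b c : R) : vec R :=
  \row_j (if nat_of_ord j == 0%N then a else if nat_of_ord j == 1%N then b else c).

Lemma mkv0 a b c : mkv a b c ord0 o0 = a. Proof. by rewrite mxE. Qed.
Lemma mkv1 a b c : mkv a b c ord0 o1 = b. Proof. by rewrite mxE. Qed.
Lemma mkv2 a b c : mkv a b c ord0 o2 = c. Proof. by rewrite mxE. Qed.

Lemma dotE x y : dot x y =
  x ord0 o0 * y ord0 o0 + x ord0 o1 * y ord0 o1 + x ord0 o2 * y ord0 o2.
Proof. by rewrite /dot sum3E. Qed.

Lemma dotC x y : dot x y = dot y x.
Proof. by rewrite !dotE; ring. Qed.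
Lemma dotDr x y z : dot x (y + z) = dot x y + dot x z.
Proof. by rewrite !dotE !mxE; ring. Qed.
Lemma dotDl x y z : dot (y + z) x = dot y x + dot z x.
Proof. by rewrite !dotE !mxE; ring. Qed.
Lemma dotZr c x y : dot x (c *: y) = c * dot x y.
Proof. by rewrite !dotE !mxE; ring. Qed.
Lemma dotZl c x y : dot (c *: x) y = c * dot x y.
Proof. by rewrite !dotE !mxE; ring. Qed.
Lemma dotNr x y : dot x (- y) = - dot x y.
Proof. by rewrite !dotE !mxE; ring. Qed.
Lemma dotNl x y : dot (- x) y = - dot x y.
Proof. by rewrite !dotE !mxE; ring. Qed.
Lemma dotBr x y z : dot x (y - z) = dot x y - dot x z.
Proof. by rewrite dotDr dotNr. Qed.
Lemma dotBl x y z : dot (y - z) x = dot y x - dot z x.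
Proof. by rewrite dotDl dotNl. Qed.
Lemma dot0r x : dot x 0 = 0.
Proof. by rewrite !dotE !mxE; ring. Qed.
Lemma dot0l x : dot 0 x = 0.
Proof. by rewrite !dotE !mxE; ring. Qed.

Definition dotlin := (dotDl, dotDr, dotNl, dotNr, dotZl, dotZr, dot0l, dot0r).

Lemma dot_sumr (I : Type) (r : seq I) (p : pred I) (f : I -> vec R) x :
  dot x (\sum_(i <- r | p i) f i) = \sum_(i <- r | p i) dot x (f i).
Proof.
apply: (big_morph (dot x)); [exact: dotDr|exact: dot0r].
Qed.

Lemma dot_mulmx x y (phi : 'M[R]_3) : dot x (y *m phi) = dot (x *m phi^T) y.
Proof.
by rewrite !dotE !mxE !sum3E !mxE; ring.
Qed.

Lemma dot_ge0 x : 0 <= dot x x.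
Proof. by rewrite dotE; rewrite -!expr2 !addr_ge0 ?sqr_ge0. Qed.

Lemma dot_eq0 x : dot x x = 0 -> x = 0.
Proof.
rewrite dotE => h.
have h0 := sqr_ge0 (x ord0 o0); have h1 := sqr_ge0 (x ord0 o1); have h2 := sqr_ge0 (x ord0 o2).
rewrite !expr2 in h0 h1 h2.
by apply: vec_eq; rewrite mxE; apply/eqP; rewrite -sqrf_eq0 expr2; apply/eqP; lra.
Qed.

Lemma dot_gt0 x : x != 0 -> 0 < dot x x.
Proof.
move=> x0; rewrite lt_neqAle dot_ge0 andbT eq_sym.
by apply: contra x0 => /eqP/dot_eq0 ->.
Qed.

Definition cross x y : vec R := mkv
  (x ord0 o1 * y ord0 o2 - x ord0 o2 * y ord0 o1)
  (x ord0 o2 * y ord0 o0 - x ord0 o0 * y ord0 o2)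
  (x ord0 o0 * y ord0 o1 - x ord0 o1 * y ord0 o0).

Definition det3 x y z : R := dot (cross x y) z.

Lemma det3E x y z : det3 x y z =
  (x ord0 o1 * y ord0 o2 - x ord0 o2 * y ord0 o1) * z ord0 o0 +
  (x ord0 o2 * y ord0 o0 - x ord0 o0 * y ord0 o2) * z ord0 o1 +
  (x ord0 o0 * y ord0 o1 - x ord0 o1 * y ord0 o0) * z ord0 o2.
Proof. by rewrite /det3 dotE !mkv0 !mkv1 !mkv2. Qed.

Ltac crs := apply: vec_eq; rewrite !(mxE, mkv0, mkv1, mkv2, dotE) /=; ring.

Lemma crossDl x y z : cross (x + y) z = cross x z + cross y z. Proof. by crs. Qed.
Lemma crossDr x y z : cross z (x + y) = cross z x + cross z y. Proof. by crs. Qed.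
Lemma crossZl c x y : cross (c *: x) y = c *: cross x y. Proof. by crs. Qed.
Lemma crossZr c x y : cross x (c *: y) = c *: cross x y. Proof. by crs. Qed.
Lemma crossN x y : cross x y = - cross y x. Proof. by crs. Qed.
Lemma crossxx x : cross x x = 0. Proof. by crs. Qed.
Lemma cross0l x : cross 0 x = 0. Proof. by crs. Qed.
Lemma cross0r x : cross x 0 = 0. Proof. by crs. Qed.
Lemma dot_crossl x y : dot (cross x y) x = 0.
Proof. by rewrite -/(det3 _ _ _) det3E; ring. Qed.
Lemma dot_crossr x y : dot (cross x y) y = 0.
Proof. by rewrite -/(det3 _ _ _) det3E; ring. Qed.

Lemma cross_cross x y z : cross (cross x y) z = dot x z *: y - dot y z *: x.
Proof. by crs. Qed.

Lemma cross_eq0 x y : x != 0 -> cross x y = 0 -> y = (dot x y / dot x x) *: x.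
Proof.
move=> x0 c0.
have := cross_cross x y x; rewrite c0 cross0l => /esym/eqP; rewrite subr_eq0 => /eqP e.
apply: (scalerI (a := dot x x)); first by rewrite gt_eqF ?dot_gt0.
by rewrite e scalerA mulrCA divff ?mulr1 ?gt_eqF ?dot_gt0 // dotC.
Qed.

(** Cramer's rule, kept free of division: with vanishing determinant it becomes a linear relation
    between coplanar vectors. *)
Lemma expand3 u v w x :
  det3 u v w *: x = det3 x v w *: u + det3 u x w *: v + det3 u v x *: w.
Proof. by apply: vec_eq; rewrite !(mxE, det3E) /=; ring. Qed.

(** The cross products form, up to the determinant, the basis dual to [u], [v], [w]. *)
Lemma expand3d u v w x :
  det3 u v w *: x = dot x u *: cross v w + dot x v *: cross w u + dot x w *: cross u v.
Proof. by apply: vec_eq; rewrite !(mxE, det3E, dotE, mkv0, mkv1, mkv2) /=; ring. Qed.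

Lemma dot_basis_eq0 u v w x : det3 u v w != 0 ->
  dot x u = 0 -> dot x v = 0 -> dot x w = 0 -> x = 0.
Proof.
move=> d e1 e2 e3; apply: (scalerI d).
by rewrite expand3d e1 e2 e3 !scale0r !addr0 scaler0.
Qed.

Lemma det3_rot x y z : det3 x y z = det3 y z x. Proof. by rewrite !det3E; ring. Qed.
Lemma det3_swap x y z : det3 x y z = - det3 y x z. Proof. by rewrite !det3E; ring. Qed.

End Vectors.

(** * Convex hulls and support functions *)

Section ConvexHull.
Variable R : realType.
Implicit Types (x y z u v w : vec R) (c t : R) (A B K P : set (vec R)) (s : seq (vec R)).

(** Unnormalised weights let the induction split off one point without rescaling the weights of the
    rest. *)
Lemma convex_comb K (I : eqType) (r : seq I) (w : I -> R) (f : I -> vec R) :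
  convex K -> (forall i, i \in r -> 0 <= w i) -> (forall i, i \in r -> K (f i)) ->
  0 < \sum_(i <- r) w i ->
  K ((\sum_(i <- r) w i)^-1 *: \sum_(i <- r) w i *: f i).
Proof.
move=> cK; elim: r => [|a r IH] w0 Kf; first by rewrite !big_nil ltxx.
rewrite !big_cons => pos.
have wa : 0 <= w a by apply: w0; rewrite mem_head.
have w0' i : i \in r -> 0 <= w i by move=> ir; apply: w0; rewrite inE ir orbT.
have Kf' i : i \in r -> K (f i) by move=> ir; apply: Kf; rewrite inE ir orbT.
have Kfa : K (f a) by apply: Kf; rewrite mem_head.
have [S0|Sn0] := eqVneq (\sum_(i <- r) w i) 0.
  have -> : \sum_(i <- r) w i *: f i = 0.
    rewrite big_seq big1 // => i ir.
    suff -> : w i = 0 by rewrite scale0r.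
    apply/eqP; move: S0 => /eqP; rewrite big_seq psumr_eq0 => [/allP/(_ i ir)|j /w0' //].
    by rewrite ir.
  rewrite S0 !addr0 in pos *.
  by rewrite scalerA mulVf ?scale1r // gt_eqF.
have Sp : 0 < \sum_(i <- r) w i.
  by rewrite lt_neqAle eq_sym Sn0 big_seq sumr_ge0 // => i /w0'.
set S := \sum_(i <- r) w i in Sn0 Sp pos *.
have t01 : 0 <= S / (w a + S) <= 1.
  by rewrite divr_ge0 ?(ltW Sp) ?(ltW pos) //= ler_pdivrMr // mul1r lerDr.
have := cK _ _ (S / (w a + S)) Kfa (IH w0' Kf' Sp) t01.
rewrite -/S; set T := \sum_(i <- r) _.
rewrite scalerA.
have -> : S / (w a + S) * S^-1 = (w a + S)^-1 by field; rewrite Sn0 gt_eqF.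
have -> : 1 - S / (w a + S) = w a / (w a + S) by field; rewrite gt_eqF.
by rewrite scalerDr scalerA mulrC.
Qed.

Lemma convex_comb1 K (I : eqType) (r : seq I) (w : I -> R) (f : I -> vec R) :
  convex K -> (forall i, i \in r -> 0 <= w i) -> (forall i, i \in r -> K (f i)) ->
  \sum_(i <- r) w i = 1 -> K (\sum_(i <- r) w i *: f i).
Proof.
move=> cK w0 Kf s1; have := convex_comb cK w0 Kf.
by rewrite s1 => /(_ ltr01); rewrite invr1 scale1r.
Qed.

Lemma conv_sub s K : convex K -> (forall v, v \in s -> K v) -> conv s `<=` K.
Proof.
move=> cK Ks x [w [w0 [w1 ->]]].
apply: convex_comb1 => // i _; apply: Ks.
exact: mem_nth.
Qed.

Lemma conv_mem s v : v \in s -> conv s v.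
Proof.
move=> vs; have hi : (index v s < size s)%N by rewrite index_mem.
exists (fun i => (i == Ordinal hi)%:R); split; first by move=> i; rewrite ler0n.
split.
  by rewrite (bigD1 (Ordinal hi)) //= eqxx big1 ?addr0 // => i /negbTE ->.
rewrite (bigD1 (Ordinal hi)) //= eqxx big1 ?addr0 ?scale1r ?nth_index //.
by move=> i /negbTE ->; rewrite scale0r.
Qed.

Lemma conv_convex s : convex (conv s).
Proof.
move=> x y t [w [w0 [w1 ->]]] [w' [w0' [w1' ->]]] /andP[t0 t1].
exists (fun i => (1 - t) * w i + t * w' i); split.
  by move=> i; rewrite addr_ge0 // mulr_ge0 // subr_ge0.
split; first by rewrite big_split /= -!mulr_sumr w1 w1'; ring.
rewrite !scaler_sumr -big_split /=; apply: eq_bigr => i _.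
by rewrite !scalerA scalerDl.
Qed.

Lemma conv_subset s s' : (forall v, v \in s -> v \in s') -> conv s `<=` conv s'.
Proof. by move=> ss; apply: conv_sub; [exact: conv_convex|move=> v /ss; exact: conv_mem]. Qed.

Lemma conv_eqi s s' : s =i s' -> conv s = conv s'.
Proof. by move=> e; apply/seteqP; split; apply: conv_subset => v; rewrite e. Qed.

Lemma conv_nil : conv [::] = set0 :> set (vec R).
Proof.
apply/seteqP; split=> // x [w [_ [+ _]]].
by rewrite big_ord0 => /esym/eqP; rewrite oner_eq0.
Qed.

(** The hull is the join of [a] with the hull of [s]: this join is convex and contains the
    generators. *)
Lemma conv_cons a s x : s != [::] ->
  conv (a :: s) x <-> exists t y, [/\ 0 <= t <= 1, conv s y & x = t *: a + (1 - t) *: y].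
Proof.
move=> s0; split; last first.
  move=> [t [y [t01 sy ->]]].
  have sub : conv s `<=` conv (a :: s).
    by apply: conv_subset => v vs; rewrite inE vs orbT.
  rewrite addrC; apply: conv_convex => //; first exact: sub.
  exact/conv_mem/mem_head.
move: x; apply: (@conv_sub _ [set x | exists t y,
    [/\ 0 <= t <= 1, conv s y & x = t *: a + (1 - t) *: y]]) => /=
  [x1 x2 l [t [y [/andP[t0 t1] sy ->]]] [t' [y' [/andP[t0' t1'] sy' ->]]] /andP[l0 l1]|v].
  (* [T] is the weight of [a] in the new combination. The remainder has to be divided by [1 - T], so
     [T = 1] is treated apart. *)
  pose T := (1 - l) * t + l * t'.
  have hT : 0 <= T <= 1.
    rewrite /T addr_ge0 ?mulr_ge0 ?subr_ge0 //=.
    have : 0 <= (1 - l) * (1 - t) by rewrite mulr_ge0 ?subr_ge0.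
    have : 0 <= l * (1 - t') by rewrite mulr_ge0 ?subr_ge0.
    lra.
  have [T1|Tn1] := eqVneq T 1.
    have e1 : (1 - l) * (1 - t) = 0.
      have : 0 <= (1 - l) * (1 - t) by rewrite mulr_ge0 ?subr_ge0.
      have : 0 <= l * (1 - t') by rewrite mulr_ge0 ?subr_ge0.
      rewrite /T in T1; lra.
    have e2 : l * (1 - t') = 0 by rewrite /T in T1; lra.
    exists 1, y; split; rewrite ?lexx ?ler01 //.
    rewrite !scalerDr !scalerA e1 e2 (subrr 1) !scale0r !addr0 -scalerDl.
    by rewrite -/T T1.
  have T1 : 0 < 1 - T by case/andP: hT => _ T1; rewrite subr_gt0 lt_neqAle Tn1.
  exists T, ((1 - l * (1 - t') / (1 - T)) *: y + (l * (1 - t') / (1 - T)) *: y'); split; [by []| |].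
    apply: conv_convex => //; rewrite divr_ge0 ?(ltW T1) ?mulr_ge0 ?subr_ge0 //=.
    rewrite ler_pdivrMr // mul1r /T.
    have : 0 <= (1 - l) * (1 - t) by rewrite mulr_ge0 ?subr_ge0.
    lra.
  rewrite !scalerDr !scalerA.
  have -> : (1 - T) * (l * (1 - t') / (1 - T)) = l * (1 - t') by field; rewrite gt_eqF.
  have -> : (1 - T) * (1 - l * (1 - t') / (1 - T)) = (1 - l) * (1 - t).
    by rewrite /T; field; rewrite -/T gt_eqF.
  by apply: vec_eq; rewrite !mxE /T; ring.
rewrite inE => /orP[/eqP ->|vs].
  case: s s0 => // b s _; exists 1, b; split; rewrite ?lexx ?ler01 //.
    exact/conv_mem/mem_head.
  by rewrite subrr scale0r addr0 scale1r.
exists 0, v; rewrite lexx ler01; split => //; first exact: conv_mem.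
by rewrite scale0r add0r subr0 scale1r.
Qed.

Lemma convex_halfspace x c : convex [set y | dot x y <= c].
Proof.
move=> y z t /= hy hz /andP[t0 t1]; rewrite !dotlin.
have : 0 <= (1 - t) * (c - dot x y) by rewrite mulr_ge0 ?subr_ge0.
have : 0 <= t * (c - dot x z) by rewrite mulr_ge0 ?subr_ge0.
lra.
Qed.

Lemma convexI A B : convex A -> convex B -> convex (A `&` B).
Proof. by move=> cA cB x y t [? ?] [? ?] t01; split; [exact: cA|exact: cB]. Qed.

Lemma conv_le s x c : (forall v, v \in s -> dot x v <= c) ->
  forall y, conv s y -> dot x y <= c.
Proof. exact: (@conv_sub s [set y | dot x y <= c] (@convex_halfspace x c)). Qed.

End ConvexHull.

(** * Support functions and separation *)

Section SupportFunctions.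
Variable R : realType.
Implicit Types (x y z u v w : vec R) (c t : R) (A B K P : set (vec R)) (s : seq (vec R)).

Definition bdd K := forall x, exists c, forall y, K y -> dot x y <= c.

Lemma conv_bdd s : bdd (conv s).
Proof.
move=> x; exists (\sum_(v <- s) `|dot x v|); apply: conv_le => v vs.
rewrite (le_trans (ler_norm _)) //.
by rewrite (big_rem v) //= lerDl sumr_ge0.
Qed.

Lemma bdd_sub A B : A `<=` B -> bdd B -> bdd A.
Proof. by move=> AB bB x; have [c h] := bB x; exists c => y /AB; exact: h. Qed.

Lemma supp_ge K x y : bdd K -> K y -> dot x y <= supp K x.
Proof.
move=> bK Ky; apply: ub_le_sup; last by exists y.
by have [c h] := bK x; exists c => _ [z Kz <-]; exact: h.
Qed.

Lemma supp_le K x c : K !=set0 -> (forall y, K y -> dot x y <= c) -> supp K x <= c.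
Proof.
by move=> [y Ky] h; apply: ge_sup; [exists (dot x y), y|move=> _ [z Kz <-]; exact: h].
Qed.

Lemma supp_eq K x y : K y -> (forall z, K z -> dot x z <= dot x y) -> supp K x = dot x y.
Proof.
move=> Ky h; apply/eqP; rewrite eq_le supp_le //=; last by exists y.
by apply: ub_le_sup; [exists (dot x y) => _ [z Kz <-]; exact: h|exists y].
Qed.

Lemma conv_max s x : s != [::] ->
  exists v, [/\ v \in s, conv s v & forall y, conv s y -> dot x y <= dot x v].
Proof.
move=> s0; suff [v vs h] : exists2 v, v \in s & forall v', v' \in s -> dot x v' <= dot x v.
  by exists v; split => //; [exact: conv_mem|exact: conv_le].
elim: s s0 => // a s IH _; have [->|s0] := eqVneq s [::].
  by exists a; rewrite ?mem_head // => v'; rewrite mem_seq1 => /eqP ->.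
have [v vs h] := IH s0; have [l|l] := leP (dot x a) (dot x v).
  by exists v => [|v']; rewrite inE ?vs ?orbT // => /orP[/eqP ->//|/h].
exists a => [|v']; rewrite inE ?eqxx // => /orP[/eqP ->//|/h h'].
exact: le_trans h' (ltW l).
Qed.

Lemma conv_neq0 s y : conv s y -> s != [::].
Proof. by case: s => //; rewrite conv_nil. Qed.

Lemma supp_conv s x y : conv s y -> exists2 v, conv s v & supp (conv s) x = dot x v.
Proof.
move=> /conv_neq0 /(conv_max x) [v [_ cv h]].
by exists v => //; exact: supp_eq.
Qed.

Lemma suppD K x y : K !=set0 -> bdd K -> supp K (x + y) <= supp K x + supp K y.
Proof.
move=> K0 bK; apply: supp_le => // z Kz.
by rewrite dotDl lerD // supp_ge.
Qed.

Lemma suppZ K c x : K !=set0 -> bdd K -> 0 <= c -> supp K (c *: x) = c * supp K x.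
Proof.
move=> K0 bK; rewrite le_eqVlt => /orP[/eqP <-|c0].
  rewrite mul0r scale0r; have [y Ky] := K0.
  by rewrite (supp_eq Ky) ?dot0l // => z _; rewrite !dot0l.
apply/eqP; rewrite eq_le; apply/andP; split.
  by apply: supp_le => // z Kz; rewrite dotZl ler_pM2l // supp_ge.
rewrite -ler_pdivlMl //; apply: supp_le => // z Kz.
by rewrite ler_pdivlMl // -dotZl supp_ge.
Qed.

Lemma supp_neg K x : supp (negset K) x = supp K (- x).
Proof.
rewrite /supp; congr (sup _); apply/seteqP; split=> [_ [_ [y Ky <-] <-]|_ [y Ky <-]].
  by exists y; rewrite // dotNl dotNr.
by exists (- y); [exists y|rewrite dotNl dotNr].
Qed.

Lemma supp_linimg K (phi : 'M[R]_3) x : supp (linimg phi K) x = supp K (x *m phi^T).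
Proof.
rewrite /supp; congr (sup _); apply/seteqP; split=> [_ [_ [y Ky <-] <-]|_ [y Ky <-]].
  by exists y => //; rewrite dot_mulmx.
by exists (y *m phi); [exists y|rewrite dot_mulmx].
Qed.

Lemma mink_bdd A B : bdd A -> bdd B -> bdd (mink_add A B).
Proof.
move=> bA bB x; have [a ha] := bA x; have [b hb] := bB x.
by exists (a + b) => _ [y Ay [z Bz <-]]; rewrite dotDr lerD ?ha ?hb.
Qed.

Lemma mink_neq0 A B : A !=set0 -> B !=set0 -> mink_add A B !=set0.
Proof. by move=> [a Aa] [b Bb]; exists (a + b), a => //; exists b. Qed.

Lemma supp_mink A B x : A !=set0 -> B !=set0 -> bdd A -> bdd B ->
  supp (mink_add A B) x = supp A x + supp B x.
Proof.
move=> A0 B0 bA bB; apply/eqP; rewrite eq_le; apply/andP; split.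
  apply: supp_le; first exact: mink_neq0.
  by move=> _ [y Ay [z Bz <-]]; rewrite dotDr lerD // supp_ge.
rewrite -lerBrDr; apply: supp_le => // y Ay; rewrite lerBrDr addrC -lerBrDr.
apply: supp_le => // z Bz; rewrite lerBrDr addrC -dotDr; apply: supp_ge.
  exact: mink_bdd.
by exists y => //; exists z.
Qed.

Lemma supp_dil K c x : K !=set0 -> bdd K -> 0 <= c -> supp (dil c K) x = c * supp K x.
Proof.
move=> K0 bK c0; rewrite -suppZ // /supp; congr (sup _).
apply/seteqP; split=> [_ [_ [y Ky <-] <-]|_ [y Ky <-]].
  by exists y => //; rewrite dotZl dotZr.
by exists (c *: y); [exists y|rewrite dotZl dotZr].
Qed.

Lemma dot_continuous x : continuous (fun y : vec R => dot x y).
Proof.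
move=> y; rewrite (_ : (fun y => dot x y) = fun y : vec R =>
    x ord0 o0 * y ord0 o0 + x ord0 o1 * y ord0 o1 + x ord0 o2 * y ord0 o2); last first.
  by apply/funext => z; rewrite dotE.
have h i : {for y, continuous (fun z : vec R => x ord0 i * z ord0 i)}.
  by apply: continuousM; [exact: cst_continuous|exact: coord_continuous].
exact: (continuousD (continuousD (h _) (h _)) (h _)).
Qed.

Lemma compact_bdd K : compact K -> bdd K.
Proof.
move=> cK x; have [->|/set0P K0] := eqVneq K set0; first by exists 0.
have [|c cA h] := @EVT_max_rV _ _ (dot x) K K0 cK.
  by apply: continuous_subspaceT; exact: dot_continuous.
by exists (dot x c) => y Ky; apply: h; rewrite inE.
Qed.

Lemma dist_continuous (p : vec R) : continuous (fun y : vec R => dot (p - y) (p - y)).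
Proof.
move=> y; rewrite (_ : (fun y => _) = fun y : vec R =>
    (p ord0 o0 - y ord0 o0) * (p ord0 o0 - y ord0 o0) +
    (p ord0 o1 - y ord0 o1) * (p ord0 o1 - y ord0 o1) +
    (p ord0 o2 - y ord0 o2) * (p ord0 o2 - y ord0 o2)); last first.
  by apply/funext => z; rewrite dotE !mxE.
have h i : {for y, continuous (fun z : vec R => p ord0 i - z ord0 i)}.
  by apply: continuousB; [exact: cst_continuous|exact: coord_continuous].
have h2 i := continuousM (h i) (h i).
exact: (continuousD (continuousD (h2 _) (h2 _)) (h2 _)).
Qed.

(** A point [p] of [A] outside [B] would be separated from [B] by [x = p - q], where [q] is the
    point of [B] nearest to [p]. *)
Lemma supp_subset A B : bdd A -> convex B -> compact B -> B !=set0 ->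
  (forall x, supp A x <= supp B x) -> A `<=` B.
Proof.
move=> bA cvB cB B0 le p Ap; apply: contrapT => nBp.
have [|q /set_mem Bq h] := @EVT_min_rV _ _ (fun y => dot (p - y) (p - y)) B B0 cB.
  by apply: continuous_subspaceT; exact: dist_continuous.
have [x xE] : exists x, x = p - q by exists (p - q).
have x0 : x != 0.
  by apply/eqP => x0; apply: nBp; rewrite (_ : p = q) //; apply/eqP; rewrite -subr_eq0 -xE x0.
have xx := dot_gt0 x0.
have hB y : B y -> dot x y <= dot x q.
  move=> By; rewrite leNgt; apply/negP => lt.
  have [d dE] : exists d, d = y - q by exists (y - q).
  have dp : 0 < dot x d by rewrite dE dotBr subr_gt0.
  have dd : 0 < dot d d.
    by apply: dot_gt0; apply/eqP => d0; rewrite d0 dot0r ltxx in dp.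
  (* The square of the distance changes from [|x|^2] to [|x|^2 - 2 t x.d + t^2 |d|^2], which is
     smaller for this [t], against the choice of [q]. *)
  pose t := Num.min 1 (dot x d / dot d d).
  have t0 : 0 < t by rewrite lt_min ltr01 divr_gt0.
  have t1 : t <= 1 by rewrite ge_min lexx.
  have t2 : t * dot d d <= dot x d by rewrite -ler_pdivlMr // ge_min lexx orbT.
  have := h ((1 - t) *: q + t *: y); rewrite inE => /(_ (cvB _ _ _ Bq By _)).
  rewrite (ltW t0) t1 => /(_ isT).
  have -> : p - ((1 - t) *: q + t *: y) = x - t *: d.
    by rewrite xE dE; apply: vec_eq; rewrite !mxE; ring.
  rewrite -xE !(dotBl, dotBr, dotZl, dotZr) (dotC d x) => hh.
  have : 0 <= t * (dot x d - t * dot d d) by rewrite mulr_ge0 ?subr_ge0 // ltW.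
  have : 0 < t * dot x d by rewrite mulr_gt0.
  lra.
have := le x; rewrite (supp_eq Bq hB) => l.
have := le_trans (supp_ge x bA Ap) l.
have -> : p = x + q by rewrite xE subrK.
by rewrite dotDr gerDr leNgt xx.
Qed.

Lemma supp_inj A B : convex A -> compact A -> A !=set0 -> convex B -> compact B -> B !=set0 ->
  (forall x, supp A x = supp B x) -> A = B.
Proof.
move=> vA cA A0 vB cB B0 e; apply/seteqP; split; apply: supp_subset => //.
- exact: compact_bdd.
- by move=> x; rewrite e.
- exact: compact_bdd.
- by move=> x; rewrite e.
Qed.

Lemma mink_convex A B : convex A -> convex B -> convex (mink_add A B).
Proof.
move=> vA vB _ _ t [a Aa [b Bb <-]] [a' Aa' [b' Bb' <-]] t01.
exists ((1 - t) *: a + t *: a'); first exact: vA.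
exists ((1 - t) *: b + t *: b'); first exact: vB.
by rewrite !scalerDr addrACA.
Qed.

Lemma mink_compact A B : compact A -> compact B -> compact (mink_add A B).
Proof.
move=> cA cB.
have -> : mink_add A B = (fun p : vec R * vec R => p.1 + p.2) @` (A `*` B).
  apply/seteqP; split=> [_ [a Aa [b Bb <-]]|_ [[a b] [/= Aa Bb] <-]].
    by exists (a, b).
  by exists a => //; exists b.
apply: continuous_compact; last exact: compact_setX.
apply: continuous_subspaceT => p; exact: add_continuous.
Qed.

Lemma dil_convex c A : convex A -> convex (dil c A).
Proof.
move=> vA _ _ t [a Aa <-] [a' Aa' <-] t01.
exists ((1 - t) *: a + t *: a'); first exact: vA.
by rewrite scalerDr !scalerA !(mulrC c).
Qed.

Lemma dil_compact c A : compact A -> compact (dil c A).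
Proof.
move=> cA; apply: continuous_compact cA.
apply: continuous_subspaceT => p; exact: scaler_continuous.
Qed.

End SupportFunctions.

(** * Sublinear functions *)
Section Sublinear.
Variable R : realType.
Implicit Types (x y z u v w : vec R) (c t : R) (K : set (vec R)) (h : vec R -> R).

Definition sublin h := (forall x y, h (x + y) <= h x + h y) /\
  (forall c x, 0 <= c -> h (c *: x) = c * h x).

Lemma sublin0 h : sublin h -> h 0 = 0.
Proof. by move=> [_ /(_ 0 0 (lexx _))]; rewrite scaler0 mul0r. Qed.

Lemma sublinN h x : sublin h -> 0 <= h x + h (- x).
Proof. by move=> sh; rewrite -(sublin0 sh) -{1}(subrr x); exact: sh.1. Qed.

Lemma supp_sublin K : K !=set0 -> bdd K -> sublin (supp K).
Proof. by move=> K0 bK; split=> *; [exact: suppD|exact: suppZ]. Qed.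

Lemma sublin_opp h : sublin h -> sublin (fun x => h (- x)).
Proof.
move=> [a b]; split=> [x y|c x c0]; first by rewrite opprD.
by rewrite -scalerN b.
Qed.

(* The largest sublinear minorant of [h] that is linear along the line of [v]. *)
Definition flatten_along h v x : R := inf [set h (x + t *: v) - t * h v | t in [set t | 0 <= t]].

Section Flatten.
Variables (h : vec R -> R) (v : vec R).
Hypothesis sh : sublin h.
Let g := flatten_along h v.

Lemma flatten_ge x t : 0 <= t -> g x <= h (x + t *: v) - t * h v.
Proof.
move=> t0; apply: ge_inf; last by exists t.
(* Since [h (s v) <= h (x + s v) + h (- x)], the infimum is over a set bounded below and is not a
   default value of [inf]. *)
exists (- h (- x)) => _ [s s0 <-].
have := sh.1 (x + s *: v) (- x); rewrite addrC addKr (sh.2 _ _ s0); lra.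
Qed.

Lemma le_flatten x c : (forall t, 0 <= t -> c <= h (x + t *: v) - t * h v) -> c <= g x.
Proof.
move=> H; apply: lb_le_inf; first by exists (h (x + 0 *: v) - 0 * h v), 0 => /=.
by move=> _ [s s0 <-]; exact: H.
Qed.

Lemma flatten_le x : g x <= h x.
Proof. by have := flatten_ge x (lexx 0); rewrite scale0r mul0r addr0 subr0. Qed.

Lemma flatten_sublin : sublin g.
Proof.
have Z c x : 0 < c -> c * g x <= g (c *: x).
  move=> c0; apply: le_flatten => t t0.
  have -> : h (c *: x + t *: v) - t * h v = c * (h (x + (t / c) *: v) - (t / c) * h v).
    have ct : c * (t / c) = t by field; rewrite gt_eqF.
    by rewrite mulrBr -(sh.2 c) ?(ltW c0) // scalerDr scalerA ct mulrA ct.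
  by rewrite ler_pM2l // flatten_ge // divr_ge0 // ltW.
have g0 : g 0 = 0.
  apply/eqP; rewrite eq_le -{1}(sublin0 sh) flatten_le /=; apply: le_flatten => t t0.
  by rewrite add0r sh.2 // subrr.
split.
  move=> x y; rewrite -lerBlDr; apply: le_flatten => t t0.
  rewrite lerBlDr -lerBlDl; apply: le_flatten => s s0.
  rewrite lerBlDr.
  have := flatten_ge (x + y) (addr_ge0 s0 t0).
  have := sh.1 (y + s *: v) (x + t *: v).
  rewrite (_ : y + s *: v + (x + t *: v) = x + y + (s + t) *: v); last first.
    by apply: vec_eq; rewrite !mxE; ring.
  by lra.
move=> c x; rewrite le_eqVlt => /orP[/eqP <-|c0]; first by rewrite scale0r mul0r.
apply/eqP; rewrite eq_le (Z _ _ c0) andbT.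
have := Z c^-1 (c *: x); rewrite invr_gt0 => /(_ c0).
by rewrite scalerA mulVf ?gt_eqF // scale1r ler_pdivrMl.
Qed.

Lemma flatten_linear : g (- v) = - g v /\ g v = h v.
Proof.
have a : g (- v) <= - h v.
  by have := flatten_ge (- v) ler01; rewrite scale1r addNr (sublin0 sh) sub0r mul1r.
have b := sublinN v flatten_sublin; rewrite -/g in b.
have c := flatten_le v.
by split; lra.
Qed.

Lemma flatten_keep u : h (- u) = - h u -> g (- u) = - g u /\ g u = h u.
Proof.
move=> e; have b := sublinN u flatten_sublin; rewrite -/g in b.
have c := flatten_le u; have d := flatten_le (- u).
by split; lra.
Qed.

End Flatten.

Definition bvec (i : 'I_3) : vec R := delta_mx ord0 i.

Lemma vecE x : x = x ord0 o0 *: bvec o0 + x ord0 o1 *: bvec o1 + x ord0 o2 *: bvec o2.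
Proof. by apply: vec_eq; rewrite !mxE /=; ring. Qed.

(** Flattening along [x0] keeps the value at [x0], and flattening along the coordinate vectors keeps
    the linearity already gained. The last function is sublinear and linear on each axis, hence
    linear, and [y] consists of its values on the coordinate vectors. *)
Lemma hahn_banach h x0 : sublin h ->
  exists y, (forall x, dot x y <= h x) /\ dot x0 y = h x0.
Proof.
move=> s0.
have s1 := @flatten_sublin _ x0 s0; have [l1 e1] := @flatten_linear _ x0 s0.
have le1 := @flatten_le _ x0 s0.
move: (flatten_along h x0) s1 l1 e1 le1 => h1 s1 l1 e1 le1.
have s2 := @flatten_sublin _ (bvec o0) s1; have [l2 _] := @flatten_linear _ (bvec o0) s1.
have le2 := @flatten_le _ (bvec o0) s1; have [l2' e2'] := @flatten_keep _ (bvec o0) s1 _ l1.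
move: (flatten_along h1 _) s2 l2 le2 l2' e2' => h2 s2 l2 le2 l2' e2'.
have s3 := @flatten_sublin _ (bvec o1) s2; have [l3 _] := @flatten_linear _ (bvec o1) s2.
have le3 := @flatten_le _ (bvec o1) s2; have [l3' e3'] := @flatten_keep _ (bvec o1) s2 _ l2'.
have [l30 _] := @flatten_keep _ (bvec o1) s2 _ l2.
move: (flatten_along h2 _) s3 l3 le3 l3' e3' l30 => h3 s3 l3 le3 l3' e3' l30.
have s4 := @flatten_sublin _ (bvec o2) s3; have [l4 _] := @flatten_linear _ (bvec o2) s3.
have le4 := @flatten_le _ (bvec o2) s3; have [l4' e4'] := @flatten_keep _ (bvec o2) s3 _ l3'.
have [l40 _] := @flatten_keep _ (bvec o2) s3 _ l30.
have [l41 _] := @flatten_keep _ (bvec o2) s3 _ l3.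
move: (flatten_along h3 _) s4 l4 le4 l4' e4' l40 l41 => g s4 l4 le4 l4' e4' l40 l41.
have lin i : g (- bvec i) = - g (bvec i) -> forall c, g (c *: bvec i) = c * g (bvec i).
  move=> li c; have [c0|c0] := leP 0 c; first by rewrite s4.2.
  rewrite -[c]opprK scaleNr -scalerN s4.2 ?li; last by rewrite oppr_ge0 ltW.
  by ring.
pose y := mkv (g (bvec o0)) (g (bvec o1)) (g (bvec o2)).
have up x : g x <= dot x y.
  rewrite {1}(vecE x) dotE !mkv0 !mkv1 !mkv2 -!lin //.
  by apply: le_trans (s4.1 _ _) _; rewrite lerD2r; exact: s4.1.
have E x : dot x y = g x.
  apply/eqP; rewrite eq_le up andbT.
  by have := up (- x); rewrite dotNl; have := sublinN x s4; lra.
exists y; split => [x|]; last by rewrite E e4' e3' e2' e1.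
rewrite E; apply: le_trans (le4 _) _; apply: le_trans (le3 _) _.
by apply: le_trans (le2 _) _; exact: le1.
Qed.

Lemma body_of_bdd h : bdd (body_of h).
Proof. by move=> x; exists (h x) => y; exact. Qed.

Lemma body_of_convex h : convex (body_of h).
Proof. by move=> x y t hx hy t01 z; apply: convex_halfspace (hx z) (hy z) t01. Qed.

Lemma body_of_compact h : compact (body_of h).
Proof.
have hE : body_of h = \bigcap_(x in [set: vec R]) [set y | dot x y <= h x].
  by apply/seteqP; split=> [y hy x _|y hy x]; [exact: hy|exact: (hy x I)].
apply: bounded_closed_compact.
  pose M := Num.max 0 (\big[Num.max/0]_(i < 3) Num.max (h (bvec i)) (h (- bvec i))).
  exists M; split; first by rewrite num_real.
  move=> m Mm y hy /=.
  have m0 : 0 <= m by apply: le_trans (ltW Mm); rewrite /M le_max lexx.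
  rewrite [leLHS]/Num.norm /= mx_normrE; apply/bigmax_leP; split => // -[i j] _ /=.
  rewrite (ord1 i).
  have lem : Num.max (h (bvec j)) (h (- bvec j)) <= m.
    by apply: le_trans (ltW Mm); rewrite /M le_max; apply/orP; right; apply: le_bigmax.
  move: lem; rewrite ge_max => /andP[a b].
  have e : dot (bvec j) y = y ord0 j.
    by rewrite dotE !mxE /=; move: j {a b}; apply: ord3P => /=; rewrite ?mul1r ?mul0r; ring.
  rewrite ler_norml lerNl -e -dotNl; apply/andP; split; last exact: le_trans (hy _) a.
  exact: le_trans (hy _) b.
rewrite hE; apply: closed_bigI => x _.
rewrite (_ : [set y | _] = (dot x) @^-1` [set t | t <= h x]) //.
by apply: preimage_closed => [y _|]; [exact: dot_continuous|exact: closed_le].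
Qed.

Lemma supp_body_of h x : sublin h -> supp (body_of h) x = h x.
Proof.
move=> sh; have [y [le e]] := hahn_banach x sh.
by rewrite (@supp_eq _ _ x y) // => z hz; rewrite e; exact: hz.
Qed.

Lemma body_of_neq0 h : sublin h -> body_of h !=set0.
Proof. by move=> /(hahn_banach 0) [y [le _]]; exists y. Qed.

End Sublinear.

(** * Half-space cuts of polytopes *)
Section Cuts.
Variable R : realType.
Implicit Types (x y z u v w n : vec R) (c t : R) (K P : set (vec R)) (s : seq (vec R)).

(** The weights are grouped by [p], and the third case is a segment between the two groups. Adding a
    generator to either group is the same step up to exchanging [p] with its complement, hence the
    [wlog]. *)
Lemma conv_split s (p : pred (vec R)) x : conv s x ->
  [\/ conv (seq.filter p s) x, conv (seq.filter (predC p) s) x |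
   exists a b t, [/\ conv (seq.filter p s) a, conv (seq.filter (predC p) s) b, 0 <= t <= 1 &
     x = (1 - t) *: a + t *: b]].
Proof.
wlog suff W : p / forall a s' y t, 0 <= t <= 1 -> p a ->
    [\/ conv (seq.filter p s') y, conv (seq.filter (predC p) s') y |
     exists a b t, [/\ conv (seq.filter p s') a, conv (seq.filter (predC p) s') b, 0 <= t <= 1 &
     y = (1 - t) *: a + t *: b]] ->
    [\/ conv (a :: seq.filter p s') (t *: a + (1 - t) *: y),
      conv (seq.filter (predC p) s') (t *: a + (1 - t) *: y) |
     exists a' b t', [/\ conv (a :: seq.filter p s') a', conv (seq.filter (predC p) s') b, 0 <= t' <= 1 &
     t *: a + (1 - t) *: y = (1 - t') *: a' + t' *: b]].
  elim: s x => [|a s IH] x; first by rewrite conv_nil.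
  have [->|s0] := eqVneq s [::].
    move=> h; rewrite /=; have [pa|pa] := boolP (p a); first by constructor 1.
    by rewrite /=; constructor 2.
  move=> /conv_cons => /(_ s0) [t [y [t01 /IH sy ->]]] /=.
  have [pa|pa] := boolP (p a); rewrite /=; first exact: (W p).
  have pC : predC (predC p) =1 p by move=> v /=; rewrite negbK.
  have := W (predC p) a s y t t01 pa; rewrite (eq_filter pC).
  case.
  - case: sy => [?|?|[a' [b [t' [ha hb t01' ->]]]]]; [by constructor 2|by constructor 1|].
    constructor 3; exists b, a', (1 - t'); split => //; first lra.
    by rewrite (_ : 1 - (1 - t') = t'); [rewrite addrC|ring].
  - by move=> ?; constructor 2.
  - by move=> ?; constructor 1.
  - move=> [a' [b [t' [ha hb t01' ->]]]].
    constructor 3; exists b, a', (1 - t'); split => //; first lra.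
    by rewrite (_ : 1 - (1 - t') = t'); [rewrite addrC|ring].
move=> a s' y t /[dup] t01 /andP[t0 t1] pa.
have sub : conv (seq.filter p s') `<=` conv (a :: seq.filter p s').
  by apply: conv_subset => v; rewrite inE orbC => ->.
have Ka : conv (a :: seq.filter p s') a by exact/conv_mem/mem_head.
case.
- by move=> /sub h; constructor 1; rewrite addrC; apply: conv_convex.
- move=> h; constructor 3; exists a, y, (1 - t); split => //; first lra.
  by rewrite (_ : 1 - (1 - t) = t) //; ring.
move=> [b [d [t' [hb hd /andP[t0' t1'] ->]]]].
(* [m] is the total weight of the points satisfying [p]. *)
have [m mE] : exists m, m = t + (1 - t) * (1 - t') by eexists.
have m0 : 0 <= (1 - t) * (1 - t') by rewrite mulr_ge0 ?subr_ge0.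
have m1 : 0 <= (1 - t) * t' by rewrite mulr_ge0 ?subr_ge0.
have [m_0|mn0] := eqVneq m 0.
  constructor 2; have -> : t *: a + (1 - t) *: ((1 - t') *: b + t' *: d) = d => //.
  have tE : t = 0 by rewrite mE in m_0; lra.
  have t'E : t' = 1 by rewrite mE tE in m_0; lra.
  by rewrite tE t'E; apply: vec_eq; rewrite !mxE; ring.
have mp : 0 < m by rewrite lt_neqAle eq_sym mn0 /=; lra.
constructor 3; exists ((1 - (1 - t) * (1 - t') / m) *: a + ((1 - t) * (1 - t') / m) *: b), d, (1 - m).
split => //; [|lra|].
  apply: conv_convex => //; first exact: sub.
  by rewrite divr_ge0 ?(ltW mp) //= ler_pdivrMr // mul1r; lra.
rewrite (_ : 1 - (1 - m) = m); last ring.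
by apply: vec_eq; rewrite !mxE mE; field; rewrite -mE gt_eqF.
Qed.

(** The point where the line through [u] and [v] meets the plane orthogonal to [n]. *)
Definition crossing n u v : vec R :=
  (dot n u - dot n v)^-1 *: (dot n u *: v - dot n v *: u).

Lemma dot_crossing n u v : dot n (crossing n u v) = 0.
Proof. by rewrite /crossing dotZr dotBr !dotZr (mulrC (dot n v)) subrr mulr0. Qed.

Lemma crossing_conv K n u v : convex K -> 0 <= dot n u -> dot n v < 0 ->
  K u -> K v -> K (crossing n u v).
Proof.
move=> cK hu hv Ku Kv.
have d0 : 0 < dot n u - dot n v by lra.
rewrite (_ : crossing n u v = (1 - dot n u / (dot n u - dot n v)) *: u +
   (dot n u / (dot n u - dot n v)) *: v).
  by apply: cK => //; rewrite divr_ge0 ?(ltW d0) //= ler_pdivrMr // mul1r; lra.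
by apply: vec_eq; rewrite !mxE; field; rewrite gt_eqF.
Qed.

(** With [u] fixed the crossing is a projective map of [v]: it carries segments to segments, but the
    weight [t] has to be replaced by [t (c - b) / d]. *)
Lemma crossing_convexr K n u : convex K -> 0 <= dot n u ->
  convex [set v | dot n v < 0 /\ K (crossing n u v)].
Proof.
move=> cK hu v v' t /= [hv Kv] [hv' Kv'] /andP[t0 t1].
set c := dot n u in hu *; set a := dot n v in hv; set b := dot n v' in hv'.
have hm : 0 <= (1 - t) * - a + t * - b.
  by rewrite addr_ge0 // mulr_ge0 ?subr_ge0 // oppr_ge0 ltW.
have dE : dot n ((1 - t) *: v + t *: v') = (1 - t) * a + t * b by rewrite !dotlin.
have ht : (1 - t) * a + t * b < 0.
  have [t00|tn0] := eqVneq t 0; first by rewrite t00; lra.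
  have : t * b < 0 by rewrite pmulr_rlt0 // lt_neqAle eq_sym tn0.
  have : (1 - t) * a <= 0 by rewrite mulr_ge0_le0 ?subr_ge0 // ltW.
  lra.
split; first by rewrite dE.
rewrite /crossing dE -/c; set d := c - _.
have d0 : 0 < d by rewrite /d; lra.
have ca : 0 < c - a by lra.
have cb : 0 < c - b by lra.
have := cK _ _ (t * (c - b) / d) Kv Kv'.
have r0 : 0 <= t * (c - b) / d by rewrite divr_ge0 ?(ltW d0) // mulr_ge0 // ltW.
have r1 : t * (c - b) / d <= 1.
  rewrite ler_pdivrMr // mul1r /d.
  have : 0 <= (1 - t) * (c - a) by rewrite mulr_ge0 ?subr_ge0 //; lra.
  lra.
rewrite r0 r1 => /(_ isT); rewrite /crossing -/c -/a -/b.
set X := (X in K X -> _); set Y := (Y in _ -> K Y); suff -> : X = Y by [].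
rewrite /X /Y; apply: vec_eq; rewrite !mxE /d; field;
  by rewrite ?(gt_eqF ca) ?(gt_eqF cb) ?(gt_eqF d0).
Qed.

Lemma crossing_convexl K n v : convex K -> dot n v < 0 ->
  convex [set u | 0 <= dot n u /\ K (crossing n u v)].
Proof.
move=> cK hv u u' t /= [hu Ku] [hu' Ku'] /andP[t0 t1].
set c := dot n v in hv *; set a := dot n u in hu; set b := dot n u' in hu'.
have dE : dot n ((1 - t) *: u + t *: u') = (1 - t) * a + t * b by rewrite !dotlin.
have ht : 0 <= (1 - t) * a + t * b by rewrite addr_ge0 // mulr_ge0 ?subr_ge0.
split; first by rewrite dE.
rewrite /crossing dE -/c; set d := _ - c.
have d0 : 0 < d by rewrite /d; lra.
have ca : 0 < a - c by lra.
have cb : 0 < b - c by lra.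
have := cK _ _ (t * (b - c) / d) Ku Ku'.
have r0 : 0 <= t * (b - c) / d by rewrite divr_ge0 ?(ltW d0) // mulr_ge0 // ltW.
have r1 : t * (b - c) / d <= 1.
  rewrite ler_pdivrMr // mul1r /d.
  have : 0 <= (1 - t) * (a - c) by rewrite mulr_ge0 ?subr_ge0 //; lra.
  lra.
rewrite r0 r1 => /(_ isT); rewrite /crossing -/c -/a -/b.
set X := (X in K X -> _); set Y := (Y in _ -> K Y); suff -> : X = Y by [].
rewrite /X /Y; apply: vec_eq; rewrite !mxE /d; field;
  by rewrite ?(gt_eqF ca) ?(gt_eqF cb) ?(gt_eqF d0).
Qed.

(** The half is generated by the generators it contains and by the crossings of the segments that
    leave it. *)
Lemma conv_cut s n : exists s', conv s `&` [set y | 0 <= dot n y] = conv s'.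
Proof.
pose p v := 0 <= dot n v.
pose s1 := seq.filter p s; pose s2 := seq.filter (predC p) s.
exists (s1 ++ [seq crossing n u v | u <- s1, v <- s2]).
set s' := _ ++ _.
have cC : convex [set y | 0 <= dot n y].
  by move=> x y t /= hx hy /andP[t0 t1]; rewrite !dotlin addr_ge0 // mulr_ge0 ?subr_ge0.
have s1sub : conv s1 `<=` conv s'.
  by apply: conv_subset => v; rewrite mem_cat => ->.
have s2neg v : v \in s2 -> dot n v < 0.
  by rewrite mem_filter /= -ltNge => /andP[].
have c1 : forall y, conv s1 y -> 0 <= dot n y.
  by apply: (@conv_sub _ _ [set y | 0 <= dot n y]) => // v; rewrite mem_filter => /andP[].
have c2 : forall y, conv s2 y -> dot n y < 0.
  move=> y hy; have [m [ms _ h]] := conv_max n (conv_neq0 hy).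
  exact: le_lt_trans (h _ hy) (s2neg _ ms).
apply/seteqP; split.
  move=> x [sx /= x0].
  (* The crossing is projective in each argument separately, so the claim is reduced to generators
     first in [a], then in [b]. *)
  have cr a b : conv s1 a -> conv s2 b -> conv s' (crossing n a b).
    move=> ha hb; have hb0 := c2 _ hb.
    move: a ha; apply: (fun h a ha => (conv_sub (@crossing_convexl (conv s') n b (@conv_convex _ s') hb0) h ha).2).
    move=> u us /=; split; first by move: us; rewrite mem_filter => /andP[].
    have u0 : 0 <= dot n u by move: us; rewrite mem_filter => /andP[].
    apply: (conv_sub (@crossing_convexr (conv s') n u (@conv_convex _ s') u0) _ hb).2.
    move=> v vs /=; split; first exact: s2neg.
    by apply: conv_mem; rewrite mem_cat; apply/orP; right; apply/allpairsP; exists (u, v).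
  case: (conv_split p sx) => [/s1sub//|/c2|[a [b [t [ha hb /andP[t0 t1] xE]]]]]; first lra.
  have hz := cr _ _ ha hb; have a0 := c1 _ ha; have b0 := c2 _ hb.
  move: x0; rewrite xE !dotlin => x0.
  have ab : 0 < dot n a - dot n b by lra.
  have [an0|anz] := eqVneq (dot n a) 0.
    have t00 : t = 0.
      apply/eqP; rewrite eq_le t0 andbT leNgt; apply/negP => tp.
      have : t * dot n b < 0 by rewrite pmulr_rlt0.
      by rewrite an0 in x0; lra.
    by rewrite t00 subr0 scale1r scale0r addr0; exact: s1sub.
  have ap : 0 < dot n a by rewrite lt_neqAle eq_sym anz.
  (* As [x] lies in the half-space, it is between [a] and the crossing of the segment from [a] to
     [b]. *)
  rewrite (_ : _ + _ = (1 - t * (dot n a - dot n b) / dot n a) *: a +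
     (t * (dot n a - dot n b) / dot n a) *: crossing n a b).
    apply: conv_convex => //; first exact: s1sub.
    rewrite divr_ge0 ?mulr_ge0 ?(ltW ap) ?(ltW ab) //= ler_pdivrMr // mul1r.
    lra.
  by rewrite /crossing scalerA; apply: vec_eq; rewrite !mxE; field; rewrite ?anz ?(gt_eqF ab).
apply: (@conv_sub _ s' (conv s `&` [set y | 0 <= dot n y])) => [|v]; first by apply: convexI => //; exact: conv_convex.
rewrite mem_cat => /orP[|/allpairsP[[u w] /= [us ws ->]]].
  by rewrite mem_filter => /andP[? ?]; split => //; exact: conv_mem.
split; last by rewrite /= dot_crossing.
have := us; have := ws; rewrite !mem_filter => /andP[_ ws'] /andP[u0 us'].
by apply: crossing_conv => //; [exact: conv_convex|exact: s2neg|exact: conv_mem|exact: conv_mem].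
Qed.

Lemma polytope_cut P n : polytope_o P -> polytope_o (P `&` [set y | 0 <= dot n y]).
Proof.
move=> [[s ->] s0]; have [s' e] := conv_cut s n.
by split; [exists s'|split => //=; rewrite dot0r].
Qed.

Lemma polytope_cutN P n : polytope_o P -> polytope_o (P `&` [set y | dot n y <= 0]).
Proof.
move=> /(polytope_cut (- n)); congr polytope_o; congr (_ `&` _).
by apply/seteqP; split=> y /=; rewrite dotNl oppr_ge0.
Qed.

Lemma polytope_cut0 P n : polytope_o P -> polytope_o (P `&` [set y | dot n y = 0]).
Proof.
move=> /(polytope_cut n)/(polytope_cutN n); congr polytope_o; rewrite -setIA; congr (_ `&` _).
apply/seteqP; split=> y /=; first by move=> [a b]; apply/eqP; rewrite eq_le a b.
by move=> ->.
Qed.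

Lemma polytope_convex P : polytope_o P -> convex P.
Proof. by move=> [[s ->] _]; exact: conv_convex. Qed.

Lemma polytope_bdd P : polytope_o P -> bdd P.
Proof. by move=> [[s ->] _]; exact: conv_bdd. Qed.

Lemma polytope_neq0 P : polytope_o P -> P !=set0.
Proof. by move=> [_ P0]; exists 0. Qed.

End Cuts.

(** * Polytopes as intersections of half-spaces *)

Section HalfspaceRepresentation.
Variable R : realType.
Implicit Types (x y z u v w n : vec R) (c t : R) (K P : set (vec R)) (s : seq (vec R)).

Definition poly_sys (L : seq (vec R * R)) x := forall p, p \in L -> dot p.1 x <= p.2.

Lemma exists_between (U L : seq R) : (forall u l : R, u \in U -> l \in L -> l <= u) ->
  exists t, (forall u : R, u \in U -> t <= u) /\ (forall l : R, l \in L -> l <= t).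
Proof.
elim: L => [|a L IH] h.
  elim: U {h} => [|a U [t [h _]]]; first by exists 0.
  exists (Num.min t a); split => // u; rewrite inE => /orP[/eqP ->|/h]; rewrite ge_min ?lexx ?orbT //.
  by move=> ->.
have [|t [h1 h2]] := IH; first by move=> u l uU lL; apply: h => //; rewrite inE lL orbT.
exists (Num.max t a); split=> [u uU|l]; first by rewrite ge_max h1 // h // mem_head.
by rewrite inE le_max => /orP[/eqP ->|/h2 ->//]; rewrite lexx orbT.
Qed.

(* One step of Fourier–Motzkin elimination: a triple [(l, b, c)] is the inequality
   [dot l x + b t <= c], and the unknown [t] is eliminated. *)
Lemma fourier_motzkin (M : seq (vec R * R * R)) : exists L, forall x,
  poly_sys L x <-> exists t, forall q, q \in M -> dot q.1.1 x + q.1.2 * t <= q.2.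
Proof.
pose Z := [seq (q.1.1, q.2) | q <- M & q.1.2 == 0].
pose U := [seq q <- M | 0 < q.1.2]; pose D := [seq q <- M | q.1.2 < 0].
pose C := [seq (- j.1.2 *: i.1.1 + i.1.2 *: j.1.1, - j.1.2 * i.2 + i.1.2 * j.2) | i <- U, j <- D].
exists (Z ++ C) => x; split => [H|[t H] p].
  pose f (q : vec R * R * R) := (q.2 - dot q.1.1 x) / q.1.2.
  have [|t [h1 h2]] := @exists_between (map f U) (map f D).
    move=> _ _ /mapP[i iU ->] /mapP[j jD ->].
    have := H (- j.1.2 *: i.1.1 + i.1.2 *: j.1.1, - j.1.2 * i.2 + i.1.2 * j.2).
    have -> : (- j.1.2 *: i.1.1 + i.1.2 *: j.1.1, - j.1.2 * i.2 + i.1.2 * j.2) \in Z ++ C.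
      by rewrite mem_cat; apply/orP; right; apply/allpairsP; exists (i, j).
    move=> /(_ isT) /=; rewrite !dotlin => le.
    move: iU jD; rewrite !mem_filter => /andP[i0 _] /andP[j0 _].
    rewrite /f ler_ndivrMr // mulrAC ler_pdivrMr //; lra.
  exists t => q qM; have [q0|q0|q0] := ltgtP q.1.2 0.
  - have := h2 (f q); rewrite map_f ?mem_filter ?q0 // => /(_ isT).
    rewrite /f ler_ndivrMr //; lra.
  - have := h1 (f q); rewrite map_f ?mem_filter ?q0 // => /(_ isT).
    rewrite /f ler_pdivlMr //; lra.
  - rewrite q0 mul0r addr0; apply: (H (q.1.1, q.2)).
    rewrite mem_cat; apply/orP; left; apply/mapP; exists q => //.
    by rewrite mem_filter q0 eqxx.
rewrite mem_cat => /orP[/mapP[q]|/allpairsP[[i j] /= [iU jD ->]]] /=.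
  by rewrite mem_filter => /andP[/eqP q0 qM] -> /=; have := H q qM; rewrite q0 mul0r addr0.
move: iU jD; rewrite !mem_filter => /andP[i0 iM] /andP[j0 jM].
have hi := H i iM; have hj := H j jM; rewrite !dotlin.
have : 0 <= - j.1.2 * (i.2 - (dot i.1.1 x + i.1.2 * t)).
  by rewrite mulr_ge0 ?subr_ge0 // oppr_ge0 ltW.
have : 0 <= i.1.2 * (j.2 - (dot j.1.1 x + j.1.2 * t)).
  by rewrite mulr_ge0 ?subr_ge0 // ltW.
lra.
Qed.

(** By [conv_cons] the hull of [a :: s] is the projection of the set of all [(x, t)] with
    [0 <= t <= 1] and [x - t a] in [(1 - t) conv s]. By induction this is a linear system, from
    which [t] is eliminated. *)
Lemma conv_hrep s : s != [::] -> exists L, forall x, conv s x <-> poly_sys L x.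
Proof.
elim: s => // a s IH _; have [->|s0] := eqVneq s [::].
  exists (flatten [seq [:: (bvec R i, dot (bvec R i) a); (- bvec R i, - dot (bvec R i) a)] |
    i <- [:: o0; o1; o2]]) => x; split.
    move=> hx [l c] pL; have := @conv_le _ [:: a] l c; apply; last exact: hx.
    move=> v; rewrite mem_seq1 => /eqP ->; move: pL.
    by rewrite !inE => /or4P[/eqP[-> ->]|/eqP[-> ->]|/eqP[-> ->]|/or3P[/eqP[-> ->]|/eqP[-> ->]|/eqP[-> ->]]];
      rewrite ?dotNl.
  move=> H; suff -> : x = a by exact/conv_mem/mem_head.
  have e i : dot (bvec R i) x = x ord0 i.
    by rewrite dotE !mxE /=; move: i; apply: ord3P => /=; rewrite ?mul1r ?mul0r; ring.
  have e' i : dot (bvec R i) a = a ord0 i.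
    by rewrite dotE !mxE /=; move: i; apply: ord3P => /=; rewrite ?mul1r ?mul0r; ring.
  have E i : i \in [:: o0; o1; o2] -> x ord0 i = a ord0 i.
    move=> io; apply/eqP; rewrite -e -e' eq_le.
    have := H (bvec R i, dot (bvec R i) a); have := H (- bvec R i, - dot (bvec R i) a).
    have h1 : (bvec R i, dot (bvec R i) a) \in flatten [seq [:: (bvec R i, dot (bvec R i) a); (- bvec R i, - dot (bvec R i) a)] |
      i <- [:: o0; o1; o2]].
      by apply/flatten_mapP; exists i => //; rewrite mem_head.
    have h2 : (- bvec R i, - dot (bvec R i) a) \in flatten [seq [:: (bvec R i, dot (bvec R i) a); (- bvec R i, - dot (bvec R i) a)] |
      i <- [:: o0; o1; o2]].
      by apply/flatten_mapP; exists i => //; rewrite !inE eqxx orbT.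
    by move=> /(_ h2) /= + /(_ h1) /= ->; rewrite dotNl lerN2.
  by apply: vec_eq; apply: E.
have [L LP] := IH s0.
have [L' LP'] := fourier_motzkin ([seq (p.1, p.2 - dot p.1 a, p.2) | p <- L] ++
   [:: (0, -1, 0); (0, 1, 1)]).
exists L' => x; rewrite (LP' x) conv_cons //; split.
  move=> [t [y [/andP[t0 t1] /LP sy ->]]]; exists t => q; rewrite mem_cat !inE.
  move=> /or3P[/mapP[p pL ->]|/eqP ->|/eqP ->] /=; rewrite ?dotlin; [|lra|lra].
  have : 0 <= (1 - t) * (p.2 - dot p.1 y) by rewrite mulr_ge0 ?subr_ge0 // sy.
  lra.
move=> [t H].
have t0 : 0 <= t by have := H (0, -1, 0); rewrite mem_cat !inE eqxx /= orbT => /(_ isT); rewrite dotlin; lra.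
have t1 : t <= 1 by have := H (0, 1, 1); rewrite mem_cat !inE eqxx /= !orbT => /(_ isT); rewrite dotlin; lra.
have HL p : p \in L -> dot p.1 x - t * dot p.1 a <= (1 - t) * p.2.
  move=> pL; have := H (p.1, p.2 - dot p.1 a, p.2).
  rewrite mem_cat (map_f (fun p => (p.1, p.2 - dot p.1 a, p.2)) pL) => /(_ isT) /=; lra.
(* At [t = 1] the system only says that [x - a] is a recession direction of [conv s]; boundedness
   then forces [x = a]. *)
have [tE|tn1] := eqVneq t 1.
  exists 1, (head a s); rewrite lexx ler01; split => //.
    by case: s s0 {IH LP} => // b s _; exact/conv_mem/mem_head.
  rewrite subrr scale0r addr0 scale1r.
  have [y0 sy0] : exists y, conv s y.
    by case: s s0 {IH LP} => // b s _; exists b; exact/conv_mem/mem_head.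
  have HL' p : p \in L -> dot p.1 (x - a) <= 0.
    by move=> /HL; rewrite tE dotBr; lra.
  have ray k : 0 <= k -> conv s (y0 + k *: (x - a)).
    move=> k0; apply/LP => p pL; rewrite dotDr dotZr.
    have : k * dot p.1 (x - a) <= 0 by rewrite mulr_ge0_le0 // HL'.
    by have := (LP y0).1 sy0 p pL; lra.
  have [c hc] := conv_bdd s (x - a).
  apply/eqP; rewrite -subr_eq0; apply/eqP/dot_eq0/eqP; rewrite eq_le dot_ge0 andbT leNgt.
  apply/negP => pos.
  have b0 := hc _ sy0.
  have k0 : 0 <= (c - dot (x - a) y0 + 1) / dot (x - a) (x - a) by rewrite divr_ge0 ?(ltW pos) //; lra.
  have := hc _ (ray _ k0); rewrite dotDr dotZr divfK ?gt_eqF //; lra.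
have u0 : 0 < 1 - t by rewrite subr_gt0 lt_neqAle tn1.
exists t, ((1 - t)^-1 *: (x - t *: a)); rewrite t0 t1; split => //; last first.
  by rewrite scalerA divff ?gt_eqF // scale1r addrC subrK.
by apply/LP => p /HL h; rewrite dotZr dotBr dotZr ler_pdivrMl.
Qed.

Lemma polytope_hrep P : polytope_o P ->
  exists L, (forall x, P x <-> poly_sys L x) /\ (forall p, p \in L -> 0 <= p.2).
Proof.
move=> [[s ->] s0]; have [L LP] := conv_hrep (conv_neq0 s0).
exists L; split => // p pL; rewrite -(dot0r p.1); exact: (LP 0).1.
Qed.

End HalfspaceRepresentation.

(** * Dimension and faces at the origin *)
Section Dimension.
Variable R : realType.
Implicit Types (x y z u v w n e : vec R) (c t : R) (A E F K P : set (vec R)).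

Lemma det_det3 (M : 'M[R]_3) : \det M = det3 (row o0 M) (row o1 M) (row o2 M).
Proof.
have a1 : lift o0 (ord0 : 'I_2) = o1 by apply/val_inj.
have a2 : lift o0 (lift ord0 ord0 : 'I_2) = o2 by apply/val_inj.
have b1 : lift o1 (ord0 : 'I_2) = o0 by apply/val_inj.
have b2 : lift o1 (lift ord0 ord0 : 'I_2) = o2 by apply/val_inj.
have c1 : lift o2 (ord0 : 'I_2) = o0 by apply/val_inj.
have c2 : lift o2 (lift ord0 ord0 : 'I_2) = o1 by apply/val_inj.
have d1 : lift (ord0 : 'I_2) (ord0 : 'I_1) = lift ord0 ord0 by apply/val_inj.
have d2 : lift (lift ord0 ord0 : 'I_2) (ord0 : 'I_1) = ord0 by apply/val_inj.
rewrite (expand_det_row _ o0) sum3E /cofactor !(expand_det_row _ (ord0 : 'I_2)).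
rewrite !big_ord_recl !big_ord0 /cofactor !det_mx11 !mxE det3E !mxE.
rewrite ?(a1, a2, b1, b2, c1, c2, d1, d2).
rewrite /= /bump /=.
rewrite !(addn0, add0n) !expr0 !expr1 !expr2.
move: (M o0 o0) (M o0 o1) (M o0 o2) (M o1 o0) (M o1 o1) (M o1 o2) (M o2 o0) (M o2 o1) (M o2 o2).
by move=> *; ring.
Qed.

Lemma free1 v : v != 0 -> row_free (v : 'M[R]_(1, 3)).
Proof.
move=> v0; apply: inj_row_free => w.
rewrite mulmx_sum_row big_ord1 row_id => /eqP; rewrite scaler_eq0 (negbTE v0) orbF => /eqP w0.
by apply/rowP => i; rewrite (ord1 i) w0 mxE.
Qed.

Definition mx2 u v : 'M[R]_(2, 3) := \matrix_(i < 2) (if i == ord0 then u else v).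
Definition mx3 u v w : 'M[R]_3 := \matrix_(i < 3) (if i == o0 then u else if i == o1 then v else w).

Lemma row_mx3 u v w : [/\ row o0 (mx3 u v w) = u, row o1 (mx3 u v w) = v & row o2 (mx3 u v w) = w].
Proof. by split; rewrite rowK. Qed.

Lemma det_mx3 u v w : \det (mx3 u v w) = det3 u v w.
Proof. by have [e0 e1 e2] := row_mx3 u v w; rewrite det_det3 e0 e1 e2. Qed.

(** For sets through the origin the affine dimension is a linear one, so it can be tested by nonzero
    vectors, cross products and triple products of points of the set. *)
Lemma affdim1P A : A 0 -> affdim_ge A 1 <-> exists2 e, A e & e != 0.
Proof.
move=> A0; split=> [[p [M [Ap [AM fM]]]]|[e Ae e0]]; last first.
  exists 0, (e : 'M[R]_(1, 3)); split => //; split; last exact: free1.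
  by move=> i; rewrite (ord1 i) row_id add0r.
have [p0|pn0] := eqVneq p 0; last by exists p.
exists (row 0 M); first by have := AM 0; rewrite p0 add0r.
apply/eqP => r0; have := mulmx_free_eq0 (1 : 'M[R]_1) fM.
by rewrite mulmx_sum_row big_ord1 r0 scaler0 eqxx => /esym/eqP/(congr1 (fun N => fun_of_matrix N ord0 0));
  rewrite !mxE => /eqP; rewrite oner_eq0.
Qed.

Lemma affdim2P A : A 0 -> affdim_ge A 2 <-> exists e1 e2, [/\ A e1, A e2 & cross e1 e2 != 0].
Proof.
move=> A0; split=> [[p [M [Ap [AM fM]]]]|[e1 [e2 [A1 A2 c0]]]]; last first.
  exists 0, (mx2 e1 e2); split => //; split.
    by move=> i; rewrite rowK add0r; case: ifP.
  apply: inj_row_free => w; rewrite mulmx_sum_row !big_ord_recl big_ord0 !rowK /= addr0 => e.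
  have h1 : w 0 ord0 *: cross e1 e2 = 0.
    by have := congr1 (fun z : vec R => cross z e2) e; rewrite crossDl !crossZl crossxx scaler0 addr0 cross0l.
  have h2 : w 0 (lift ord0 ord0) *: cross e1 e2 = 0.
    by have := congr1 (fun z : vec R => cross e1 z) e; rewrite crossDr !crossZr crossxx scaler0 add0r cross0r.
  apply/rowP => i; rewrite mxE; apply/eqP.
  move/eqP: h1; move/eqP: h2; rewrite !scaler_eq0 (negbTE c0) !orbF => /eqP h2 /eqP h1.
  by case: (unliftP ord0 i) => [j ->|->]; rewrite ?(ordP0 j) ?h1 ?h2.
pose a := row ord0 M; pose b := row (lift ord0 ord0) M.
have cab : cross a b != 0.
  have fr (s t : R) : s *: a + t *: b = 0 -> s = 0 /\ t = 0.
    move=> e; pose w : 'rV[R]_2 := \row_i (if i == ord0 then s else t).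
    have := mulmx_free_eq0 w fM.
    rewrite mulmx_sum_row !big_ord_recl big_ord0 addr0 !mxE /= -/a -/b e eqxx.
    move=> /esym/eqP w0; split; first by have := congr1 (fun N => fun_of_matrix N ord0 ord0) w0; rewrite !mxE.
    by have := congr1 (fun N => fun_of_matrix N ord0 (lift ord0 ord0)) w0; rewrite !mxE.
  apply/eqP => c0; have [a0|an0] := eqVneq a 0.
    have := fr 1 0; rewrite a0 scaler0 scale0r addr0 => /(_ erefl)[/eqP].
    by rewrite oner_eq0.
  have := cross_eq0 an0 c0; set k := _ / _ => be.
  have := fr (- k) 1; rewrite scale1r {1}be scaleNr addNr => /(_ erefl)[_ /eqP].
  by rewrite oner_eq0.
have Aa : A (p + a) := AM _; have Ab : A (p + b) := AM _.
have [c1|c1] := eqVneq (cross p (p + a)) 0; last by exists p, (p + a).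
have [c2|c2] := eqVneq (cross p (p + b)) 0; last by exists p, (p + b).
exists (p + a), (p + b); split => //.
(* If [p] is parallel to both other points, it drops out, and their product is that of [a] and
   [b]. *)
move: c1 c2; rewrite !crossDr !crossDl !crossxx !add0r => c1 c2.
by rewrite c2 (crossN a p) c1 oppr0 !add0r.
Qed.

Lemma affdim3P A : A 0 ->
  affdim_ge A 3 <-> exists e1 e2 e3, [/\ A e1, A e2, A e3 & det3 e1 e2 e3 != 0].
Proof.
move=> A0; split=> [[p [M [Ap [AM fM]]]]|[e1 [e2 [e3 [A1 A2 A3 d0]]]]]; last first.
  exists 0, (mx3 e1 e2 e3); split => //; split.
    by move=> i; rewrite rowK add0r; do 2 case: ifP => // _.
  by rewrite row_free_unit unitmxE det_mx3 unitfE.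
move: fM; rewrite row_free_unit unitmxE unitfE det_det3.
set a := row o0 M; set b := row o1 M; set c := row o2 M => d0.
have Aa : A (p + a) := AM _; have Ab : A (p + b) := AM _; have Ac : A (p + c) := AM _.
have [c1|c1] := eqVneq (det3 p (p + a) (p + b)) 0; last by exists p, (p + a), (p + b).
have [c2|c2] := eqVneq (det3 p (p + a) (p + c)) 0; last by exists p, (p + a), (p + c).
have [c3|c3] := eqVneq (det3 p (p + b) (p + c)) 0; last by exists p, (p + b), (p + c).
exists (p + a), (p + b), (p + c); split => //.
suff -> : det3 (p + a) (p + b) (p + c) = det3 a b c + det3 p (p + a) (p + b) -
  det3 p (p + a) (p + c) + det3 p (p + b) (p + c) by rewrite c1 c2 c3 subr0 !addr0.
by rewrite !det3E !mxE; ring.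
Qed.

Lemma affdim_sub A B k : A `<=` B -> affdim_ge A k -> affdim_ge B k.
Proof.
move=> AB [p [M [Ap [AM fM]]]]; exists p, M; split; first exact: AB.
by split => // i; exact: AB.
Qed.

Lemma not_affdim3 A : A 0 -> ~ affdim_ge A 3 ->
  exists2 m, m != 0 & forall y, A y -> dot m y = 0.
Proof.
move=> A0 h3; have [/(affdim2P A0) [a [b [Aa Ab c0]]]|h2] := pselect (affdim_ge A 2).
  exists (cross a b) => // y Ay; apply/eqP/negPn/negP => d; apply: h3.
  by apply/(affdim3P A0); exists a, b, y.
have [/(affdim1P A0) [a Aa a0]|h1] := pselect (affdim_ge A 1); last first.
  exists (bvec R o0); first by apply/eqP => /(congr1 (fun N => fun_of_matrix N ord0 o0)); rewrite !mxE /= => /eqP; rewrite oner_eq0.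
  move=> y Ay; have [->|y0] := eqVneq y 0; first by rewrite dot0r.
  by exfalso; apply: h1; apply/(affdim1P A0); exists y.
have par y : A y -> y = (dot a y / dot a a) *: a.
  move=> Ay; apply: cross_eq0 => //; apply/eqP/negPn/negP => d; apply: h2.
  by apply/(affdim2P A0); exists a, y.
have [m m0 ma] : exists2 m, m != 0 & dot m a = 0.
  have [h|h] := eqVneq (cross a (bvec R o0)) 0; last first.
    by exists (cross a (bvec R o0)) => //; rewrite dot_crossl.
  have [h'|h'] := eqVneq (cross a (bvec R o1)) 0; last first.
    by exists (cross a (bvec R o1)) => //; rewrite dot_crossl.
  exfalso; move/eqP: a0; apply; apply: vec_eq; rewrite mxE.
  - by have := congr1 (fun N => fun_of_matrix N ord0 o2) h'; rewrite /cross mkv2 !mxE /= mulr0 mulr1 subr0.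
  - by have := congr1 (fun N => fun_of_matrix N ord0 o2) h; rewrite /cross mkv2 !mxE /= mulr0 mulr1 sub0r => /eqP; rewrite oppr_eq0 => /eqP.
  - by have := congr1 (fun N => fun_of_matrix N ord0 o1) h; rewrite /cross mkv1 !mxE /= mulr0 mulr1 subr0.
by exists m => // y /par ->; rewrite dotZr ma mulr0.
Qed.

Lemma full_dot0 A n : A 0 -> affdim_ge A 3 -> (forall y, A y -> dot n y = 0) -> n = 0.
Proof.
move=> A0 /(affdim3P A0) [a [b [c [Aa Ab Ac d]]]] h.
exact: (dot_basis_eq0 d (h _ Aa) (h _ Ab) (h _ Ac)).
Qed.

Lemma not_affdim2 A : A 0 -> ~ affdim_ge A 2 -> exists e, forall y, A y -> exists t, y = t *: e.
Proof.
move=> A0 h2; have [/(affdim1P A0) [a Aa a0]|h1] := pselect (affdim_ge A 1); last first.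
  exists 0 => y Ay; exists 0; rewrite scaler0; have [//|y0] := eqVneq y 0.
  by exfalso; apply: h1; apply/(affdim1P A0); exists y.
exists a => y Ay; exists (dot a y / dot a a); apply: cross_eq0 => //.
apply/eqP/negPn/negP => d; apply: h2.
by apply/(affdim2P A0); exists a, y.
Qed.

Lemma edge_line E : E 0 -> affdim_eq E 1 ->
  exists e, [/\ E e, e != 0 & forall y, E y -> exists t, y = t *: e].
Proof.
move=> E0 [/(affdim1P E0) [e Ee e0] h2]; exists e; split => // y Ey.
exists (dot e y / dot e e); apply: cross_eq0 => //.
apply/eqP/negPn/negP => d; apply: h2.
by apply/(affdim2P E0); exists e, y.
Qed.

End Dimension.

Section Faces.
Variable R : realType.
Implicit Types (x y z u v w n e : vec R) (c t : R) (A E F K P : set (vec R)).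

(* The face of [P] in a direction [u] with [u <= 0] on [P], when it contains the origin. *)
Definition slice P u := P `&` [set y | dot u y = 0].
Definition nonpos P u := forall y, P y -> dot u y <= 0.

(** The maximum of [u] on [P] is attained on the face, and it is 0 because the face contains the
    origin. *)
Lemma face_oP P F : polytope_o P ->
  (face P F /\ F 0) <-> exists u, [/\ u != 0, nonpos P u & F = slice P u].
Proof.
move=> hP; have P0 : P 0 := hP.2; split.
  move=> [[u [u0 ->]] [_ /esym]]; rewrite dot0r => s0; exists u; split => //.
    by move=> y Py; rewrite -s0; apply: supp_ge => //; exact: polytope_bdd.
  by rewrite /slice s0.
move=> [u [u0 np ->]]; have s0 : supp P u = 0.
  by rewrite (supp_eq P0) ?dot0r // => z /np.
split; last by split; rewrite //= dot0r.
by exists u; split => //; rewrite /slice s0.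
Qed.

Lemma slice_polytope P u : polytope_o P -> polytope_o (slice P u).
Proof. exact: polytope_cut0. Qed.

(** Dimension at least 2 is enough, because a face lies in a plane. *)
Lemma facets_oP P F : polytope_o P ->
  facets_o P F <-> exists u, [/\ u != 0, nonpos P u, F = slice P u & affdim_ge F 2].
Proof.
move=> hP; split.
  move=> [fF [[d2 _] F0]]; have [u [u0 np FE]] := (face_oP F hP).1 (conj fF F0).
  by exists u.
move=> [u [u0 np FE d2]]; have [|fF F0] := (face_oP F hP).2; first by exists u.
split => //; split => //; split => // d3.
suff : u = 0 by move/eqP; rewrite (negbTE u0).
by apply: (full_dot0 F0 d3) => y; rewrite FE => -[].
Qed.

Lemma edges_oP P E : polytope_o P ->
  edges_o P E <-> exists u, [/\ u != 0, nonpos P u, E = slice P u & affdim_eq E 1].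
Proof.
move=> hP; split.
  move=> [fE [d1 E0]]; have [u [u0 np EE]] := (face_oP E hP).1 (conj fE E0).
  by exists u.
move=> [u [u0 np EE d1]]; have [|fE E0] := (face_oP E hP).2; first by exists u.
by split => //; split.
Qed.

(** Generators off the supporting plane are strictly below it and carry no weight at a point of the
    face. *)
Lemma slice_conv s u : polytope_o (conv s) -> nonpos (conv s) u ->
  slice (conv s) u = conv [seq v <- s | dot u v == 0].
Proof.
move=> hP np; apply/seteqP; split; last first.
  have -> : slice (conv s) u = conv s `&` [set y | dot u y <= 0] `&` [set y | dot (- u) y <= 0].
    apply/seteqP; split=> y; rewrite /slice /= dotNl; first by move=> [? ->]; rewrite oppr0 lexx.
    by move=> [[sy a] b]; split => //; apply/eqP; rewrite eq_le a /= -oppr_le0.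
  apply: conv_sub; first by apply: convexI; [apply: convexI|]; [exact: conv_convex|exact: convex_halfspace|exact: convex_halfspace].
  move=> v; rewrite mem_filter => /andP[/eqP d0 vs].
  by rewrite /= dotNl d0 oppr0 lexx; split => //; split => //; exact: conv_mem.
move=> x [sx /= ux]; case: (conv_split (fun v => dot u v == 0) sx) => //.
  have neg y : conv [seq v <- s | predC (fun v => dot u v == 0) v] y -> dot u y < 0.
    move=> hy; have [m [ms _ h]] := conv_max u (conv_neq0 hy).
    apply: le_lt_trans (h _ hy) _; move: ms; rewrite mem_filter /= => /andP[d0 ms].
    by rewrite lt_neqAle d0 np //; exact: conv_mem.
  by move=> /neg; rewrite ux ltxx.
move=> [a [b [t [ha hb /andP[t0 t1] xE]]]].
have b0 : dot u b < 0.
  have [m [ms _ h]] := conv_max u (conv_neq0 hb).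
  apply: le_lt_trans (h _ hb) _; move: ms; rewrite mem_filter /= => /andP[d0 ms].
  by rewrite lt_neqAle d0 np //; exact: conv_mem.
have a0 : dot u a = 0.
  have l : dot u a <= 0 by apply: (@conv_le _ _ u 0 _ a ha) => v; rewrite mem_filter => /andP[/eqP ->].
  have l' : 0 <= dot u a.
    have := @conv_le _ _ (- u) 0 _ a ha; rewrite dotNl oppr_le0; apply => v.
    by rewrite mem_filter dotNl => /andP[/eqP -> _]; rewrite oppr0.
  lra.
move: ux; rewrite xE !dotlin a0 mulr0 add0r => /eqP; rewrite mulf_eq0 (lt_eqF b0) orbF => /eqP t00.
by rewrite t00 subr0 scale1r scale0r addr0.
Qed.

End Faces.

(** * Simplicial cones *)
Section SimplicialCones.
Variable R : realType.
Implicit Types (x y z u v w n m l : vec R) (c t : R) (K L P C : set (vec R)).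
Implicit Types (B D : 'I_3 -> vec R) (I J : 'I_3 -> bool).

Definition dual_pair B D := forall i j, dot (D i) (B j) = (i == j)%:R.
Definition basis B := exists D, dual_pair B D.

Definition cone B I : set (vec R) := [set x | exists t : 'I_3 -> R,
  [/\ forall i, 0 <= t i, forall i, ~~ I i -> t i = 0 & x = \sum_i t i *: B i]].

Lemma dual_coord B D (t : 'I_3 -> R) i : dual_pair B D -> dot (D i) (\sum_j t j *: B j) = t i.
Proof.
move=> BD; rewrite dot_sumr (bigD1 i) //= dotZr BD eqxx mulr1 big1 ?addr0 // => j ji.
by rewrite dotZr BD eq_sym (negbTE ji) mulr0.
Qed.

Lemma dual_expand B D x : dual_pair B D -> x = \sum_i dot (D i) x *: B i.
Proof.
move=> BD.
pose MB : 'M[R]_3 := \matrix_i B i; pose MD : 'M[R]_3 := \matrix_i D i.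
have e : MD *m MB^T = 1%:M.
  apply/matrixP => i j; rewrite !mxE -BD /dot; apply: eq_bigr => k _.
  by rewrite !mxE.
have e2 : MD^T *m MB = 1%:M.
  by apply: trmx_inj; rewrite trmx_mul trmxK trmx1; exact: mulmx1C.
rewrite -{1}(mulmx1 x) -e2 mulmxA mulmx_sum_row; apply: eq_bigr => i _.
rewrite rowK; congr (_ *: _); rewrite !mxE /dot; apply: eq_bigr => k _.
by rewrite !mxE mulrC.
Qed.

Lemma coneP B D I x : dual_pair B D ->
  cone B I x <-> (forall i, 0 <= dot (D i) x) /\ (forall i, ~~ I i -> dot (D i) x = 0).
Proof.
move=> BD; split=> [[t [t0 tI ->]]|[h0 hI]].
  by split=> i; rewrite (dual_coord _ _ BD) //; exact: tI.
by exists (fun i => dot (D i) x); split => //; exact: dual_expand.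
Qed.

Lemma cone_mem B I i : I i -> cone B I (B i).
Proof.
move=> Ii; exists (fun j => (j == i)%:R); split.
- by move=> j; rewrite ler0n.
- by move=> j; case: eqP => // ->; rewrite Ii.
- by rewrite (bigD1 i) //= eqxx scale1r big1 ?addr0 // => j /negbTE ->; rewrite scale0r.
Qed.

Lemma coneZ B I c x : 0 <= c -> cone B I x -> cone B I (c *: x).
Proof.
move=> c0 [t [t0 tI ->]]; exists (fun i => c * t i); split.
- by move=> i; rewrite mulr_ge0.
- by move=> i /tI ->; rewrite mulr0.
- by rewrite scaler_sumr; apply: eq_bigr => i _; rewrite scalerA.
Qed.

Lemma coneD B I x y : cone B I x -> cone B I y -> cone B I (x + y).
Proof.
move=> [t [t0 tI ->]] [s [s0 sI ->]]; exists (fun i => t i + s i); split.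
- by move=> i; rewrite addr_ge0.
- by move=> i h; rewrite tI // sI // addr0.
- by rewrite -big_split /=; apply: eq_bigr => i _; rewrite scalerDl.
Qed.

Lemma cone_convex B I : convex (cone B I).
Proof.
by move=> x y t hx hy /andP[t0 t1]; apply: coneD; apply: coneZ; rewrite ?subr_ge0.
Qed.

Definition upd B j w i := if i == j then w else B i.

(** The plane [q D_i = p D_j] contains [w] and the third generator and separates [B i] from [B j].
    In dual coordinates all three pieces become sign conditions. *)
Lemma edge_split B I i j (p q : R) : basis B -> I i -> I j -> i != j -> 0 < p -> 0 < q ->
  let w := p *: B i + q *: B j in
  [/\ basis (upd B j w), basis (upd B i w) & exists m,
  [/\ cone B I `&` [set x | 0 <= dot m x] = cone (upd B j w) I,
      cone B I `&` [set x | dot m x <= 0] = cone (upd B i w) I &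
      cone B I `&` [set x | dot m x = 0] = cone (upd B j w) (fun k => I k && (k != i))]].
Proof.
move=> [D BD] Ii Ij ij p0 q0 w.
(* The dual basis after [B j'] has been replaced by [w']. *)
have H i' j' p' q' : I i' -> I j' -> i' != j' -> 0 < p' -> 0 < q' ->
   let w := p' *: B i' + q' *: B j' in let m := q' *: D i' - p' *: D j' in
   exists D', [/\ dual_pair (upd B j' w) D', (forall k, k != i' -> k != j' -> D' k = D k),
    D' j' = q'^-1 *: D j' & D' i' = D i' - (p' / q') *: D j'].
  move=> Ii' Ij' ij' p0' q0' w' m.
  exists (fun k => if k == j' then q'^-1 *: D j' else if k == i' then
     D i' - (p' / q') *: D j' else D k); split; last 3 first.
  - by move=> k /negbTE ki /negbTE kj; rewrite ki kj.
  - by rewrite eqxx.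
  - by rewrite (negbTE ij') eqxx.
  move=> k l; rewrite /upd.
  have [->|kj] := eqVneq k j'.
    have [_|lj] := eqVneq l j'.
      by rewrite dotZl /w' dotDr !dotZr !BD (eq_sym j') (negbTE ij') ?eqxx mulr0 add0r mulr1 mulVf ?gt_eqF.
    by rewrite dotZl BD eq_sym (negbTE lj) mulr0.
  have [->|ki] := eqVneq k i'; have [->|lj] := eqVneq l j'; rewrite ?(dotBl, dotZl, dotDr, dotZr) !BD.
  - rewrite !eqxx (negbTE ij') (eq_sym j') (negbTE ij') !mulr0 !mulr1 !addr0 !add0r.
    by rewrite mulfVK ?gt_eqF // subrr.
  - by rewrite (eq_sym j') (negbTE lj) mulr0 subr0.
  - by rewrite (negbTE ki) (negbTE kj) !mulr0 addr0.
  - by [].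
have [D1 [BD1 D1k D1j D1i]] := H i j p q Ii Ij ij p0 q0.
have ji : j != i by rewrite eq_sym.
have [D2 [BD2 D2k D2j D2i]] := H j i q p Ij Ii ji q0 p0.
have wE : q *: B j + p *: B i = w by rewrite /w addrC.
rewrite -/w in BD1; rewrite wE in BD2.
split; [by exists D1|by exists D2|].
exists (q *: D i - p *: D j).
have mE x : dot (q *: D i - p *: D j) x = q * dot (D i) x - p * dot (D j) x.
  by rewrite dotBl !dotZl.
have E1 x : cone (upd B j w) I x <-> cone B I x /\ 0 <= q * dot (D i) x - p * dot (D j) x.
  rewrite (coneP _ _ BD1) (coneP _ _ BD); split=> [[h0 hI]|[[h0 hI] hm]].
    have hj : 0 <= dot (D j) x.
      by have := h0 j; rewrite D1j dotZl pmulr_rge0 // invr_gt0.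
    have hi := h0 i; rewrite D1i dotBl dotZl in hi.
    have hi' : 0 <= q * dot (D i) x - p * dot (D j) x.
      have : 0 <= q * (dot (D i) x - p / q * dot (D j) x) by rewrite mulr_ge0 // ltW.
      by rewrite mulrBr mulrA mulrCA divff ?gt_eqF // mulr1.
    split=> //; split=> k; last first.
      move=> Ik; have ki : k != i by apply: contra Ik => /eqP ->.
      have kj : k != j by apply: contra Ik => /eqP ->.
      by rewrite -(D1k _ ki kj); exact: hI.
    have [->//|kj] := eqVneq k j.
    have [->|ki] := eqVneq k i; last by rewrite -(D1k _ ki kj).
    rewrite -(pmulr_rge0 _ q0); have : 0 <= p * dot (D j) x by rewrite mulr_ge0 // ltW.
    lra.
  split=> k; last first.
    move=> Ik; have ki : k != i by apply: contra Ik => /eqP ->.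
    have kj : k != j by apply: contra Ik => /eqP ->.
    by rewrite (D1k _ ki kj) hI.
  have [->|kj] := eqVneq k j; first by rewrite D1j dotZl mulr_ge0 // invr_ge0 ltW.
  have [->|ki] := eqVneq k i; last by rewrite (D1k _ ki kj).
  rewrite D1i dotBl dotZl -(pmulr_rge0 _ q0) mulrBr.
  by rewrite [q * (_ * _)]mulrA [q * (_ / _)]mulrCA divff ?gt_eqF // mulr1.
have E2 x : cone (upd B i w) I x <-> cone B I x /\ q * dot (D i) x - p * dot (D j) x <= 0.
  rewrite (coneP _ _ BD2) (coneP _ _ BD); split=> [[h0 hI]|[[h0 hI] hm]].
    have hj : 0 <= dot (D i) x.
      by have := h0 i; rewrite D2j dotZl pmulr_rge0 // invr_gt0.
    have hi := h0 j; rewrite D2i dotBl dotZl in hi.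
    have hi' : 0 <= p * dot (D j) x - q * dot (D i) x.
      have : 0 <= p * (dot (D j) x - q / p * dot (D i) x) by rewrite mulr_ge0 // ltW.
      by rewrite mulrBr mulrA mulrCA divff ?gt_eqF // mulr1.
    split; last lra.
    split=> k; last first.
      move=> Ik; have ki : k != i by apply: contra Ik => /eqP ->.
      have kj : k != j by apply: contra Ik => /eqP ->.
      by rewrite -(D2k _ kj ki); exact: hI.
    have [->//|kj] := eqVneq k i.
    have [->|ki] := eqVneq k j; last by rewrite -(D2k _ ki kj).
    rewrite -(pmulr_rge0 _ p0); have : 0 <= q * dot (D i) x by rewrite mulr_ge0 // ltW.
    lra.
  split=> k; last first.
    move=> Ik; have ki : k != i by apply: contra Ik => /eqP ->.
    have kj : k != j by apply: contra Ik => /eqP ->.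
    by rewrite (D2k _ kj ki) hI.
  have [->|kj] := eqVneq k i; first by rewrite D2j dotZl mulr_ge0 // invr_ge0 ltW.
  have [->|ki] := eqVneq k j; last by rewrite (D2k _ ki kj).
  rewrite D2i dotBl dotZl -(pmulr_rge0 _ p0) mulrBr.
  rewrite [p * (_ * _)]mulrA [p * (_ / _)]mulrCA divff ?gt_eqF // mulr1; lra.
have E3 x : cone (upd B j w) (fun k => I k && (k != i)) x <->
    cone (upd B j w) I x /\ dot (D1 i) x = 0.
  rewrite !(coneP _ _ BD1); split=> [[h0 hI]|[[h0 hI] hi]].
    split; last by apply: hI; rewrite eqxx andbF.
    by split=> // k Ik; apply: hI; rewrite (negbTE Ik).
  split=> // k; rewrite negb_and negbK => /orP[/hI //|/eqP -> //].
split; apply/seteqP; split=> x /=.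
- by move=> [cx]; rewrite mE => h; apply/E1.
- by move=> /E1[cx h]; rewrite mE.
- by move=> [cx]; rewrite mE => h; apply/E2.
- by move=> /E2[cx h]; rewrite mE.
- move=> [cx]; rewrite mE => h; apply/E3; split; first by apply/E1; rewrite h lexx.
  apply: (mulfI (lt0r_neq0 q0)); rewrite D1i dotBl dotZl mulr0 -h.
  by field; rewrite gt_eqF.
- move=> /E3[/E1[cx _] h]; rewrite mE; split => //.
  rewrite D1i dotBl dotZl in h.
  have -> : q * dot (D i) x - p * dot (D j) x = q * (dot (D i) x - p / q * dot (D j) x).
    by field; rewrite gt_eqF.
  by rewrite h mulr0.
Qed.

Definition const_sign n B I :=
  (forall i, I i -> 0 <= dot n (B i)) \/ (forall i, I i -> dot n (B i) <= 0).

(** The edges of the cone that [n] crosses; their number is the measure of the subdivision below. *)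
Definition sign_changes n B I := [set ij : 'I_3 * 'I_3 |
  [&& I ij.1, I ij.2, 0 < dot n (B ij.1) & dot n (B ij.2) < 0]]%SET.

Section Induction.
Variable Pr : set (vec R) -> Prop.
Hypothesis Pr_cut : forall C n, Pr (C `&` [set x | dot n x = 0]) ->
  Pr (C `&` [set x | 0 <= dot n x]) -> Pr (C `&` [set x | dot n x <= 0]) -> Pr C.

(** Cutting a crossed edge at the zero [w] of [n] removes this sign change and creates none. As a
    positive combination of two generators, [w] respects the signs of the functionals already
    treated. *)
Lemma cone_refine1 n (ds : seq (vec R)) :
  (forall B I, basis B -> (forall m, m \in n :: ds -> const_sign m B I) -> Pr (cone B I)) ->
  forall B I, basis B -> (forall m, m \in ds -> const_sign m B I) -> Pr (cone B I).
Proof.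
move=> H B I; have [k] := ubnP #|sign_changes n B I|.
elim: k B I => // k IH B I; rewrite ltnS => le bB cs.
have [e0|[[i j]]] := set_0Vmem (sign_changes n B I).
  apply: H => // m; rewrite inE => /orP[/eqP ->|/cs //].
  have [/existsP [i /andP[Ii ni]]|/existsPn h] := boolP [exists i, I i && (0 < dot n (B i))].
    left=> j Ij; rewrite leNgt; apply/negP => nj.
    have : (i, j) \in sign_changes n B I by rewrite finset.in_set /= Ii Ij ni nj.
    by rewrite e0 finset.in_set0.
  by right=> i Ii; have := h i; rewrite Ii /= -leNgt.
rewrite finset.in_set /= => /and4P[Ii Ij ni nj].
have ij : i != j by apply/eqP => ij; rewrite ij in ni; lra.
have p0 : 0 < - dot n (B j) by rewrite oppr_gt0.
have [b1 b2 [m [E1 E2 E3]]] := edge_split bB Ii Ij ij p0 ni.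
set w := _ + _ in b1 b2 E1 E2 E3.
have nw : dot n w = 0 by rewrite /w dotDr !dotZr; ring.
have csw h J : (forall a, J a -> I a) -> forall l, l \in ds -> const_sign l (upd B h w) J.
  move=> JI l lds; have [s|s] := cs l lds; [left|right] => a Ja; rewrite /upd;
    (case: ifP => _; last exact/s/JI); rewrite /w dotDr !dotZr.
    by rewrite addr_ge0 // mulr_ge0 ?s // ltW.
  have h1 : - dot n (B j) * dot l (B i) <= 0 by rewrite mulr_ge0_le0 ?s // ltW.
  have h2 : dot n (B i) * dot l (B j) <= 0 by rewrite mulr_ge0_le0 ?s // ltW.
  lra.
have lt h J : (h == i) || (h == j) -> (forall a, J a -> I a) ->
    (#|sign_changes n (upd B h w) J| < k)%N.
  move=> hij JI; apply: leq_trans le; apply: proper_card; apply/properP; split.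
    apply/fintype.subsetP => -[a b]; rewrite !finset.in_set /= /upd.
    by have [->|_] := eqVneq a h; have [->|_] := eqVneq b h; rewrite ?nw ?ltxx ?andbF //;
      move=> /and4P[/JI -> /JI -> -> ->].
  exists (i, j); first by rewrite finset.in_set /= Ii Ij ni nj.
  rewrite finset.in_set /= /upd; case/orP: hij => /eqP ->; rewrite eqxx nw ltxx ?andbF //.
apply: (Pr_cut (n := m)).
- rewrite E3; apply: IH => //; last by apply: csw => l /andP[].
  by apply: lt => [|l /andP[]//]; rewrite eqxx orbT.
- by rewrite E1; apply: IH => //; [apply: lt => //; rewrite eqxx orbT|exact: csw].
- by rewrite E2; apply: IH => //; [apply: lt => //; rewrite eqxx|exact: csw].
Qed.

Lemma cone_refine (ns : seq (vec R)) :
  (forall B I, basis B -> (forall m, m \in ns -> const_sign m B I) -> Pr (cone B I)) ->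
  forall B I, basis B -> Pr (cone B I).
Proof.
elim: ns => [|n ns IH] H; first by move=> B I bB; exact: H.
by apply: IH; exact: cone_refine1 H.
Qed.

(** The coordinate planes cut space into orthants and their common faces, which are simplicial cones
    and start the refinement. *)
Lemma cone_induction (ns : seq (vec R)) :
  (forall B I, basis B -> (forall m, m \in ns -> const_sign m B I) -> Pr (cone B I)) ->
  Pr setT.
Proof.
move=> /cone_refine H.
(* The indices [o0], [o1], [o2] stand for the plane itself, its positive and its negative side. *)
pose hs (s : 'I_3) n := if s == o0 then [set x | dot n x = 0] else
  if s == o1 then [set x | 0 <= dot n x] else [set x | dot n x <= 0].
have cutP C n : (forall s, Pr (C `&` hs s n)) -> Pr C.
  by move=> h; apply: (Pr_cut (n := n)); [exact: (h o0)|exact: (h o1)|exact: (h o2)].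
apply: (@cutP _ (bvec R o0)) => s0; apply: (@cutP _ (bvec R o1)) => s1.
apply: (@cutP _ (bvec R o2)) => s2.
pose s i := if i == o0 then s0 else if i == o1 then s1 else s2.
pose B (i : 'I_3) := if s i == o2 then - bvec R i else bvec R i.
have BB : dual_pair B B.
  have e i j : dot (bvec R i) (bvec R j) = (i == j)%:R.
    rewrite dotE !mxE /=; move: i j; apply: ord3P; apply: ord3P; rewrite /=; ring.
  move=> i j; rewrite /B; have [<-|ij] := eqVneq i j.
    by case: ifP => _; rewrite ?dotNl ?dotNr ?opprK e eqxx.
  by case: ifP => _; case: ifP => _; rewrite ?dotNl ?dotNr ?opprK e (negbTE ij) ?oppr0.
have -> : setT `&` hs s0 (bvec R o0) `&` hs s1 (bvec R o1) `&` hs s2 (bvec R o2) =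
   cone B (fun i => s i != o0).
  have E i x : hs (s i) (bvec R i) x <-> 0 <= dot (B i) x /\ (~~ (s i != o0) -> dot (B i) x = 0).
    rewrite /hs /B negbK; move: (s i); apply: ord3P => /=; split => //.
    - by move=> ->.
    - by move=> [_ /(_ isT)].
    - by case.
    - by rewrite dotNl oppr_ge0 => ->.
    - by rewrite dotNl oppr_ge0 => -[].
  apply/seteqP; split=> x.
    move=> [[[_ h0] h1] h2]; apply/(coneP _ _ BB).
    have HH : forall i, 0 <= dot (B i) x /\ (~~ (s i != o0) -> dot (B i) x = 0).
      by apply: ord3P; apply/E.
    by split=> i; [exact: (HH i).1|exact: (HH i).2].
  move=> /(coneP _ _ BB) [h0 hI].
  have HH i : hs (s i) (bvec R i) x by apply/E; split => //; exact: hI.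
  by split; [split; [split; [|exact: (HH o0)]|exact: (HH o1)]|exact: (HH o2)].
by apply: H; exists B.
Qed.

End Induction.
End SimplicialCones.

(** * Cut additive functionals *)
Section CutAdditive.
Variable R : realType.
Implicit Types (x y u v w n m l : vec R) (c t : R) (K L P C : set (vec R)).
Implicit Types (B D : 'I_3 -> vec R) (I J : 'I_3 -> bool).

Definition simplex B I : set (vec R) := conv (0 :: [seq B i | i <- [seq i <- [:: o0; o1; o2] | I i]]).

Lemma ord3_mem (i : 'I_3) : i \in [:: o0; o1; o2].
Proof. by move: i; apply: ord3P. Qed.

Lemma simplex_mem B I i : I i -> simplex B I (B i).
Proof.
move=> Ii; apply: conv_mem; rewrite inE; apply/orP; right; apply: map_f.
by rewrite mem_filter Ii ord3_mem.
Qed.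

Lemma simplex0 B I : simplex B I 0.
Proof. exact/conv_mem/mem_head. Qed.

Lemma simplex_polytope B I : polytope_o (simplex B I).
Proof. by split; [eexists|exact: simplex0]. Qed.

Lemma simplexE B I l : (forall i, I i -> dot l (B i) = 1) ->
  simplex B I = cone B I `&` [set x | dot l x <= 1].
Proof.
move=> lB; apply/seteqP; split.
  apply: conv_sub; first by apply: convexI; [exact: cone_convex|exact: convex_halfspace].
  move=> v; rewrite inE => /orP[/eqP ->|/mapP[i]].
    split; last by rewrite /= dot0r ler01.
    by exists (fun=> 0); split => //; rewrite big1 // => i _; rewrite scale0r.
  rewrite mem_filter => /andP[Ii _] ->; split; first exact: cone_mem.
  by rewrite /= lB // lexx.
move=> x [[t [t0 tI ->]]] /=; rewrite dot_sumr => le.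
have e : \sum_i dot l (t i *: B i) = \sum_i t i.
  apply: eq_bigr => i _; rewrite dotZr.
  have [/lB ->|/tI ->] := boolP (I i); by rewrite ?mulr1 ?mul0r.
rewrite e in le.
(* [None] carries the weight left over for the origin. *)
pose t' (o : option 'I_3) := if o is Some i then t i else 1 - \sum_i t i.
pose f (o : option 'I_3) := if o is Some i then if I i then B i else 0 else 0.
have := @convex_comb1 _ (simplex B I) _ [:: None; Some o0; Some o1; Some o2] t' f.
rewrite !big_cons !big_nil /= !addr0 sum3E scaler0 add0r => H.
have -> : \sum_i t i *: B i = t o0 *: (if I o0 then B o0 else 0) +
  (t o1 *: (if I o1 then B o1 else 0) + t o2 *: (if I o2 then B o2 else 0)).
  rewrite sum3E addrA; congr (_ + _ + _); (case: ifPn => // /tI ->; by rewrite !scale0r).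
apply: H; first exact: conv_convex.
- by move=> [i|] _ //=; rewrite subr_ge0.
- move=> [i|] _ /=; last exact: simplex0.
  by case: ifP => [/simplex_mem //|_]; exact: simplex0.
- by rewrite [1 - _ + _]addrC -!addrA addrC; ring.
Qed.

Definition normal_sys (M N : seq (vec R)) x :=
  (forall m, m \in M -> dot m x <= 0) /\ (forall l, l \in N -> dot l x <= 1).

(** Inequalities with right-hand side 0 go to [M], the others are scaled to 1. The zero functional
    is added so that [N] always has a maximal element. *)
Lemma polytope_normal P : polytope_o P ->
  exists M N, 0 \in N /\ forall x, P x <-> normal_sys M N x.
Proof.
move=> /polytope_hrep [L [LP L0]].
exists [seq p.1 | p <- L & p.2 == 0], (0 :: [seq p.2^-1 *: p.1 | p <- L & p.2 != 0]).
split; first by rewrite mem_head.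
move=> x; rewrite LP; split=> [H|[H1 H2] p pL].
  split=> [m /mapP[p]|l]; first by rewrite mem_filter => /andP[/eqP p0 /H pL] ->; rewrite -p0.
  rewrite inE => /orP[/eqP ->|/mapP[p]]; first by rewrite dot0l ler01.
  rewrite mem_filter => /andP[p0 pL] ->; rewrite dotZl.
  by rewrite ler_pdivrMl ?mulr1 ?H // lt_neqAle eq_sym p0 L0.
have [p0|p0] := eqVneq p.2 0.
  by rewrite p0; apply: H1; apply/mapP; exists p; rewrite // mem_filter p0 eqxx.
have := H2 (p.2^-1 *: p.1); rewrite dotZl inE.
have -> : p.2^-1 *: p.1 \in [seq p.2^-1 *: p.1 | p <- L & p.2 != 0].
  by apply/mapP; exists p; rewrite // mem_filter p0.
by rewrite orbT ler_pdivrMl ?mulr1; [exact|rewrite lt_neqAle eq_sym p0 L0].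
Qed.

Definition differences (N : seq (vec R)) := [seq a - b | a <- N, b <- N].

(* On a simplicial cone where the functionals of [M] and the differences of functionals
   of [N] do not change sign, the polytope is a simplex with a vertex at the origin. *)
Lemma small_cell P M N B I : bdd P -> (forall x, P x <-> normal_sys M N x) -> 0 \in N ->
  basis B -> (forall m, m \in M ++ differences N -> const_sign m B I) ->
  exists J l, [/\ (forall i, J i -> I i), l \in N,
    P `&` cone B I = cone B J `&` [set x | dot l x <= 1],
    (forall i, J i -> 0 < dot l (B i)) &
    (forall i, I i -> ~~ J i -> exists m, [/\ m \in M, 0 < dot m (B i) &
       forall j, I j -> 0 <= dot m (B j)])].
Proof.
move=> bP PE N0 [D BD] cs.
(* [J] collects the rays along which no functional of [M] is positive. A functional of [N] that is
   largest at the sum [b] of these rays is largest on each of them, because differences do not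
   change sign. *)
pose J i := I i && all (fun m => dot m (B i) <= 0) M.
pose b := \sum_i (if J i then B i else 0).
have [l lN lmax] : exists2 l, l \in N & forall l', l' \in N -> dot l' b <= dot l b.
  have N00 : N != [::] by apply/eqP => e; rewrite e in N0.
  have [v [vN _ vmax]] := conv_max b N00.
  by exists v => // l' l'N; rewrite !(dotC _ b); apply: vmax; exact: conv_mem.
have lJ l' i : l' \in N -> J i -> dot l' (B i) <= dot l (B i).
  move=> l'N Ji; rewrite -subr_le0 -dotBl.
  have : const_sign (l' - l) B I.
    by apply: cs; rewrite mem_cat; apply/orP; right; apply/allpairsP; exists (l', l).
  have JI k : J k -> I k by case/andP.
  move=> [h|h]; last exact/h/JI.
  have := lmax _ l'N; rewrite -subr_le0 -dotBl /b dot_sumr (bigD1 i) //= Ji.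
  apply: le_trans; rewrite lerDl sumr_ge0 // => k _; case: ifP => [/JI/h //|_].
  by rewrite dot0r.
have JIc x : cone B J x -> cone B I x.
  move=> /(coneP _ _ BD) [h0 hJ]; apply/(coneP _ _ BD); split => // i Ii; apply: hJ.
  by rewrite /J (negbTE Ii).
have PJ x : P x -> cone B I x -> cone B J x.
  move=> /PE[HM _] [t [t0 tI xE]]; exists t; split => // i; rewrite /J negb_and => /orP[/tI //|].
  have [Ii|/tI //] := boolP (I i).
  move=> /allPn [m mM]; rewrite -ltNge => mB.
  have : const_sign m B I by apply: cs; rewrite mem_cat mM.
  move=> [h|h]; last by have := h _ Ii; lra.
  have := HM _ mM; rewrite xE dot_sumr (bigD1 i) //= dotZr => le.
  have r0 : 0 <= \sum_(j | j != i) dot m (t j *: B j).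
    apply: sumr_ge0 => j _; rewrite dotZr; have [/h hj|/tI ->] := boolP (I j); last by rewrite mul0r.
    by rewrite mulr_ge0.
  have : t i * dot m (B i) <= 0 by lra.
  by rewrite pmulr_lle0 // => ti; apply/eqP; rewrite eq_le ti t0.
have E : P `&` cone B I = cone B J `&` [set x | dot l x <= 1].
  apply/seteqP; split=> x; first by move=> [Px cx]; split; [exact: PJ|exact: ((PE x).1 Px).2].
  move=> [cx /= lx]; split; last exact: JIc.
  apply/PE; have [t [t0 tI xE]] := cx; split=> [m mM|l' l'N].
    rewrite xE dot_sumr; apply: sumr_le0 => i _; rewrite dotZr.
    have [/andP[_ /allP/(_ _ mM) h]|/tI ->] := boolP (J i); last by rewrite mul0r.
    by rewrite mulr_ge0_le0.
  apply: le_trans lx; rewrite xE !dot_sumr; apply: ler_sum => i _; rewrite !dotZr.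
  have [Ji|/tI ->] := boolP (J i); last by rewrite !mul0r.
  by rewrite ler_wpM2l // lJ.
exists J, l; split => //; first by move=> i /andP[].
  (* Otherwise the whole ray would lie in [P], which is bounded. *)
  move=> i Ji; rewrite ltNge; apply/negP => l0.
  have ray k : 0 <= k -> P (k *: B i).
    move=> k0; suff : (P `&` cone B I) (k *: B i) by case.
    rewrite E; split; first exact/coneZ/cone_mem.
    by rewrite /= dotZr (le_trans _ ler01) // mulr_ge0_le0.
  have [c hc] := bP (D i).
  have := hc _ (ray (`|c| + 1) _); rewrite dotZr BD eqxx mulr1 => h.
  have : `|c| + 1 <= c by apply: h; rewrite addr_ge0.
  by have := ler_norm c; lra.
move=> i Ii; rewrite /J Ii /= => /allPn [m mM]; rewrite -ltNge => mB; exists m; split => //.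
have : const_sign m B I by apply: cs; rewrite mem_cat mM.
by move=> [//|h]; have := h _ Ii; lra.
Qed.

Definition cut_additive (z : set (vec R) -> R) := forall P n, polytope_o P ->
  z P + z (P `&` [set x | dot n x = 0]) =
  z (P `&` [set x | 0 <= dot n x]) + z (P `&` [set x | dot n x <= 0]).

Lemma cut_additiveD z z' : cut_additive z -> cut_additive z' ->
  cut_additive (fun P => z P + z' P).
Proof. by move=> h h' P n hP; rewrite addrACA h // h' // addrACA. Qed.

Lemma cut_additiveZ c z : cut_additive z -> cut_additive (fun P => c * z P).
Proof. by move=> h P n hP; rewrite -!mulrDr h. Qed.

Lemma cut_additive_eq0 z : cut_additive z ->
  (forall B I, basis B -> z (simplex B I) = 0) -> forall P, polytope_o P -> z P = 0.
Proof.
move=> zc z0 P hP; have [M [N [N0 PE]]] := polytope_normal hP.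
pose Pr C := polytope_o (P `&` C) -> z (P `&` C) = 0.
suff : Pr setT by rewrite /Pr setIT; exact.
apply: (@cone_induction _ Pr _ (M ++ differences N)).
  move=> C n; rewrite /Pr !setIA => h0 h1 h2 hC.
  have := zc _ n hC; rewrite (h0 (polytope_cut0 n hC)) (h1 (polytope_cut n hC)).
  by rewrite (h2 (polytope_cutN n hC)) !addr0.
move=> B I [D BD] cs _.
have [J [l [JI lN -> lpos _]]] := small_cell (polytope_bdd hP) PE N0 (ex_intro _ D BD) cs.
(* Rescaling the generators to [l = 1] turns the cell into a simplex. *)
pose B' i := if J i then (dot l (B i))^-1 *: B i else B i.
pose D' i := if J i then dot l (B i) *: D i else D i.
have BD' : dual_pair B' D'.
  move=> i j; rewrite /B' /D'; have [Ji|Ji] := boolP (J i); have [Jj|Jj] := boolP (J j);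
    rewrite ?dotZl ?dotZr BD; have [e|e] := eqVneq i j; rewrite ?mulr0 //.
  - by rewrite e mulr1 mulfV // gt_eqF // lpos.
  - by rewrite e (negbTE Jj) in Ji.
  - by rewrite e Jj in Ji.
have cE : cone B J = cone B' J.
  apply/seteqP; split=> x /=.
    move=> /(coneP _ _ BD) [h0 hJ]; apply/(coneP _ _ BD'); split=> i; rewrite /D'.
      by case: ifP => // Ji; rewrite dotZl mulr_ge0 // ltW // lpos.
    by move=> Ji; rewrite (negbTE Ji) hJ.
  move=> /(coneP _ _ BD') [h0 hJ]; apply/(coneP _ _ BD); split=> i.
    by have := h0 i; rewrite /D'; case: ifP => // Ji; rewrite dotZl pmulr_rge0 // lpos.
  by move=> Ji; have := hJ i Ji; rewrite /D' (negbTE Ji).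
rewrite cE -(@simplexE B' J l); first by apply: z0; exists D'.
by move=> i Ji; rewrite /B' Ji dotZr mulVf // gt_eqF // lpos.
Qed.

Definition valuation (z : set (vec R) -> R) := forall K L,
  polytope_o K -> polytope_o L -> polytope_o (K `|` L) -> polytope_o (K `&` L) ->
  z (K `|` L) + z (K `&` L) = z K + z L.

Lemma halfspaceU n : [set x : vec R | 0 <= dot n x] `|` [set x | dot n x <= 0] = setT.
Proof.
apply/seteqP; split=> // x _ /=; have [h|h] := leP 0 (dot n x); first by left.
by right; exact: ltW.
Qed.

Lemma halfspaceI n : [set x : vec R | 0 <= dot n x] `&` [set x | dot n x <= 0] =
  [set x | dot n x = 0].
Proof.
apply/seteqP; split=> x /=; first by move=> [a b]; apply/eqP; rewrite eq_le a b.
by move=> ->.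
Qed.

Lemma valuation_cut z : valuation z -> cut_additive z.
Proof.
move=> vz P n hP; have := vz _ _ (polytope_cut n hP) (polytope_cutN n hP).
rewrite -setIUr halfspaceU setIT -setIIr halfspaceI; apply => //.
exact: polytope_cut0.
Qed.

Lemma le_of_segment (a b c : R) :
  (forall t, 0 < t -> t <= 1 -> (1 - t) * a + t * b <= c) -> a <= c.
Proof.
move=> h; rewrite leNgt; apply/negP => ca.
  have [ba|ab] := leP a b; first by have := h 1 ltr01 (lexx _); lra.
  pose t := Num.min 1 ((a - c) / (2 * (a - b))).
  have t0 : 0 < t by rewrite lt_min ltr01 divr_gt0 //; lra.
  have t1 : t <= 1 by rewrite ge_min lexx.
  have t2 : t * (2 * (a - b)) <= a - c by rewrite -ler_pdivlMr ?ge_min ?lexx ?orbT //; lra.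
  have := h t t0 t1; lra.
Qed.

(** Cut additivity glues the identity along a subdivision of space into cones. When no functional of
    either polytope, and no difference of two of them, changes sign on the cone, one polytope
    contains the other there and the identity is trivial. *)
Lemma cut_additive_valuation z : cut_additive z -> valuation z.
Proof.
move=> zc K L hK hL hU hI.
have [M [N [N0 KE]]] := polytope_normal hK; have [M' [N' [N0' LE]]] := polytope_normal hL.
pose Pr C := [/\ polytope_o (K `&` C), polytope_o (L `&` C), polytope_o ((K `|` L) `&` C) &
  polytope_o ((K `&` L) `&` C)] ->
  z ((K `|` L) `&` C) + z ((K `&` L) `&` C) = z (K `&` C) + z (L `&` C).
suff : Pr setT by rewrite /Pr !setIT; apply.
apply: (@cone_induction _ Pr _ ((M ++ differences N) ++ (M' ++ differences N') ++ differences (N ++ N'))).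
  move=> C n; rewrite /Pr !setIA => h0 h1 h2 [p1 p2 p3 p4].
  have := zc _ n p1; have := zc _ n p2; have := zc _ n p3; have := zc _ n p4.
  have := h0; have := h1; have := h2.
  move=> /(_ (And4 (polytope_cutN n p1) (polytope_cutN n p2) (polytope_cutN n p3) (polytope_cutN n p4))).
  move=> + /(_ (And4 (polytope_cut n p1) (polytope_cut n p2) (polytope_cut n p3) (polytope_cut n p4))).
  move=> + + /(_ (And4 (polytope_cut0 n p1) (polytope_cut0 n p2) (polytope_cut0 n p3) (polytope_cut0 n p4))).
  lra.
move=> B I bB cs _.
suff [KL|LK] : K `&` cone B I `<=` L `&` cone B I \/ L `&` cone B I `<=` K `&` cone B I.
- have -> : (K `|` L) `&` cone B I = L `&` cone B I.
    by rewrite setIUl; apply/setUidPr.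
  have -> : K `&` L `&` cone B I = K `&` cone B I.
    by apply/seteqP; split=> x; [move=> [[? ?] ?]|move=> /[dup] /KL [? _] [? ?]].
  by rewrite addrC.
- have -> : (K `|` L) `&` cone B I = K `&` cone B I.
    by rewrite setIUl; apply/setUidPl.
  have -> : K `&` L `&` cone B I = L `&` cone B I.
    by apply/seteqP; split=> x; [move=> [[? ?] ?]|move=> /[dup] /LK [? _] [? ?]].
  by [].
have [J [l [JI lN EK lpos hJ]]] : exists J l, [/\ (forall i, J i -> I i), l \in N,
    K `&` cone B I = cone B J `&` [set x | dot l x <= 1],
    (forall i, J i -> 0 < dot l (B i)) &
    (forall i, I i -> ~~ J i -> exists m, [/\ m \in M, 0 < dot m (B i) &
       forall j, I j -> 0 <= dot m (B j)])].
  apply: small_cell => //; first exact: polytope_bdd.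
  by move=> m mM; apply: cs; rewrite mem_cat mM.
have [J' [l' [JI' lN' EL lpos' hJ']]] : exists J l, [/\ (forall i, J i -> I i), l \in N',
    L `&` cone B I = cone B J `&` [set x | dot l x <= 1],
    (forall i, J i -> 0 < dot l (B i)) &
    (forall i, I i -> ~~ J i -> exists m, [/\ m \in M', 0 < dot m (B i) &
       forall j, I j -> 0 <= dot m (B j)])].
  apply: small_cell => //; first exact: polytope_bdd.
  by move=> m mM; apply: cs; rewrite mem_cat; apply/orP; right; rewrite mem_cat mM.
have vU : convex (K `|` L) := polytope_convex hU.
(* If [A] lies in a hyperplane [m = 0] and [A'] has a point [q] with [m q > 0], the
   half-open segments from [q] to points of [A] lie in [A'], which is closed. *)
have key A A' (MA NA MA' NA' : seq (vec R)) JA' lA' i : (A `|` A' = K `|` L) ->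
    (forall x, A x <-> normal_sys MA NA x) -> (forall x, A' x <-> normal_sys MA' NA' x) ->
    A' `&` cone B I = cone B JA' `&` [set x | dot lA' x <= 1] ->
    (forall i, JA' i -> 0 < dot lA' (B i)) ->
    I i -> JA' i -> (exists m, [/\ m \in MA, 0 < dot m (B i) &
       forall j, I j -> 0 <= dot m (B j)]) -> A `&` cone B I `<=` A' `&` cone B I.
  move=> AU AE AE' EA' lA'pos Ii Ji [m [mM mBi mB]] p [Ap cp]; split => //.
  have [q qE] : exists q, q = (dot lA' (B i))^-1 *: B i by eexists.
  have li := lA'pos _ Ji.
  have [A'q cq] : (A' `&` cone B I) q.
    rewrite EA' qE; split; first by apply: coneZ; [rewrite invr_ge0 ltW|exact: cone_mem].
    by rewrite /= dotZr mulVf ?gt_eqF.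
  have mp : 0 <= dot m p.
    have [t [t0 tI ->]] := cp; rewrite dot_sumr; apply: sumr_ge0 => j _; rewrite dotZr.
    by have [/mB ?|/tI ->] := boolP (I j); [rewrite mulr_ge0|rewrite mul0r].
  have mq : 0 < dot m q by rewrite qE dotZr mulr_gt0 // invr_gt0.
  have seg t : 0 < t -> t <= 1 -> A' ((1 - t) *: p + t *: q).
    move=> t0 t1; have : (A `|` A') ((1 - t) *: p + t *: q).
      by rewrite AU; apply: vU; [rewrite -AU; left|rewrite -AU; right|rewrite ltW].
    case=> // hA; have := ((AE _).1 hA).1 _ mM; rewrite dotDr !dotZr.
    have h1 : 0 <= (1 - t) * dot m p by rewrite mulr_ge0 // subr_ge0.
    have h2 : 0 < t * dot m q by rewrite mulr_gt0.
    by move=> h; have := ltr_wpDl h1 h2; rewrite ltNge h.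
  apply/AE'; split=> k kM; apply: (@le_of_segment _ (dot k q)) => t t0 t1; rewrite -!dotZr -dotDr.
    exact: (((AE' _).1 (seg t t0 t1)).1 _ kM).
  exact: (((AE' _).1 (seg t t0 t1)).2 _ kM).
have [/existsP [i /andP[Ji Ji']]|/existsPn s1] := boolP [exists i, J' i && ~~ J i].
  by left; apply: (key K L M N M' N' J' l' i) => //; [exact: JI'|exact: (hJ _ (JI' _ Ji) Ji')].
have [/existsP [i /andP[Ji Ji']]|/existsPn s2] := boolP [exists i, J i && ~~ J' i].
  by right; apply: (key L K M' N' M N J l i) => //; [rewrite setUC|exact: JI|exact/hJ'/Ji'/JI].
have JE : J = J'.
  apply/funext => i; have := s1 i; have := s2 i.
  by case: (J i); case: (J' i).
rewrite EK EL -JE.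
have : const_sign (l - l') B I.
  apply: cs; rewrite !mem_cat; apply/orP; right; apply/orP; right.
  by apply/allpairsP; exists (l, l'); rewrite !mem_cat lN lN' orbT.
have cmp k k' : (forall i, I i -> dot k (B i) <= dot k' (B i)) ->
  cone B J `&` [set x | dot k' x <= 1] `<=` cone B J `&` [set x | dot k x <= 1].
  move=> h x [cx /= le]; split => //=; apply: le_trans le.
  have [t [t0 tI ->]] := cx; rewrite !dot_sumr; apply: ler_sum => i _; rewrite !dotZr.
  by have [/JI/h hi|/tI ->] := boolP (J i); [rewrite ler_wpM2l|rewrite !mul0r].
by move=> [h|h]; [left|right]; apply: cmp => i /h; rewrite dotBl ?subr_ge0 ?subr_le0.
Qed.

End CutAdditive.

(** * Faces of half polytopes *)
Section HalfPolytopes.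
Variable R : realType.
Implicit Types (x y u v w n m e p q : vec R) (c t : R) (A E F K P : set (vec R)).

Definition half P n := P `&` [set y | 0 <= dot n y].
Definition meets_pos P n := exists2 p, P p & 0 < dot n p.

Lemma half_polytope P n : polytope_o P -> polytope_o (half P n).
Proof. exact: polytope_cut. Qed.

Lemma halfN P n : half P (- n) = P `&` [set y | dot n y <= 0].
Proof. by congr (_ `&` _); apply/seteqP; split=> y /=; rewrite dotNl oppr_ge0. Qed.

Lemma slice_sub P u : slice P u `<=` P. Proof. by move=> y []. Qed.
Lemma half_sub P u : half P u `<=` P. Proof. by move=> y []. Qed.
Lemma slice_half P n : slice P n `<=` half P n.
Proof. by move=> y [Py /= ny]; split; rewrite //= ny. Qed.

Lemma sliceN P n : slice P (- n) = slice P n.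
Proof.
by congr (_ `&` _); apply/seteqP; split=> y /=; rewrite dotNl => /eqP; rewrite ?oppr_eq0 => /eqP // ->; rewrite oppr0.
Qed.

Lemma slice_halfE P n : slice (half P n) n = slice P n.
Proof.
apply/seteqP; split=> y; first by move=> [[Py _] ny].
by move=> [Py ny]; split => //; split; rewrite //= ny.
Qed.

Lemma slice_slice P n u : slice (slice P n) u = slice (slice P u) n.
Proof. by rewrite /slice setIAC. Qed.

Lemma half_slice P n u : half (slice P u) n = slice (half P n) u.
Proof. by rewrite /half /slice setIAC. Qed.

Lemma not_meets_pos P n : ~ meets_pos P n -> forall y, P y -> dot n y <= 0.
Proof. by move=> h y Py; rewrite leNgt; apply/negP => ny; apply: h; exists y. Qed.

(** Seen from a point strictly inside the half-space, [P] and its half have the same directions; [t]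
    stops where the segment leaves the half-space. *)
Lemma half_near P n p y : convex P -> P p -> 0 < dot n p -> P y ->
  exists2 t, 0 < t <= 1 & half P n ((1 - t) *: p + t *: y).
Proof.
move=> cP Pp np Py.
have [ny|ny] := leP 0 (dot n y).
  exists 1; first by rewrite ltr01 lexx.
  by rewrite subrr scale0r add0r scale1r.
exists (dot n p / (dot n p - dot n y)).
  by rewrite divr_gt0 //= ?ler_pdivrMr; lra.
split.
  by apply: cP => //; rewrite divr_ge0 ?ler_pdivrMr /=; lra.
rewrite /= !dotlin; set a := dot n p in np *; set b := dot n y in ny *.
have -> : (1 - a / (a - b)) * a + a / (a - b) * b = 0 by field; lra.
by [].
Qed.

(** Support at [p] is a condition on the directions from [p], and these are the same for the half
    and for [P]. *)
Lemma local_nonpos P n u p : convex P -> half P n p -> 0 < dot n p -> dot u p = 0 ->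
  nonpos (half P n) u -> nonpos P u.
Proof.
move=> cP [Pp _] np up h y Py; have [t /andP[t0 t1] /h] := half_near cP Pp np Py.
by rewrite dotDr !dotZr up mulr0 add0r pmulr_rle0.
Qed.

Lemma local_vanish P n u : convex P -> meets_pos P n ->
  (forall y, half P n y -> dot u y = 0) -> forall y, P y -> dot u y = 0.
Proof.
move=> cP [p Pp np] h y Py; have hp : half P n p by split => //; exact: ltW.
have np1 : nonpos (half P n) u by move=> z hz; rewrite (h z hz).
have np2 : nonpos (half P n) (- u) by move=> z hz; rewrite dotNl (h z hz) oppr0.
have up : dot (- u) p = 0 by rewrite dotNl (h p hp) oppr0.
apply/eqP; rewrite eq_le (local_nonpos cP hp np (h _ hp) np1 Py) /=.
by rewrite -oppr_le0 -dotNl (local_nonpos cP hp np up np2 Py).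
Qed.

Lemma half_dim3 P n : convex P -> P 0 -> meets_pos P n -> affdim_ge P 3 -> affdim_ge (half P n) 3.
Proof.
move=> cP P0 mp d3; apply: contrapT => h.
have h0 : half P n 0 by split; rewrite //= dot0r.
have [m m0 hm] := not_affdim3 h0 h.
by move/eqP: m0; apply; apply: (full_dot0 P0 d3); exact: local_vanish mp hm.
Qed.

Lemma half_dim2 P n : convex P -> P 0 -> meets_pos P n -> affdim_ge P 2 -> affdim_ge (half P n) 2.
Proof.
move=> cP P0 [p Pp np] /(affdim2P P0) [e1 [e2 [P1 P2 c0]]]; apply: contrapT => h.
have h0 : half P n 0 by split; rewrite //= dot0r.
have [e he] := not_affdim2 h0 h.
have [k pE] : exists k, p = k *: e by apply: he; split => //; exact: ltW.
have k0 : k != 0 by apply/eqP => k0; rewrite pE k0 scale0r dot0r ltxx in np.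
have line y : P y -> exists t, y = t *: e.
  move=> Py; have [t /andP[t0 _] /he [s yE]] := half_near cP Pp np Py.
  exists ((s - (1 - t) * k) / t); apply: (scalerI (lt0r_neq0 t0)).
  rewrite scalerA mulrC divfK ?gt_eqF // scalerBl -yE pE scalerA.
  by rewrite addrAC subrr add0r.
have [t1 E1] := line _ P1; have [t2 E2] := line _ P2.
by move/eqP: c0; apply; rewrite E1 E2 crossZl crossZr crossxx !scaler0.
Qed.

Lemma half_dim1 P n : P 0 -> meets_pos P n -> affdim_ge (half P n) 1.
Proof.
move=> P0 [p Pp np]; apply/affdim1P; first by split; rewrite //= dot0r.
exists p; first by split => //; exact: ltW.
by apply/eqP => p0; rewrite p0 dot0r ltxx in np.
Qed.

(** Every segment between the two sides of the plane crosses the slice, so the ratio of [m] to [n]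
    is the same at all points off the plane. *)
Lemma slice_vanish P n m : convex P -> meets_pos P n -> meets_pos P (- n) ->
  (forall y, slice P n y -> dot m y = 0) ->
  exists k, forall y, P y -> dot m y = k * dot n y.
Proof.
move=> cP [p Pp np] [q Pq]; rewrite dotNl oppr_gt0 => nq h.
have cr a b : P a -> P b -> 0 < dot n a -> dot n b < 0 ->
    dot n a * dot m b = dot n b * dot m a.
  move=> Pa Pb na nb.
  have := h (crossing n a b); rewrite /crossing dotZr dotBr !dotZr => e.
  have : slice P n (crossing n a b).
    by split; [apply: crossing_conv => //; exact: ltW|exact: dot_crossing].
  move=> /e /eqP; rewrite mulf_eq0 invr_eq0 subr_eq0 => /orP[/eqP|/eqP]; lra.
exists (dot m p / dot n p) => y Py.
have np0 : dot n p != 0 by rewrite gt_eqF.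
have [ny|ny|ny] := ltgtP (dot n y) 0.
- have := cr _ _ Pp Py np ny => e; apply: (mulfI np0); rewrite e; field; exact: np0.
- have e1 := cr _ _ Pp Pq np nq; have e2 := cr _ _ Py Pq ny nq.
  apply: (mulfI (ltr0_neq0 nq)); rewrite -e2 (mulrC (_ / _)) mulrCA.
  have -> : dot n q * (dot m p / dot n p) = dot m q.
    by rewrite mulrA -e1 mulrAC divff // mul1r.
  by [].
- rewrite ny mulr0; apply: h; split => //.
Qed.

Lemma normals_parallel u e1 e2 : cross e1 e2 != 0 -> dot u e1 = 0 -> dot u e2 = 0 ->
  exists k, u = k *: cross e1 e2.
Proof.
move=> c0 h1 h2; exists (dot (cross e1 e2) u / dot (cross e1 e2) (cross e1 e2)).
by apply: cross_eq0 => //; rewrite cross_cross (dotC e1) (dotC e2) h1 h2 !scale0r subr0.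
Qed.

Lemma parallel_normals u v e1 e2 : cross e1 e2 != 0 -> u != 0 ->
  dot u e1 = 0 -> dot u e2 = 0 -> dot v e1 = 0 -> dot v e2 = 0 -> exists k, v = k *: u.
Proof.
move=> c0 u0 h1 h2 h3 h4.
have [k uE] := normals_parallel c0 h1 h2; have [l vE] := normals_parallel c0 h3 h4.
have k0 : k != 0 by apply/eqP => k0; rewrite uE k0 scale0r eqxx in u0.
by exists (l / k); rewrite vE uE scalerA divfK.
Qed.

Lemma orthogonal_pair n : exists m m', [/\ dot m n = 0, dot m' n = 0 & (n != 0 -> cross m m' != 0)].
Proof.
have [->|n0] := eqVneq n 0; first by exists 0, 0; rewrite dot0l.
have [m m0 mn] : exists2 m, m != 0 & dot m n = 0.
  have d1 : ~ affdim_ge [set t *: n | t in [set: R]] 3.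
    have h0 : [set t *: n | t in [set: R]] 0 by exists 0 => //; rewrite scale0r.
    move=> /(affdim3P h0) [e1 [e2 [e3 [[t1 _ <-] [t2 _ <-] _]]]].
    by rewrite /det3 crossZl crossZr crossxx !scaler0 dot0l eqxx.
  have [|m m0 h] := not_affdim3 _ d1; first by exists 0 => //; rewrite scale0r.
  by exists m => //; apply: h; exists 1 => //; rewrite scale1r.
exists m, (cross m n); split => //; first by rewrite dot_crossr.
move=> _; rewrite crossN cross_cross (dotC n) mn scale0r subr0 oppr_eq0 scaler_eq0.
by rewrite negb_or n0 andbT gt_eqF // dot_gt0.
Qed.

Lemma slice_dim1 P n u : polytope_o P -> meets_pos P n -> meets_pos P (- n) ->
  u != 0 -> (forall y, P y -> dot u y = 0) -> affdim_ge P 2 ->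
  affdim_eq (slice P n) 1.
Proof.
move=> hP pos neg u0 uP; have P0 := hP.2; have cP := polytope_convex hP.
move=> /(affdim2P P0) [e1 [e2 [P1 P2 c0]]].
have h0 : slice P n 0 by split; rewrite //= dot0r.
have nu k : n = k *: u -> False.
  by move=> nE; have [p /uP up] := pos; rewrite nE dotZl up mulr0 ltxx.
split.
  apply: contrapT => h.
  (* On a slice reduced to the origin every functional vanishes. The cross product of [u] and [n]
     would then be a combination of [u] and [n], to which it is orthogonal, hence zero. *)
  have z y : slice P n y -> dot (cross u n) y = 0.
    move=> sy; have [->|y0] := eqVneq y 0; first by rewrite dot0r.
    by exfalso; apply: h; apply/(affdim1P h0); exists y.
  have [k hk] := slice_vanish cP pos neg z.
  have k1 y : P y -> dot (cross u n - k *: n) y = 0 by move=> /hk; rewrite dotBl dotZl => ->; rewrite subrr.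
  have [l lE] := parallel_normals c0 u0 (uP _ P1) (uP _ P2) (k1 _ P1) (k1 _ P2).
  have cu : cross u n = 0.
    apply: dot_eq0; rewrite {2}(_ : cross u n = l *: u + k *: n); last by rewrite -lE subrK.
    by rewrite dotDr !dotZr dot_crossl dot_crossr !mulr0 addr0.
  by apply: (nu (dot u n / dot u u)); exact: cross_eq0.
move=> /(affdim2P h0) [a [b [[Pa na] [Pb nb] cab]]].
by have [k] := parallel_normals cab u0 (uP _ Pa) (uP _ Pb) na nb; exact: nu.
Qed.

Section Strict.
Variables (P : set (vec R)) (n : vec R).
Hypothesis hP : polytope_o P.
Hypotheses (pos : meets_pos P n) (neg : meets_pos P (- n)).
Let cP : convex P := polytope_convex hP.
Let P0 : P 0 := hP.2.

Lemma strict_n0 : n != 0.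
Proof. by apply/eqP => e; have [p _] := pos; rewrite e dot0l ltxx. Qed.

Lemma nonpos_not_multiple u k : u != 0 -> nonpos P u -> u = k *: n -> False.
Proof.
move=> u0 np uE; have [p Pp p0] := pos; have [q Pq] := neg; rewrite dotNl oppr_gt0 => q0.
have := np _ Pp; have := np _ Pq; rewrite uE !dotZl => h1 h2.
have k0 : k != 0 by apply/eqP => k0; rewrite uE k0 scale0r eqxx in u0.
by rewrite pmulr_lle0 // in h2; rewrite nmulr_lle0 // in h1; case/eqP: k0; lra.
Qed.

(** A slice inside a line is annihilated by a nonzero functional orthogonal to [n], but
    [slice_vanish] makes such a functional a multiple of [n]. *)
Lemma slice_dim2 : affdim_ge P 3 -> affdim_ge (slice P n) 2.
Proof.
move=> d3; apply: contrapT => h.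
have h0 : slice P n 0 by split; rewrite //= dot0r.
have [e he] := not_affdim2 h0 h.
have [m [m' [mn mn' c0]]] := orthogonal_pair n.
have c0' := c0 strict_n0.
have key k : dot k n = 0 -> (forall y, slice P n y -> dot k y = 0) -> k = 0.
  move=> kn hk; have [l hl] := slice_vanish cP pos neg hk.
  have kE : k - l *: n = 0.
    by apply: (full_dot0 P0 d3) => y Py; rewrite dotBl dotZl hl // subrr.
  move/eqP: kE; rewrite subr_eq0 => /eqP kE.
  move: kn; rewrite kE dotZl => /eqP; rewrite mulf_eq0 (gt_eqF (dot_gt0 strict_n0)) orbF => /eqP ->.
  by rewrite scale0r.
(* The combination of [m] and [m'] that vanishes at [e]. *)
pose k := dot m' e *: m - dot m e *: m'.
have k0 : k = 0.
  apply: key; first by rewrite /k dotBl !dotZl mn mn' !mulr0 subrr.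
  by move=> y /he [t ->]; rewrite /k dotBl !dotZl !dotZr; ring.
have me : dot m e = 0.
  have := congr1 (fun z : vec R => cross m z) k0; rewrite /k crossDr crossZr crossxx scaler0 add0r -scaleNr crossZr cross0r.
  by move/eqP; rewrite scaler_eq0 (negbTE c0') orbF oppr_eq0 => /eqP.
have m0 : m = 0 by apply: key => // y /he [t ->]; rewrite dotZr me mulr0.
by rewrite m0 cross0l eqxx in c0'.
Qed.

(** A facet of the half either reaches the open half-space, where its plane supports all of [P], or
    lies in the cutting plane and is the slice. *)
Lemma facets_half F' : affdim_ge P 3 -> facets_o (half P n) F' <->
  F' = slice P n \/ exists2 F, facets_o P F /\ meets_pos F n & F' = half F n.
Proof.
move=> d3; rewrite (facets_oP _ (half_polytope n hP)); split.
  move=> [u [u0 np FE d2]].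
  have [[p Fp pp]|h] := pselect (meets_pos F' n).
    right; have := Fp; rewrite FE => -[hp up].
    have npP := local_nonpos cP hp pp up np.
    exists (slice P u); last by rewrite half_slice.
    split; last by exists p => //; split => //; exact: hp.1.
    apply/(facets_oP _ hP); exists u; split => //; apply: affdim_sub d2.
    by rewrite FE => y [[Py _] uy].
  left; have F0 : F' 0 by rewrite FE; split; [split|]; rewrite //= dot0r.
  have nF y : F' y -> dot n y = 0.
    move=> Fy; apply/eqP; rewrite eq_le (not_meets_pos h) //.
    by move: Fy; rewrite FE => -[[_ ]].
  have uF y : F' y -> dot u y = 0 by rewrite FE => -[_].
  have [e1 [e2 [F1 F2 c0]]] := (affdim2P F0).1 d2.
  have [k nE] := parallel_normals c0 u0 (uF _ F1) (uF _ F2) (nF _ F1) (nF _ F2).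
  have [l uE] := parallel_normals c0 strict_n0 (nF _ F1) (nF _ F2) (uF _ F1) (uF _ F2).
  rewrite FE; apply/seteqP; split=> y.
    by move=> [[Py _] uy]; split => //; rewrite /= nE dotZl uy mulr0.
  by move=> sy; split; [exact: slice_half|rewrite /= uE dotZl sy.2 mulr0].
case=> [->|[F [/(facets_oP _ hP) [u [u0 np FE d2]] mp] ->]].
  exists (- n); rewrite oppr_eq0 strict_n0 sliceN slice_halfE; split => //; last exact: slice_dim2.
  by move=> y [_ /=]; rewrite dotNl oppr_le0.
exists u; split => //; first by move=> y [/np].
  by rewrite FE half_slice.
apply: half_dim2 => //; first by rewrite FE; exact: polytope_convex (slice_polytope u hP).
by rewrite FE; split; rewrite //= dot0r.
Qed.

(* Tilting the supporting plane [u] of the section slightly makes it support the half. *)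
Lemma tilt u : nonpos (slice P n) u ->
  exists t, nonpos (half P n) (u - t *: n) /\ slice (half P n) (u - t *: n) = slice (slice P n) u.
Proof.
move=> np; have hH := half_polytope n hP; have [[s sE] H0] := hH.
pose t := 1 + \sum_(v <- s | 0 < dot n v) `|dot u v| / dot n v.
have sH v : v \in s -> half P n v by rewrite sE; exact: conv_mem.
have lt v : v \in s -> 0 < dot n v -> dot (u - t *: n) v < 0.
  move=> vs nv; rewrite dotBl dotZl subr_lt0 -ltr_pdivrMr // /t.
  rewrite (big_rem v vs) /= nv.
  have h1 : dot u v / dot n v <= `|dot u v| / dot n v by rewrite ler_pM2r ?invr_gt0 // ler_norm.
  have h2 : 0 <= \sum_(y <- rem v s | 0 < dot n y) `|dot u y| / dot n y.
    by apply: sumr_ge0 => y ny; rewrite divr_ge0 // ltW.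
  lra.
have eq v : v \in s -> dot n v = 0 -> dot (u - t *: n) v <= 0.
  move=> vs nv; rewrite dotBl dotZl nv mulr0 subr0; apply: np; split => //; exact: (sH _ vs).1.
have npt : nonpos (half P n) (u - t *: n).
  rewrite sE => y; apply: conv_le => v vs; have := (sH _ vs).2; rewrite /= le_eqVlt.
  by move=> /orP[/eqP/esym/(eq _ vs)//|/(lt _ vs)/ltW].
exists t; split => //; apply/seteqP; split=> y; last first.
  move=> [sy uy]; split; first exact: slice_half.
  by rewrite /= dotBl dotZl uy sy.2 mulr0 subr0.
rewrite sE slice_conv ?sE -?sE // => hy.
have Hy : half P n y.
  by rewrite sE; apply: conv_subset hy => v; rewrite mem_filter => /andP[].
have ny : dot n y = 0.
  have h1 : dot n y <= 0.
    apply: conv_le hy => v; rewrite mem_filter => /andP[/eqP e vs].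
    by rewrite leNgt; apply/negP => /(lt _ vs); rewrite e ltxx.
  by apply/eqP; rewrite eq_le h1 (Hy.2).
split; first by split => //; exact: Hy.1.
have h : slice (half P n) (u - t *: n) y by rewrite sE slice_conv -?sE.
by have := h.2; rewrite /= dotBl dotZl ny mulr0 subr0.
Qed.

Lemma half_edge E u : u != 0 -> nonpos (half P n) u -> E = slice (half P n) u ->
  affdim_eq E 1 -> meets_pos E n -> exists2 E', edges_o P E' /\ meets_pos E' n & E = half E' n.
Proof.
move=> u0 np EE [d1 d2] [p Ep pp]; have := Ep; rewrite EE => -[hp up].
have npP := local_nonpos cP hp pp up np.
have mp : meets_pos (slice P u) n by exists p => //; split => //; exact: hp.1.
exists (slice P u); last by rewrite half_slice.
split => //; apply/(edges_oP _ hP); exists u; split => //; split.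
  by apply: affdim_sub d1; rewrite EE => y [[Py _] uy].
move=> h; apply: d2; rewrite EE -half_slice; apply: half_dim2 => //.
  exact: polytope_convex (slice_polytope u hP).
exact: (slice_polytope u hP).2.
Qed.

Lemma edge_half E : edges_o P E -> meets_pos E n -> edges_o (half P n) (half E n).
Proof.
move=> /(edges_oP _ hP) [u [u0 np EE [d1 d2]]] mp; apply/(edges_oP _ (half_polytope n hP)).
exists u; split => //; first by move=> y [/np].
  by rewrite EE half_slice.
split; first by apply: half_dim1 => //; rewrite EE; exact: (slice_polytope u hP).2.
by move=> h; apply: d2; apply: affdim_sub h; exact: half_sub.
Qed.

(** The new edges are those of the slice: [tilt] makes a plane that supports the slice support the
    half, with the same contact set. *)
Lemma edges_half3 E' : affdim_ge P 3 -> edges_o (half P n) E' <->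
  edges_o (slice P n) E' \/ exists2 E, edges_o P E /\ meets_pos E n & E' = half E n.
Proof.
move=> d3; split; last first.
  case=> [|[E [eE mp] ->]]; last exact: edge_half.
  move=> /(edges_oP _ (slice_polytope n hP)) [u [u0 np EE d1]].
  have [t [npt st]] := tilt np.
  apply/(edges_oP _ (half_polytope n hP)); exists (u - t *: n); split => //; last by rewrite st.
  apply/eqP => /eqP; rewrite subr_eq0 => /eqP uE.
  case: d1 => _; apply; rewrite EE (_ : slice (slice P n) u = slice P n); first exact: slice_dim2.
  apply/seteqP; split=> y; first by case.
  by move=> sy; split => //; rewrite /= uE dotZl sy.2 mulr0.
move=> /(edges_oP _ (half_polytope n hP)) [u [u0 np EE d1]].
have [mp|h] := pselect (meets_pos E' n); first by right; exact: half_edge EE d1 mp.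
left; apply/(edges_oP _ (slice_polytope n hP)); exists u; split => //.
  by move=> y /slice_half; exact: np.
rewrite EE; apply/seteqP; split=> y; last by move=> [/slice_half ? ?].
move=> [Hy uy]; split => //; split; first exact: Hy.1.
apply/eqP; rewrite eq_le (Hy.2 : 0 <= dot n y) andbT; apply: (not_meets_pos h).
by rewrite EE.
Qed.

Lemma edges_half2 E' m : m != 0 -> (forall y, P y -> dot m y = 0) -> affdim_ge P 2 ->
  edges_o (half P n) E' <->
  E' = slice P n \/ exists2 E, edges_o P E /\ meets_pos E n & E' = half E n.
Proof.
move=> m0 mP d2; have [s1 s2] := slice_dim1 hP pos neg m0 mP d2.
have S0 : slice P n 0 by split; rewrite //= dot0r.
split; last first.
  case=> [->|[E [eE mp] ->]]; last exact: edge_half.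
  apply/(edges_oP _ (half_polytope n hP)); exists (- n).
  rewrite oppr_eq0 strict_n0 sliceN slice_halfE; split => //.
  by move=> y [_ /=]; rewrite dotNl oppr_le0.
move=> /(edges_oP _ (half_polytope n hP)) [u [u0 np EE d1]].
have [mp|h] := pselect (meets_pos E' n); first by right; exact: half_edge EE d1 mp.
left.
have E'S : E' `<=` slice P n.
  move=> y Ey; have := Ey; rewrite EE => -[Hy uy]; split; first exact: Hy.1.
  by apply/eqP; rewrite eq_le (Hy.2 : 0 <= dot n y) andbT; exact: (not_meets_pos h).
apply/seteqP; split => // y Sy.
have E0 : E' 0 by rewrite EE; split; [split|]; rewrite //= dot0r.
have [e [Ee e0 _]] := edge_line E0 d1.
have [f [Sf f0 Sl]] := edge_line S0 (conj s1 s2).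
have [te eE] := Sl _ (E'S _ Ee); have [ty yE] := Sl _ Sy.
have te0 : te != 0 by apply/eqP => t0; rewrite eE t0 scale0r eqxx in e0.
rewrite EE; split; first exact: slice_half.
have : dot u e = 0 by move: Ee; rewrite EE => -[].
rewrite eE dotZr => /eqP; rewrite mulf_eq0 (negbTE te0) /= => /eqP uf.
by rewrite /= yE dotZr uf mulr0.
Qed.

(** Apart from the cutting plane, the planes through an edge of the slice form the pencil [u - t n],
    and they support [P] for [t] between [r a] and [r b]. For [t] inside a proper interval the plane
    touches [P] only in the edge. If the interval is a point, the plane touches [P] on both sides of
    the cut and carries a split facet. *)
Lemma edges_slice E' : affdim_ge P 3 -> edges_o (slice P n) E' <->
  (edges_o P E' /\ E' `<=` [set y | dot n y = 0]) \/
  exists2 F, [/\ facets_o P F, meets_pos F n & meets_pos F (- n)] & E' = slice F n.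
Proof.
move=> d3; have hS := slice_polytope n hP; split; last first.
  case=> [[/(edges_oP _ hP) [u [u0 np EE d1]] En]|[F [/(facets_oP _ hP) [u [u0 np FE d2]] mp mn] ->]].
    apply/(edges_oP _ hS); exists u; split => //; first by move=> y /slice_sub; exact: np.
    rewrite slice_slice -EE; apply/seteqP; split=> y; last by case.
    by move=> Ey; split => //; exact: En.
  apply/(edges_oP _ hS); exists u; split => //; first by move=> y /slice_sub; exact: np.
    by rewrite FE slice_slice.
  have hF : polytope_o F by rewrite FE; exact: slice_polytope.
  by apply: (slice_dim1 hF mp mn u0 _ d2) => y; rewrite FE => -[].
move=> /(edges_oP _ hS) [u [u0 np EE d1]].
have [[s sE] _] := hP.
have sP v : v \in s -> P v by rewrite sE; exact: conv_mem.
have nz t : u - t *: n != 0.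
  apply/eqP => /eqP; rewrite subr_eq0 => /eqP uE.
  case: d1 => _; apply; rewrite EE (_ : slice (slice P n) u = slice P n); first exact: slice_dim2.
  apply/seteqP; split=> y; first by case.
  by move=> sy; split => //; rewrite /= uE dotZl sy.2 mulr0.
have ex k : meets_pos P k -> exists2 v, v \in s & 0 < dot k v.
  move=> [p Pp pp]; rewrite sE in Pp; have [v [vs _ h]] := conv_max k (conv_neq0 Pp).
  by exists v => //; exact: lt_le_trans pp (h _ Pp).
pose U := [seq v <- s | 0 < dot n v]; pose W := [seq v <- s | dot n v < 0].
(* The parameter at which the plane of the pencil passes through [v]. *)
pose r v := dot u v / dot n v.
have [a aU amax] : exists2 a, a \in U & forall v, v \in U -> r v <= r a.
  have [v vs v0] := ex _ pos; have vU : v \in U by rewrite mem_filter v0.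
  clear -vU; elim: U v vU => // b U IH v _; have [->|] := eqVneq U [::].
    by exists b; rewrite ?mem_head // => w; rewrite mem_seq1 => /eqP ->.
  case: U IH => // c U IH _; have [a aU h] := IH c (mem_head _ _).
  have [l|l] := leP (r b) (r a).
    by exists a => [|w]; rewrite inE ?aU ?orbT // => /orP[/eqP ->//|/h].
  exists b => [|w]; rewrite inE ?eqxx // => /orP[/eqP ->//|/h h'].
  exact: le_trans h' (ltW l).
have [b bW bmin] : exists2 b, b \in W & forall v, v \in W -> r b <= r v.
  have [v vs] := ex _ neg; rewrite dotNl oppr_gt0 => v0; have vW : v \in W by rewrite mem_filter v0.
  clear -vW; elim: W v vW => // b W IH v _; have [->|] := eqVneq W [::].
    by exists b; rewrite ?mem_head // => w; rewrite mem_seq1 => /eqP ->.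
  case: W IH => // c W IH _; have [a aW h] := IH c (mem_head _ _).
  have [l|l] := leP (r a) (r b).
    by exists a => [|w]; rewrite inE ?aW ?orbT // => /orP[/eqP ->//|/h].
  exists b => [|w]; rewrite inE ?eqxx // => /orP[/eqP ->//|/h h'].
  exact: le_trans (ltW l) h'.
move: (aU) (bW); rewrite !mem_filter => /andP[na as_] /andP[nb bs].
have rab : r a <= r b.
  have := np (crossing n a b); rewrite /crossing dotZr dotBr !dotZr => h.
  have : slice P n (crossing n a b).
    split; last exact: dot_crossing.
    by apply: crossing_conv => //; [exact: ltW|exact: sP|exact: sP].
  move=> /h; rewrite pmulr_rle0 ?invr_gt0; last lra.
  by move=> h'; rewrite /r ler_pdivrMr // mulrAC ler_ndivlMr //; lra.
have split_dot v t : dot (u - t *: n) v = dot u v - t * dot n v by rewrite dotBl dotZl.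
have npt t : r a <= t -> t <= r b -> nonpos P (u - t *: n).
  move=> at_ tb; rewrite sE => y; apply: conv_le => v vs; rewrite split_dot.
  have [nv|nv|nv] := ltgtP (dot n v) 0.
  - have : r b <= r v by apply: bmin; rewrite mem_filter nv.
    move=> /(le_trans tb); rewrite /r ler_ndivlMr //; lra.
  - have : r v <= r a by apply: amax; rewrite mem_filter nv.
    move=> /le_trans /(_ at_); rewrite /r ler_pdivrMr //; lra.
  - rewrite nv mulr0 subr0; apply: np; split => //; exact: sP.
have EP t y : E' y -> slice P (u - t *: n) y.
  by rewrite EE => -[[Py ny] uy]; split => //; rewrite /= split_dot uy ny mulr0 subr0.
have E0 : E' 0 by rewrite EE; split; [split|]; rewrite //= dot0r.
have [ab|ab] := ltP (r a) (r b).
  left; pose t := (r a + r b) / 2; have at_ : r a < t by rewrite /t; lra.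
  have tb : t < r b by rewrite /t; lra.
  have En : E' `<=` [set y | dot n y = 0] by rewrite EE => y [[]].
  split => //; apply/(edges_oP _ hP); exists (u - t *: n); split => //; first by apply: npt; exact: ltW.
  apply/seteqP; split=> y; first exact: EP.
  move=> sy; have := sy; rewrite sE slice_conv -?sE //; last by apply: npt; exact: ltW.
  move=> hy; have zero v : v \in [seq v <- s | dot (u - t *: n) v == 0] -> dot n v = 0.
    rewrite mem_filter => /andP[/eqP + vs]; rewrite split_dot => e.
    have [nv|nv|//] := ltgtP (dot n v) 0.
    - have : r b <= r v by apply: bmin; rewrite mem_filter nv.
      move=> /(lt_le_trans tb); rewrite /r ltr_ndivlMr //; lra.
    - have : r v <= r a by apply: amax; rewrite mem_filter nv.
      move=> /le_lt_trans /(_ at_); rewrite /r ltr_pdivrMr //; lra.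
  have ny : dot n y = 0.
    apply/eqP; rewrite eq_le; apply/andP; split.
      by apply: conv_le hy => v /zero ->.
    rewrite -oppr_le0 -dotNl; apply: conv_le hy => v /zero; rewrite dotNl => ->.
    by rewrite oppr0.
  have := sy.2; rewrite /= split_dot ny mulr0 subr0 => uy.
  by rewrite EE; split => //; split => //; exact: sy.1.
have rE : r a = r b by apply/eqP; rewrite eq_le rab.
right; pose k := u - r a *: n.
have npk : nonpos P k by apply: npt; rewrite ?lexx ?rE.
have ka : dot k a = 0 by rewrite split_dot /r divfK ?subrr // gt_eqF.
have kb : dot k b = 0 by rewrite split_dot rE /r divfK ?subrr // lt_eqF.
have Fa : slice P k a by split => //; exact: sP.
have Fb : slice P k b by split => //; exact: sP.
have F0 : slice P k 0 by split; rewrite //= dot0r.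
exists (slice P k).
  split; [|by exists a|by exists b; rewrite // dotNl oppr_gt0].
  apply/(facets_oP _ hP); exists k; split => //; first exact: nz.
  have [e [Ee e0 _]] := edge_line E0 d1.
  apply/(affdim2P F0); exists e, a; split => //; first exact: EP.
  apply/eqP => c0; have := cross_eq0 e0 c0 => aE.
  have ne : dot n e = 0 by move: Ee; rewrite EE => -[[]].
  by move: na; rewrite aE dotZr ne mulr0 ltxx.
rewrite EE slice_slice; apply/seteqP; split=> y.
  by move=> [[Py uy] ny]; split => //; split => //; rewrite /= split_dot uy ny mulr0 subr0.
move=> [[Py ky] ny]; split => //; split => //.
by move: ky; rewrite /= split_dot ny mulr0 subr0.
Qed.

End Strict.
End HalfPolytopes.

(** * Cut additivity of the sums over faces at the origin *)

Section FaceSums.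
Variable R : realType.
Implicit Types (x y u v w n m e p q : vec R) (c t : R) (A E F K P : set (vec R)).

(** A face is the hull of the generators it contains, so subsets of the generators index the
    faces. *)
Lemma faces_finite P (Fs : set (set (vec R))) : polytope_o P ->
  (forall F, Fs F -> exists u, nonpos P u /\ F = slice P u) -> finite_set Fs.
Proof.
move=> hP H; have [[s sE] _] := hP.
apply: (@sub_finite_set _ _ ((fun m : (size s).-tuple bool => conv (mask m s)) @` setT)).
  move=> F /H [u [np ->]].
  exists (map_tuple (fun v => dot u v == 0) (in_tuple s)) => //=.
  by rewrite -filter_mask sE slice_conv -?sE.
by apply: finite_image; exact: finite_finset.
Qed.

Lemma facets_finite P : polytope_o P -> finite_set (facets_o P).
Proof.
by move=> hP; apply: (faces_finite hP) => F /(facets_oP _ hP) [u [_ np FE _]]; exists u.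
Qed.

Lemma edges_finite P : polytope_o P -> finite_set (edges_o P).
Proof.
by move=> hP; apply: (faces_finite hP) => F /(edges_oP _ hP) [u [_ np FE _]]; exists u.
Qed.

Lemma facet_polytope P F : polytope_o P -> facets_o P F -> polytope_o F.
Proof. by move=> hP /(facets_oP _ hP) [u [_ _ -> _]]; exact: slice_polytope. Qed.

Lemma edge_polytope P F : polytope_o P -> edges_o P F -> polytope_o F.
Proof. by move=> hP /(edges_oP _ hP) [u [_ _ -> _]]; exact: slice_polytope. Qed.

(* For a polytope containing the origin this is the integral of [supp (face P u) x] over the
   unit normals [u] at the origin with respect to the Euler characteristic. *)
Definition gsum P x : R :=
  if `[< affdim_ge P 3 >] then
    \sum_(F \in facets_o P) supp F x - \sum_(E \in edges_o P) supp E x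
  else if `[< affdim_ge P 2 >] then 2 * supp P x - \sum_(E \in edges_o P) supp E x
  else 0.

Lemma hD_gsum a1 a2 b1 b2 P x : hD a1 a2 b1 b2 P x =
  a1 * supp P x + (a2 - a1) * gsum P x + b1 * supp P (- x) + (b2 - b1) * gsum P (- x).
Proof.
rewrite /hD /gsum supp_neg.
have e (Fs : set (set (vec R))) : \sum_(F \in Fs) supp (negset F) x = \sum_(F \in Fs) supp F (- x).
  by apply: eq_fsbigr => F _; rewrite supp_neg.
rewrite (e (facets_o P)) (e (edges_o P)); clear e.
by case: ifP => _; [ring|case: ifP => _; ring].
Qed.

(** A maximising point of [P] lies in one half, and the other half contains the slice. Conversely,
    points of the two halves are exchanged for a point of [P] and one of the slice with the same
    sum. *)
Lemma supp_cut P n x : polytope_o P ->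
  supp P x + supp (slice P n) x = supp (half P n) x + supp (half P (- n)) x.
Proof.
move=> hP; have bP := polytope_bdd hP; have P0 := hP.2.
have b1 : bdd (half P n) := bdd_sub (@half_sub _ P n) bP.
have b2 : bdd (half P (- n)) := bdd_sub (@half_sub _ P (- n)) bP.
have b3 : bdd (slice P n) := bdd_sub (@slice_sub _ P n) bP.
have H k : (slice P k) 0 by split; rewrite //= dot0r.
have H' k : (half P k) 0 by split; rewrite //= dot0r.
apply/eqP; rewrite eq_le; apply/andP; split.
  rewrite -lerBrDr; apply: supp_le => [|y Py]; first by exists 0.
  have W k : dot k y >= 0 -> bdd (half P k) -> bdd (half P (- k)) ->
      dot x y + supp (slice P k) x <= supp (half P k) x + supp (half P (- k)) x.
    move=> ky bk bk'; apply: lerD; first by apply: supp_ge.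
    apply: supp_le; first by exists 0.
    by move=> z [Pz kz]; apply: supp_ge => //; split; rewrite //= dotNl kz oppr0.
  rewrite lerBrDr; have [h|h] := leP 0 (dot n y); first exact: (W n h b1 b2).
  have := W (- n); rewrite opprK sliceN dotNl oppr_ge0 addrC => /(_ (ltW h) b2 b1).
  by rewrite [leRHS]addrC addrC.
rewrite -lerBrDr; apply: supp_le => [|y [Py ny]]; first by exists 0.
rewrite lerBrDr addrC -lerBrDr; apply: supp_le => [|z [Pz nz]]; first by exists 0.
rewrite lerBrDr addrC.
have [n0|n0] := eqVneq (dot n y) 0.
  by rewrite addrC; apply: lerD; apply: supp_ge.
have np : 0 < dot n y by rewrite lt_neqAle eq_sym n0.
have nz' : dot n z <= 0 by move: nz; rewrite /= dotNl oppr_ge0.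
have [nz0|nz0] := eqVneq (dot n z) 0; first by apply: lerD; apply: supp_ge.
have nzn : dot n z < 0 by rewrite lt_neqAle nz0.
pose a := dot n y; pose b := - dot n z.
have ab : 0 < a + b by rewrite addr_gt0 ?oppr_gt0.
have cr : slice P n (crossing n y z).
  by split; [apply: crossing_conv => //; exact: polytope_convex|exact: dot_crossing].
(* The segment [y, z] meets the hyperplane in [c]; [y + z - c] lies on the same segment. *)
pose d := y + z - crossing n y z.
have Pd : P d.
  have -> : d = (1 - b / (a + b)) *: y + (b / (a + b)) *: z + 0.
    rewrite /d /crossing /a /b; apply: vec_eq; rewrite !mxE; by field; rewrite ?(gt_eqF ab).
  rewrite addr0; apply: (polytope_convex hP) => //.
  by rewrite divr_ge0 ?(ltW ab) ?ler_pdivrMr ?mul1r ?lerDr ?(ltW np) //= oppr_ge0.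
have -> : dot x y + dot x z = dot x d + dot x (crossing n y z).
  by rewrite /d dotBr dotDr subrK.
by apply: lerD; apply: supp_ge.
Qed.

Lemma supp0set (A : set (vec R)) x : (forall y, A y <-> y = 0) -> supp A x = 0.
Proof.
move=> h; rewrite (@supp_eq _ A x 0) ?dot0r //; first by apply/h.
by move=> z /h ->; rewrite dot0r.
Qed.

Lemma half_nonneg P n : ~ meets_pos P (- n) -> half P n = P.
Proof.
move=> h; apply/seteqP; split; first exact: half_sub.
by move=> y Py; split => //=; have := not_meets_pos h Py; rewrite dotNl oppr_le0.
Qed.

Section GsumCut.
Variables (P : set (vec R)) (n x : vec R).
Hypothesis hP : polytope_o P.
Hypotheses (pos : meets_pos P n) (neg : meets_pos P (- n)).

Let Pos : set (set (vec R)) := [set F | meets_pos F n].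
Let Neg : set (set (vec R)) := [set F | meets_pos F (- n)].
(** What [F] contributes to the face sums of the two halves together. *)
Let phi F : R := (if F \in Pos then supp (half F n) x else 0) +
  (if F \in Neg then supp (half F (- n)) x else 0).

Lemma sum_half_image k (Fs : set (set (vec R))) : finite_set Fs ->
  (forall F F', Fs F -> Fs F' -> meets_pos F k -> meets_pos F' k -> half F k = half F' k -> F = F') ->
  \sum_(G \in [set G | exists2 F, Fs F /\ meets_pos F k & G = half F k]) supp G x =
  \sum_(F \in Fs) if F \in [set F | meets_pos F k] then supp (half F k) x else 0.
Proof.
move=> fin inj.
have -> : [set G | exists2 F, Fs F /\ meets_pos F k & G = half F k] =
    (fun F => half F k) @` (Fs `&` [set F | meets_pos F k]).
  by apply/seteqP; split=> G [F h]; [move=> ->; exists F|move=> <-; exists F].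
rewrite fsbig_image ?fsbig_mkcondr // => F F' /set_mem [h1 h2] /set_mem [h3 h4]; exact: inj.
Qed.

Lemma meets_pos_half F k : meets_pos F k -> meets_pos (half F k) k.
Proof. by move=> [p Fp kp]; exists p => //; split => //; exact: ltW. Qed.

(** The half of a facet still spans the plane of the facet. *)
Lemma facet_half_inj k F F' : meets_pos P k -> facets_o P F -> facets_o P F' ->
  meets_pos F k -> meets_pos F' k -> half F k = half F' k -> F = F'.
Proof.
move=> _ hF hF' mF mF' e; have pF := facet_polytope hP hF.
move/(facets_oP _ hP): hF => [u [u0 np FE d2]].
move/(facets_oP _ hP): hF' => [u' [u0' np' FE' d2']].
have pH := half_polytope k pF.
have [e1 [e2 [F1 F2 c0]]] := (affdim2P pH.2).1 (half_dim2 (polytope_convex pF) pF.2 mF d2).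
have uH y : half F k y -> dot u y = 0 by move=> [+ _]; rewrite FE => -[].
have uH' y : half F k y -> dot u' y = 0 by rewrite e => -[+ _]; rewrite FE' => -[].
have [a aE] := parallel_normals c0 u0 (uH _ F1) (uH _ F2) (uH' _ F1) (uH' _ F2).
have [b bE] := parallel_normals c0 u0' (uH' _ F1) (uH' _ F2) (uH _ F1) (uH _ F2).
rewrite FE FE'; apply/seteqP; split=> y [Py uy]; split => //=.
  by rewrite aE dotZl uy mulr0.
by rewrite bE dotZl uy mulr0.
Qed.

Lemma edge_half_inj k F F' : edges_o P F -> edges_o P F' ->
  meets_pos F k -> meets_pos F' k -> half F k = half F' k -> F = F'.
Proof.
have W G G' : edges_o P G -> edges_o P G' -> meets_pos G k -> half G k = half G' k -> G `<=` G'.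
  move=> hG hG' [p Gp kp] e; have pG := edge_polytope hP hG.
  move/(edges_oP _ hP): hG => [u [u0 np GE d1]].
  move/(edges_oP _ hP): hG' => [u' [u0' np' GE' _]].
  have [f [Gf f0 line]] := edge_line pG.2 d1; have [t pE] := line _ Gp.
  have t0 : t != 0 by apply/eqP => t0; rewrite pE t0 scale0r dot0r ltxx in kp.
  have : half G k p by split => //; exact: ltW.
  rewrite e => -[+ _]; rewrite GE' pE => -[_ /=]; rewrite dotZr => /eqP.
  rewrite mulf_eq0 (negbTE t0) /= => /eqP uf y Gy; have [s yE] := line _ Gy.
  split; last by rewrite /= yE dotZr uf mulr0.
  by move: Gy; rewrite GE => -[].
by move=> hF hF' mF mF' e; apply/seteqP; split; apply: W.
Qed.

Lemma phi_split F : polytope_o F -> (meets_pos F n \/ meets_pos F (- n)) ->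
  phi F = supp F x + (if F \in Pos `&` Neg then supp (slice F n) x else 0).
Proof.
move=> hF h; rewrite /phi in_setI.
have [/set_mem p|p] := boolP (F \in Pos); have [/set_mem q|q] := boolP (F \in Neg); rewrite /=.
- by rewrite -supp_cut.
- by rewrite !addr0 half_nonneg // => ?; move/negP: q; apply; exact: mem_set.
- rewrite add0r addr0 half_nonneg // opprK => ?; move/negP: p; apply; exact: mem_set.
- by exfalso; case: h => ?; [move/negP: p|move/negP: q]; apply; exact: mem_set.
Qed.

(** A facet inside the cutting plane would make this plane support [P], which has points on both
    sides. *)
Lemma facet_strict F : facets_o P F -> meets_pos F n \/ meets_pos F (- n).
Proof.
move=> hF; apply: contrapT => /not_orP [h1 h2]; have pF := facet_polytope hP hF.
move/(facets_oP _ hP): hF => [u [u0 np FE d2]].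
have nF y : F y -> dot n y = 0.
  move=> Fy; apply/eqP; rewrite eq_le (not_meets_pos h1) //=.
  by have := not_meets_pos h2 Fy; rewrite dotNl oppr_le0.
have uF y : F y -> dot u y = 0 by rewrite FE => -[].
have [e1 [e2 [F1 F2 c0]]] := (affdim2P pF.2).1 d2.
have [k uE] := parallel_normals c0 (strict_n0 pos) (nF _ F1) (nF _ F2) (uF _ F1) (uF _ F2).
exact: nonpos_not_multiple pos neg _ _ u0 np uE.
Qed.

Lemma edge_slice0 E : edges_o P E -> ~ E `<=` [set y | dot n y = 0] -> supp (slice E n) x = 0.
Proof.
move=> hE h; have pE := edge_polytope hP hE.
move/(edges_oP _ hP): hE => [u [u0 np EE d1]]; apply: supp0set => y; split; last first.
  by move=> ->; split; rewrite //= ?dot0r //; exact: pE.2.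
move=> [Ey ny]; have [f [Ef f0 line]] := edge_line pE.2 d1; have [t yE] := line _ Ey.
have [t0|t0] := eqVneq t 0; first by rewrite yE t0 scale0r.
exfalso; apply: h => z Ez; have [s zE] := line _ Ez.
move: ny; rewrite /= yE zE !dotZr => /eqP; rewrite mulf_eq0 (negbTE t0) /= => /eqP ->.
by rewrite mulr0.
Qed.

Lemma edge_not_slice E : E `<=` [set y | dot n y = 0] \/ (meets_pos E n \/ meets_pos E (- n)).
Proof.
have [?|h1] := pselect (meets_pos E n); first by right; left.
have [?|h2] := pselect (meets_pos E (- n)); first by right; right.
left=> y Ey; apply/eqP; rewrite eq_le (not_meets_pos h1) //=.
by have := not_meets_pos h2 Ey; rewrite dotNl oppr_le0.
Qed.

Let Flat : set (set (vec R)) := [set E | E `<=` [set y | dot n y = 0]].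

(** An edge in the cutting plane meets neither open side. Any other edge meets the plane only at the
    origin, so the overlap of its halves contributes 0. *)
Lemma phi_edge E : edges_o P E -> phi E = if E \in ~` Flat then supp E x else 0.
Proof.
move=> hE; have pE := edge_polytope hP hE.
have [/set_mem h|h] := boolP (E \in ~` Flat).
  have [//|s] := edge_not_slice E.
  by rewrite phi_split // edge_slice0 //; case: ifP; rewrite addr0.
have {}h : Flat E by apply: contrapT => h'; move/negP: h; apply; exact: mem_set.
rewrite /phi; case: ifP => [/set_mem [p /h /= e]|_]; first by rewrite e ltxx.
case: ifP => [/set_mem [p /h /= e]|_]; last by rewrite addr0.
by rewrite dotNl e oppr0 ltxx.
Qed.

(** A functional that is nonpositive on [P] and vanishes at an inner point of a segment vanishes at
    its ends; so the plane of a facet that contains the slice of [G] contains [G]. *)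
Lemma split_facet_inj F F' : facets_o P F -> facets_o P F' ->
  (Pos `&` Neg) F -> (Pos `&` Neg) F' -> slice F n = slice F' n -> F = F'.
Proof.
have W G G' : facets_o P G -> facets_o P G' -> (Pos `&` Neg) G -> slice G n = slice G' n -> G `<=` G'.
  move=> hG hG' [[p Gp np_] [q Gq]]; rewrite dotNl oppr_gt0 => nq e.
  have pG := facet_polytope hP hG; have cG := polytope_convex pG.
  move/(facets_oP _ hP): hG => [u [u0 np GE d2]].
  move/(facets_oP _ hP): hG' => [u' [u0' np' GE' _]].
  have GP y : G y -> P y by rewrite GE => -[].
  have key a : G a -> dot n a != 0 -> dot u' a = 0.
    move=> Ga na0.
    have [b [Gb ab]] : exists b, G b /\ dot n a * dot n b < 0.
      have [na|na|na] := ltgtP (dot n a) 0; last by rewrite na eqxx in na0.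
        by exists p; rewrite nmulr_rlt0.
      by exists q; rewrite pmulr_rlt0.
    have crP : exists c c', [/\ 0 < c, 0 < c' & slice G n (c *: a + c' *: b)].
      have [na|na|na] := ltgtP (dot n a) 0; last by rewrite na eqxx in na0.
        have nb : 0 < dot n b by move: ab; rewrite nmulr_rlt0.
        have d0 : 0 < (dot n b - dot n a)^-1 by rewrite invr_gt0; lra.
        exists ((dot n b - dot n a)^-1 * dot n b), ((dot n b - dot n a)^-1 * - dot n a); split.
        - by rewrite mulr_gt0.
        - by rewrite mulr_gt0 // oppr_gt0.
        - rewrite (_ : _ + _ = crossing n b a); last by rewrite /crossing; apply: vec_eq; rewrite !mxE; ring.
          by split; [apply: crossing_conv => //; exact: ltW|exact: dot_crossing].
      have nb : dot n b < 0 by move: ab; rewrite pmulr_rlt0.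
      have d0 : 0 < (dot n a - dot n b)^-1 by rewrite invr_gt0; lra.
      exists ((dot n a - dot n b)^-1 * - dot n b), ((dot n a - dot n b)^-1 * dot n a); split.
      - by rewrite mulr_gt0 // oppr_gt0.
      - by rewrite mulr_gt0.
      - rewrite (_ : _ + _ = crossing n a b); last by rewrite /crossing; apply: vec_eq; rewrite !mxE; ring.
        by split; [apply: crossing_conv => //; exact: ltW|exact: dot_crossing].
    have [c [c' [c0 c0' sl]]] := crP; move: sl; rewrite e => -[+ _]; rewrite GE' => -[_ /=].
    rewrite dotDr !dotZr => s0.
    have ha : c * dot u' a <= 0 by rewrite pmulr_rle0 //; apply: np'; apply: GP.
    have hb : c' * dot u' b <= 0 by rewrite pmulr_rle0 //; apply: np'; apply: GP.
    have : c * dot u' a = 0 by lra.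
    by move=> /eqP; rewrite mulf_eq0 (gt_eqF c0) => /eqP.
  move=> y Gy; rewrite GE'; split; first exact: GP.
  have [ny|ny] := eqVneq (dot n y) 0; last exact: key.
  by have : slice G n y by []; rewrite e => -[+ _]; rewrite GE' => -[].
by move=> hF hF' s s' e; apply/seteqP; split; apply: W.
Qed.

Lemma sum_phi (Fs : set (set (vec R))) : finite_set Fs -> \sum_(F \in Fs) phi F =
  (\sum_(F \in Fs) if F \in Pos then supp (half F n) x else 0) +
  (\sum_(F \in Fs) if F \in Neg then supp (half F (- n)) x else 0).
Proof. by move=> fin; rewrite -fsbig_split. Qed.

Lemma sum_edges_phi : \sum_(E \in edges_o P) phi E =
  \sum_(E \in edges_o P) supp E x - \sum_(E \in edges_o P `&` Flat) supp E x.
Proof.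
rewrite (eq_fsbigr (fun E => if E \in ~` Flat then supp E x else 0)); last first.
  by move=> E /set_mem; exact: phi_edge.
have e1 : \sum_(E \in edges_o P `&` ~` Flat) supp E x =
    \sum_(E \in edges_o P) if E \in ~` Flat then supp E x else 0 := fsbig_mkcondr _ _ _ _.
have e2 : \sum_(E \in edges_o P) supp E x = \sum_(E \in edges_o P `&` Flat) supp E x +
    \sum_(E \in edges_o P `&` ~` Flat) supp E x := fsbigID Flat _ _ (edges_finite hP).
by rewrite -e1 e2 addrC addKr.
Qed.

Let posN : meets_pos P (- - n). Proof. by rewrite opprK. Qed.

Lemma facet_sum_half k : meets_pos P k -> meets_pos P (- k) -> affdim_ge P 3 ->
  \sum_(F \in facets_o (half P k)) supp F x = supp (slice P k) x +
  \sum_(F \in facets_o P) if F \in [set F | meets_pos F k] then supp (half F k) x else 0.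
Proof.
move=> pk nk d3; have fin := facets_finite hP.
have -> : facets_o (half P k) = [set slice P k] `|`
    [set G | exists2 F, facets_o P F /\ meets_pos F k & G = half F k].
  by apply/seteqP; split=> G /(facets_half hP pk nk _ d3).
rewrite fsbigU0.
- rewrite fsbig_set1 sum_half_image // => F F' hF hF'; exact: facet_half_inj.
- exact: finite_set1.
- apply: (@sub_finite_set _ _ ((fun F => half F k) @` facets_o P)); last exact: finite_image.
  by move=> G [F [hF _] ->]; exists F.
- move=> G [-> [F [_ /meets_pos_half + e]]]; rewrite -e => -[p [_ /= ep]].
  by rewrite ep ltxx.
Qed.

Lemma edge_sum_half3 k : meets_pos P k -> meets_pos P (- k) -> affdim_ge P 3 ->
  \sum_(F \in edges_o (half P k)) supp F x = \sum_(F \in edges_o (slice P k)) supp F x +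
  \sum_(F \in edges_o P) if F \in [set F | meets_pos F k] then supp (half F k) x else 0.
Proof.
move=> pk nk d3; have fin := edges_finite hP.
have -> : edges_o (half P k) = edges_o (slice P k) `|`
    [set G | exists2 F, edges_o P F /\ meets_pos F k & G = half F k].
  by apply/seteqP; split=> G /(edges_half3 hP pk nk _ d3).
have hS := slice_polytope k hP.
rewrite fsbigU0.
- rewrite sum_half_image // => F F' hF hF'; exact: edge_half_inj.
- exact: edges_finite.
- apply: (@sub_finite_set _ _ ((fun F => half F k) @` edges_o P)); last exact: finite_image.
  by move=> G [F [hF _] ->]; exists F.
- move=> G [/(edges_oP _ hS) [u [_ _ GE _]] [F [_ /meets_pos_half [p + kp]] GE']].
  by rewrite -GE' GE => -[[_ /= e] _]; rewrite e ltxx in kp.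
Qed.

Lemma edge_sum_half2 k m : meets_pos P k -> meets_pos P (- k) -> m != 0 ->
  (forall y, P y -> dot m y = 0) -> affdim_ge P 2 ->
  \sum_(F \in edges_o (half P k)) supp F x = supp (slice P k) x +
  \sum_(F \in edges_o P) if F \in [set F | meets_pos F k] then supp (half F k) x else 0.
Proof.
move=> pk nk m0 mP d2; have fin := edges_finite hP.
have -> : edges_o (half P k) = [set slice P k] `|`
    [set G | exists2 F, edges_o P F /\ meets_pos F k & G = half F k].
  by apply/seteqP; split=> G /(edges_half2 hP pk nk _ m0 mP d2).
rewrite fsbigU0.
- rewrite fsbig_set1 sum_half_image // => F F' hF hF'; exact: edge_half_inj.
- exact: finite_set1.
- apply: (@sub_finite_set _ _ ((fun F => half F k) @` edges_o P)); last exact: finite_image.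
  by move=> G [F [hF _] ->]; exists F.
- move=> G [-> [F [_ /meets_pos_half + e]]]; rewrite -e => -[p [_ /= ep]].
  by rewrite ep ltxx.
Qed.

Lemma edge_sum_slice : affdim_ge P 3 -> \sum_(E \in edges_o (slice P n)) supp E x =
  \sum_(E \in edges_o P `&` Flat) supp E x +
  \sum_(F \in facets_o P) if F \in Pos `&` Neg then supp (slice F n) x else 0.
Proof.
move=> d3; have fin := facets_finite hP.
have -> : edges_o (slice P n) = (edges_o P `&` Flat) `|` ((fun F => slice F n) @` (facets_o P `&` (Pos `&` Neg))).
  apply/seteqP; split=> G.
    move=> /(edges_slice hP pos neg _ d3) [[? ?]|[F [? ? ?] ->]]; first by left.
    by right; exists F.
  move=> h; apply/(edges_slice hP pos neg _ d3); case: h => [[? ?]|[F [? [? ?]] <-]]; first by left.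
  by right; exists F.
rewrite fsbigU0.
- rewrite fsbig_image ?fsbig_mkcondr // => F F' /set_mem [? ?] /set_mem [? ?].
  exact: split_facet_inj.
- by apply: sub_finite_set (edges_finite hP); exact: subIsetl.
- by apply: finite_image; apply: sub_finite_set fin; exact: subIsetl.
- move=> G [[hG GF] [F [hF [[p Fp pp] [q Fq qq]]] FG]]; rewrite dotNl oppr_gt0 in qq.
  move/(edges_oP _ hP): hG => [u [u0 np GE _]].
  have pF := facet_polytope hP hF.
  move/(facets_oP _ hP): hF => [u' [_ _ FE _]].
  have FP y : F y -> P y by rewrite FE => -[].
  have cr : G (crossing n p q).
    rewrite -FG; split; last exact: dot_crossing.
    by apply: crossing_conv => //; [exact: polytope_convex|exact: ltW].
  move: cr; rewrite GE => -[_ /=]; rewrite /crossing dotZr dotBr !dotZr => /eqP.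
  rewrite mulf_eq0 invr_eq0 (_ : (_ - _ == 0) = false) ?orFb; last by rewrite gt_eqF //; lra.
  move=> /eqP e.
  have hp := np _ (FP _ Fp); have hq := np _ (FP _ Fq).
  have up : dot u p = 0.
    have h1 : dot n p * dot u q <= 0 by rewrite mulr_ge0_le0 // ltW.
    have h2 : dot n q * dot u p = 0.
      apply/eqP; rewrite eq_le; apply/andP; split; first by rewrite -subr_ge0 -e; lra.
      by rewrite mulr_le0 // ltW.
    by move/eqP: h2; rewrite mulf_eq0 (lt_eqF qq) => /eqP.
  have : G p by rewrite GE; split => //; exact: FP.
  by move=> /GF /= e'; rewrite e' ltxx in pp.
Qed.

(** In dimension 3 the slice is a facet of both halves, which matches its weight 2 in [gsum]. The
    edges of the slice are subtracted twice on the right and once on the left; the surplus from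
    split facets and from edges in the cutting plane is exactly the missing sum over them. *)
Lemma gsum_cut_strict : gsum P x + gsum (slice P n) x = gsum (half P n) x + gsum (half P (- n)) x.
Proof.
have cP := polytope_convex hP; have P0 := hP.2.
have [d3|d3] := pselect (affdim_ge P 3).
  have h3 k : meets_pos P k -> affdim_ge (half P k) 3 by move=> mk; exact: half_dim3.
  have s2 := slice_dim2 hP pos neg d3.
  have s3 : ~ affdim_ge (slice P n) 3.
    move=> s3; have n0 : n = 0 by apply: (full_dot0 (slice_polytope n hP).2 s3) => y [].
    by have := strict_n0 pos; rewrite n0 eqxx.
  rewrite /gsum (asboolT d3) (asboolF s3) (asboolT s2) (asboolT (h3 _ pos)) (asboolT (h3 _ neg)).
  rewrite (facet_sum_half pos neg d3) (facet_sum_half neg posN d3).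
  rewrite (edge_sum_half3 pos neg d3) (edge_sum_half3 neg posN d3) !sliceN.
  have e1 := sum_phi (facets_finite hP); have e2 := sum_phi (edges_finite hP).
  rewrite sum_edges_phi in e2.
  have e3 : \sum_(F \in facets_o P) phi F = \sum_(F \in facets_o P) supp F x +
      \sum_(F \in facets_o P) if F \in Pos `&` Neg then supp (slice F n) x else 0.
    rewrite -fsbig_split; last exact: facets_finite.
    apply: eq_fsbigr => F /set_mem hF; apply: phi_split; last exact: facet_strict.
    exact: facet_polytope hF.
  have e4 := edge_sum_slice d3.
  rewrite e3 in e1; move: e1 e2 e4; rewrite /Pos /Neg /=; lra.
have nh3 k : ~ affdim_ge (half P k) 3 by move=> h; apply: d3; exact: affdim_sub (@half_sub _ P k) h.
have ns3 : ~ affdim_ge (slice P n) 3 by move=> h; apply: d3; exact: affdim_sub (@slice_sub _ P n) h.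
have [d2|d2] := pselect (affdim_ge P 2); last first.
  have nh2 k : ~ affdim_ge (half P k) 2 by move=> h; apply: d2; exact: affdim_sub (@half_sub _ P k) h.
  have ns2 : ~ affdim_ge (slice P n) 2 by move=> h; apply: d2; exact: affdim_sub (@slice_sub _ P n) h.
  by rewrite /gsum !asboolF.
have [m m0 mP] := not_affdim3 P0 d3.
have [_ s2] := slice_dim1 hP pos neg m0 mP d2.
have h2 k : meets_pos P k -> affdim_ge (half P k) 2 by move=> mk; exact: half_dim2.
rewrite /gsum !(asboolF (nh3 _)) (asboolF d3) (asboolF ns3) (asboolF s2) (asboolT d2).
rewrite (asboolT (h2 _ pos)) (asboolT (h2 _ neg)).
rewrite (edge_sum_half2 pos neg m0 mP d2) (edge_sum_half2 neg posN m0 mP d2) !sliceN.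
have e2 := sum_phi (edges_finite hP).
(* No edge of a planar [P] lies in the cutting line: its supporting functional would be a multiple
   of [n] on [P], which has points on both sides, hence zero on [P]. *)
have e3 : \sum_(E \in edges_o P) phi E = \sum_(E \in edges_o P) supp E x.
  apply: eq_fsbigr => E /set_mem hE; rewrite phi_edge //; case: ifP => // /negP h; exfalso.
  have {}h : E `<=` [set y | dot n y = 0] by apply: contrapT => h'; apply: h; exact: mem_set.
  have pE := edge_polytope hP hE; move/(edges_oP _ hP): hE => [u [u0 np EE d1]].
  have [f [Ef f0 _]] := edge_line pE.2 d1.
  have hS := slice_polytope n hP.
  have [f' [Sf' f0' line]] := edge_line hS.2 (slice_dim1 hP pos neg m0 mP d2).
  have Sf : slice P n f by split; [move: Ef; rewrite EE => -[]|exact: h].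
  have [tf fE] := line _ Sf.
  have t0 : tf != 0 by apply/eqP => t0; rewrite fE t0 scale0r eqxx in f0.
  have uf' : dot u f' = 0.
    have : dot u f = 0 by move: Ef; rewrite EE => -[].
    by rewrite fE dotZr => /eqP; rewrite mulf_eq0 (negbTE t0) => /eqP.
  have us y : slice P n y -> dot u y = 0 by move=> /line [s ->]; rewrite dotZr uf' mulr0.
  have [k hk] := slice_vanish cP pos neg us.
  have [p Pp pp] := pos; have [q Pq qq] := neg; rewrite dotNl oppr_gt0 in qq.
  have h1 := np _ Pp; have h2' := np _ Pq; rewrite hk // in h1; rewrite hk // in h2'.
  rewrite pmulr_lle0 // in h1; rewrite nmulr_lle0 // in h2'.
  have k0 : k = 0 by apply/eqP; rewrite eq_le h1 h2'.
  have : E p by rewrite EE; split => //=; rewrite hk // k0 mul0r.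
  by move=> /h /= e; rewrite e ltxx in pp.
rewrite e3 in e2; have := supp_cut n x hP; move: e2; rewrite /Pos /Neg /=; lra.
Qed.

End GsumCut.

Lemma slice_nonneg P n : ~ meets_pos P n -> half P n = slice P n.
Proof.
move=> h; apply/seteqP; split=> y; last exact: slice_half.
by move=> [Py ny]; split => //; apply/eqP; rewrite eq_le (not_meets_pos h Py).
Qed.

Lemma gsum_cut x : cut_additive (fun P => gsum P x).
Proof.
move=> P n hP /=; rewrite -/(slice P n) -/(half P n) -halfN.
have [pos|h] := pselect (meets_pos P n); last first.
  rewrite (slice_nonneg h) addrC [in RHS](@half_nonneg _ (- n)) // opprK; exact: h.
have [neg|h] := pselect (meets_pos P (- n)); first exact: gsum_cut_strict.
by rewrite half_nonneg // (slice_nonneg h) sliceN.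
Qed.

Lemma supp_cut_additive x : cut_additive (fun P => supp P x).
Proof. by move=> P n hP /=; have := supp_cut n x hP; rewrite halfN. Qed.

Lemma hD_cut a1 a2 b1 b2 x : cut_additive (fun P => hD a1 a2 b1 b2 P x).
Proof.
rewrite (_ : (fun P => hD a1 a2 b1 b2 P x) = fun P => a1 * supp P x + (a2 - a1) * gsum P x +
    b1 * supp P (- x) + (b2 - b1) * gsum P (- x)); last by apply/funext => P; rewrite hD_gsum.
apply: cut_additiveD; last by apply: cut_additiveZ; exact: gsum_cut.
apply: cut_additiveD; last by apply: cut_additiveZ; exact: supp_cut_additive.
apply: cut_additiveD; last by apply: cut_additiveZ; exact: gsum_cut.
by apply: cut_additiveZ; exact: supp_cut_additive.
Qed.

End FaceSums.

(** * Sublinearity of the support function of D *)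
Section LocalFormula.
Variable R : realType.
Implicit Types (x y u v w n m e p q d : vec R) (c t : R) (A E F K P : set (vec R)) (s : seq (vec R)).

Definition top K x := K `&` [set y | dot x y = supp K x].
Definition width K d := supp K d + supp K (- d).

Lemma width_ge0 K d : K !=set0 -> bdd K -> 0 <= width K d.
Proof. by move=> K0 bK; apply: sublinN; exact: supp_sublin. Qed.

Lemma supp_mono A K x : A !=set0 -> A `<=` K -> bdd K -> supp A x <= supp K x.
Proof. by move=> A0 AK bK; apply: supp_le => // y /AK; exact: supp_ge. Qed.

Lemma width_mono A K d : A !=set0 -> A `<=` K -> bdd K -> width A d <= width K d.
Proof. by move=> A0 AK bK; apply: lerD; exact: supp_mono. Qed.

Lemma width_set1 A y d : A y -> (forall z, A z -> z = y) -> width A d = 0.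
Proof.
move=> Ay h; rewrite /width (@supp_eq _ A d y Ay); last by move=> z /h ->.
rewrite (@supp_eq _ A (- d) y Ay); last by move=> z /h ->.
by rewrite dotNl subrr.
Qed.

(** [S] dominates all quotients of slope differences by value differences, so for [t <= 1 / (1 + S)]
    no generator that is smaller at [x] overtakes a larger one. The radius depends on [s] alone and
    serves all faces at once. *)
Lemma local_supp s x d : exists2 eps : R, 0 < eps & forall s', s' != [::] ->
  (forall v, v \in s' -> v \in s) -> forall t, 0 <= t <= eps ->
  supp (conv s') (x + t *: d) = supp (conv s') x + t * supp (top (conv s') x) d.
Proof.
pose S := \sum_(v <- s) \sum_(v' <- s | dot x v < dot x v') `|dot d v - dot d v'| / (dot x v' - dot x v).
have T0 v v' : dot x v < dot x v' -> 0 <= `|dot d v - dot d v'| / (dot x v' - dot x v).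
  by move=> h; rewrite divr_ge0 // subr_ge0 ltW.
have S0 : 0 <= S by apply: sumr_ge0 => v _; apply: sumr_ge0 => v' h; exact: T0.
have eps0 : 0 < (1 + S)^-1 by rewrite invr_gt0 ltr_pwDl.
exists (1 + S)^-1 => // s' s0 ss.
have ineq v v' t : v \in s -> v' \in s -> dot x v < dot x v' -> 0 <= t <= (1 + S)^-1 ->
    dot x v + t * dot d v <= dot x v' + t * dot d v'.
  move=> vs vs' lt /andP[t0 t1].
  have le : `|dot d v - dot d v'| / (dot x v' - dot x v) <= S.
    rewrite /S (big_rem v) //= (big_rem v') //= lt -addrA lerDl addr_ge0 //.
      by apply: sumr_ge0 => *; exact: T0.
    by apply: sumr_ge0 => *; apply: sumr_ge0 => *; exact: T0.
  have px : 0 < dot x v' - dot x v by rewrite subr_gt0.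
  rewrite ler_pdivrMr // in le.
  have : t * `|dot d v - dot d v'| <= dot x v' - dot x v.
    apply: le_trans (ler_wpM2l t0 le) _.
    rewrite mulrA ger_pMl //; apply: le_trans (ler_wpM2r S0 t1) _.
    by rewrite mulrC ler_pdivrMr ?mul1r ?lerDr ?ltr_pwDl.
  have : t * (dot d v - dot d v') <= t * `|dot d v - dot d v'| by rewrite ler_wpM2l // ler_norm.
  by rewrite mulrBr; lra.
have [v1 [v1s _ h1]] := conv_max x s0.
have h1' v : v \in s' -> dot x v <= dot x v1 by move=> vs; apply: h1; exact: conv_mem.
pose s2 := [seq v <- s' | dot x v == dot x v1].
have s20 : s2 != [::].
  have : v1 \in s2 by rewrite mem_filter eqxx.
  by case: s2.
have [v2 [v2s _ h2]] := conv_max d s20.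
move: (v2s); rewrite mem_filter => /andP[/eqP x2 v2s'].
have h2' v : v \in s2 -> dot d v <= dot d v2 by move=> vs; apply: h2; exact: conv_mem.
have max t v : 0 <= t <= (1 + S)^-1 -> v \in s' -> dot (x + t *: d) v <= dot (x + t *: d) v2.
  move=> t01 vs; rewrite !dotDl !dotZl x2.
  have [e|ne] := eqVneq (dot x v) (dot x v1).
    rewrite e lerD2l ler_wpM2l ?h2' //; first by case/andP: t01.
    by rewrite mem_filter e eqxx.
  rewrite -x2; apply: ineq => //; [exact: ss|exact: ss|].
  by rewrite x2 lt_neqAle ne h1'.
have c2 := conv_mem v2s'.
have sx : supp (conv s') x = dot x v2.
  by apply: supp_eq => // z; apply: conv_le => v /h1'; rewrite x2.
have st t : 0 <= t <= (1 + S)^-1 -> supp (conv s') (x + t *: d) = dot x v2 + t * dot d v2.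
  move=> t01; rewrite -dotZl -dotDl; apply: supp_eq => // z; apply: conv_le => v.
  exact: max.
have sd : supp (top (conv s') x) d = dot d v2.
  apply: supp_eq; first by split; rewrite //= sx.
  move=> y [cy /=]; rewrite sx => xy.
  have e01 : 0 <= (1 + S)^-1 <= (1 + S)^-1 by rewrite lexx ltW.
  have := supp_ge (x + (1 + S)^-1 *: d) (@conv_bdd _ s') cy.
  by rewrite st // dotDl dotZl xy lerD2l ler_pM2l.
by move=> t t01; rewrite st // sx sd.
Qed.

Lemma top_polytope0 F x : polytope_o F -> nonpos F x -> top F x = slice F x.
Proof.
move=> pF np; have s0 : supp F x = 0 by rewrite (supp_eq pF.2) ?dot0r.
by rewrite /top s0.
Qed.

Lemma top_neq0 K x : polytope_o K -> top K x !=set0.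
Proof.
move=> [[s ->] s0]; have [v cv e] := supp_conv x s0.
by exists v; split.
Qed.

Lemma top_bdd K x : bdd K -> bdd (top K x).
Proof. by apply: bdd_sub => y []. Qed.

Lemma width_top_ge0 K x d : polytope_o K -> 0 <= width (top K x) d.
Proof. by move=> hK; apply: width_ge0; [exact: top_neq0|apply: top_bdd; exact: polytope_bdd]. Qed.

Lemma width_top_flat F x d : polytope_o F -> (forall y, F y -> dot x y = 0) -> top F x = F.
Proof.
move=> pF h; rewrite top_polytope0 //; last by move=> y /h ->.
by apply/seteqP; split=> y; [case|move=> Fy; split => //; exact: h].
Qed.

(** [x] is not constant on such a segment, so its maximum there is attained at a single point. *)
Lemma width_top_edge P E x d : polytope_o P -> edges_o P E ->
  ~ (E `<=` [set y | dot x y = 0]) -> width (top E x) d = 0.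
Proof.
move=> hP hE h; have pE := edge_polytope hP hE.
move/(edges_oP _ hP): hE => [u [_ _ _ d1]].
have [e [Ee e0 line]] := edge_line pE.2 d1.
have [y ty] := top_neq0 x pE; apply: (width_set1 _ ty) => z [Ez xz].
have [Ey xy] := ty; have [a yE] := line _ Ey; have [b zE] := line _ Ez.
have xe : dot x e != 0.
  apply/eqP => xe; apply: h => w Ew; have [c ->] := line _ Ew.
  by rewrite /= dotZr xe mulr0.
have : a * dot x e = b * dot x e by rewrite -!dotZr -yE -zE xy xz.
by move=> /(mulIf xe) ab; rewrite yE zE ab.
Qed.

End LocalFormula.

(** * Estimates for finite sums *)

Section Sums.
Variable R : realType.
Variable I : choiceType.
Implicit Types (A B : set I) (g : I -> R).

Lemma fsum_subset A B g : A `<=` B -> finite_set B -> (forall i, B i -> 0 <= g i) ->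
  \sum_(i \in A) g i <= \sum_(i \in B) g i.
Proof.
move=> AB fin g0; rewrite (fsbigID A B) //= (_ : B `&` A = A) ?lerDl; last exact/setIidPr.
by apply: fsumr_ge0 => i [/g0].
Qed.

Lemma fsumZ A c g : finite_set A -> \sum_(i \in A) c * g i = c * \sum_(i \in A) g i.
Proof. by move=> fin; rewrite !fsbig_finite //= mulr_sumr. Qed.

Lemma fsumD A g g' : finite_set A ->
  \sum_(i \in A) (g i + g' i) = \sum_(i \in A) g i + \sum_(i \in A) g' i.
Proof. by move=> fin; rewrite !fsbig_finite //= big_split. Qed.

Lemma fsum_le_image A B (h : I -> I) g : finite_set B -> (forall i, B i -> 0 <= g (h i)) ->
  A `<=` h @` B -> \sum_(i \in A) g i <= \sum_(j \in B) g (h j).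
Proof.
move=> fin g0 AhB.
have [f fP] : exists f : I -> I, forall i, A i -> B (f i) /\ h (f i) = i.
  have : forall i, exists j, A i -> B j /\ h j = i.
    move=> i; have [Ai|nA] := pselect (A i); last by exists i.
    by have [j Bj hj] := AhB i Ai; exists j.
  by move=> /choice [f fP]; exists f.
have e : \sum_(i \in A) g i = \sum_(j \in f @` A) g (h j).
  rewrite fsbig_image; last first.
    by move=> i j /set_mem Ai /set_mem Aj e; rewrite -(fP _ Ai).2 e (fP _ Aj).2.
  by apply: eq_fsbigr => i /set_mem Ai; rewrite (fP _ Ai).2.
rewrite e; apply: fsum_subset => // _ [i Ai <-]; exact: (fP _ Ai).1.
Qed.

(** The last hypothesis says that [A] has at most two elements. *)
Lemma fsum_le2 A (w : R) g : finite_set A -> 0 <= w -> (forall i, A i -> g i <= w) ->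
  (forall i j k, A i -> A j -> A k -> [\/ i = j, i = k | j = k]) ->
  \sum_(i \in A) g i <= 2 * w.
Proof.
move=> fin w0 gw A2.
have [->|/set0P [i Ai]] := eqVneq A set0; first by rewrite fsbig_set0 mulr_ge0.
rewrite (fsbigID [set i] A) //= (_ : A `&` [set i] = [set i]); last by apply/setIidPr => _ ->.
rewrite fsbig_set1.
have [->|/set0P [j [Aj ji]]] := eqVneq (A `&` ~` [set i]) set0.
  by rewrite fsbig_set0 addr0; have := gw _ Ai; lra.
rewrite (_ : A `&` ~` [set i] = [set j]) ?fsbig_set1; last first.
  apply/seteqP; split=> [k [Ak ki]|_ -> //].
  by case: (A2 i j k Ai Aj Ak) => // e; [case: ji|case: ki].
by have := gw _ Ai; have := gw _ Aj; lra.
Qed.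

End Sums.

(** * Kinks of the face sums of solid polytopes *)

Section Kinks.
Variable R : realType.
Implicit Types (x y u v w n m e p q d : vec R) (c t : R) (A E F K P : set (vec R)) (s : seq (vec R)).

Definition flat_edges P x := edges_o P `&` [set E | E `<=` [set y | dot x y = 0]].

Lemma sum_edges_top P x d : polytope_o P ->
  \sum_(E \in edges_o P) width (top E x) d = \sum_(E \in flat_edges P x) width E d.
Proof.
move=> hP; have fin := edges_finite hP.
rewrite (fsbigID [set E | E `<=` [set y | dot x y = 0]] (edges_o P)) //=.
rewrite [X in _ + X]fsbig1; last by move=> E [hE h]; exact: width_top_edge hE h.
rewrite addr0; apply: eq_fsbigr => E /set_mem [hE h].
by rewrite width_top_flat //; exact: edge_polytope hE.
Qed.

Lemma flat_edges_finite P x : polytope_o P -> finite_set (flat_edges P x).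
Proof. by move=> hP; apply: sub_finite_set (edges_finite hP); exact: subIsetl. Qed.

(** Distinct edges would each be exposed by a functional that is negative on the other two, which
    three rays in one plane do not allow. *)
Lemma flat_edges_card P x : polytope_o P -> x != 0 -> forall E1 E2 E3,
  flat_edges P x E1 -> flat_edges P x E2 -> flat_edges P x E3 -> [\/ E1 = E2, E1 = E3 | E2 = E3].
Proof.
move=> hP x0 E1 E2 E3 [h1 f1] [h2 f2] [h3 f3].
have H E : edges_o P E -> E `<=` [set y | dot x y = 0] -> exists e u,
    [/\ e != 0, dot x e = 0, P e & nonpos P u] /\
      [/\ E = slice P u, dot u e = 0 & forall y, E y -> exists t, y = t *: e].
  move=> hE fE; have pE := edge_polytope hP hE.
  move/(edges_oP _ hP): hE => [u [u0 np EE d1]].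
  have [e [Ee e0 line]] := edge_line pE.2 d1; exists e, u.
  by have := Ee; rewrite {1}EE => -[Pe ue]; split; split => //; exact: fE.
have [e1 [u1 [[e10 xe1 Pe1 np1] [E1E ue1 l1]]]] := H _ h1 f1.
have [e2 [u2 [[e20 xe2 Pe2 np2] [E2E ue2 l2]]]] := H _ h2 f2.
have [e3 [u3 [[e30 xe3 Pe3 np3] [E3E ue3 l3]]]] := H _ h3 f3.
have eqE E E' e e' u u' : E = slice P u -> E' = slice P u' -> e != 0 -> e' != 0 -> P e' ->
    dot u e = 0 -> dot u' e' = 0 ->
    (forall y, E y -> exists t, y = t *: e) -> (forall y, E' y -> exists t, y = t *: e') ->
    dot u e' = 0 -> E = E'.
  move=> EE EE' en0 en0' Pe' ue ue' ln ln' uz.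
  have [t e'E] : exists t, e' = t *: e by apply: ln; rewrite EE.
  have t0 : t != 0 by apply/eqP => t0; rewrite e'E t0 scale0r eqxx in en0'.
  apply/seteqP; split=> y Ey.
    have [k yE] := ln _ Ey; rewrite EE'; split; first by move: Ey; rewrite EE => -[].
    move: ue'; rewrite e'E dotZr => /eqP; rewrite mulf_eq0 (negbTE t0) /= => /eqP h.
    by rewrite yE dotZr h mulr0.
  have [k yE] := ln' _ Ey; rewrite EE; split; first by move: Ey; rewrite EE' => -[].
  by rewrite /= yE e'E !dotZr ue !mulr0.
have [z12|n12] := eqVneq (dot u1 e2) 0; first by constructor 1; exact: (eqE _ _ e1 e2 u1 u2).
have [z13|n13] := eqVneq (dot u1 e3) 0; first by constructor 2; exact: (eqE _ _ e1 e3 u1 u3).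
have [z23|n23] := eqVneq (dot u2 e3) 0; first by constructor 3; exact: (eqE _ _ e2 e3 u2 u3).
have [z21|n21] := eqVneq (dot u2 e1) 0; first by constructor 1; symmetry; exact: (eqE _ _ e2 e1 u2 u1).
have [z31|n31] := eqVneq (dot u3 e1) 0; first by constructor 2; symmetry; exact: (eqE _ _ e3 e1 u3 u1).
have [z32|n32] := eqVneq (dot u3 e2) 0; first by constructor 3; symmetry; exact: (eqE _ _ e3 e2 u3 u2).
exfalso.
have lt12 : dot u1 e2 < 0 by rewrite lt_neqAle n12 np1.
have lt13 : dot u1 e3 < 0 by rewrite lt_neqAle n13 np1.
have lt23 : dot u2 e3 < 0 by rewrite lt_neqAle n23 np2.
have lt21 : dot u2 e1 < 0 by rewrite lt_neqAle n21 np2.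
have lt31 : dot u3 e1 < 0 by rewrite lt_neqAle n31 np3.
have lt32 : dot u3 e2 < 0 by rewrite lt_neqAle n32 np3.
have d0 : det3 e1 e2 e3 = 0.
  by apply/eqP/negPn/negP => d0; move/eqP: x0; apply; exact: dot_basis_eq0 d0 _ _ _.
(* The planar relation between e1, e2, e3, whose coefficients are pairwise of opposite signs. *)
have := expand3 e1 e2 e3 x; rewrite d0 scale0r.
set a := det3 x e2 e3; set b := det3 e1 x e3; set c := det3 e1 e2 x => /esym rel.
have r1 : b * dot u1 e2 + c * dot u1 e3 = 0.
  by have := congr1 (fun z : vec R => dot u1 z) rel; rewrite !dotDr !dotZr ue1 mulr0 add0r dot0r.
have r2 : a * dot u2 e1 + c * dot u2 e3 = 0.
  by have := congr1 (fun z : vec R => dot u2 z) rel; rewrite !dotDr !dotZr ue2 mulr0 addr0 dot0r.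
have r3 : a * dot u3 e1 + b * dot u3 e2 = 0.
  by have := congr1 (fun z : vec R => dot u3 z) rel; rewrite !dotDr !dotZr ue3 mulr0 addr0 dot0r.
have c12 : cross e1 e2 != 0.
  apply/eqP => h; have := cross_eq0 e10 h => e2E.
  by move/eqP: n12; apply; rewrite e2E dotZr ue1 mulr0.
have cn0 : c != 0.
  rewrite /c /det3; have [k xk] := normals_parallel c12 xe1 xe2.
  rewrite xk dotZr; apply: mulf_neq0; last by rewrite gt_eqF ?dot_gt0.
  by apply: contra x0 => /eqP k0; rewrite xk k0 scale0r.
have [cl|cg|ce] := ltgtP c 0; last by rewrite ce eqxx in cn0.
- have : 0 < c * dot u1 e3 by rewrite nmulr_rgt0.
  have : 0 < c * dot u2 e3 by rewrite nmulr_rgt0.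
  move=> h1' h2'.
  have b0 : 0 < b by rewrite -(nmulr_llt0 _ lt12); lra.
  have a0 : 0 < a by rewrite -(nmulr_llt0 _ lt21); lra.
  have : a * dot u3 e1 < 0 by rewrite pmulr_rlt0.
  have : b * dot u3 e2 < 0 by rewrite pmulr_rlt0.
  lra.
- have : c * dot u1 e3 < 0 by rewrite pmulr_rlt0.
  have : c * dot u2 e3 < 0 by rewrite pmulr_rlt0.
  move=> h1' h2'.
  have b0 : b < 0 by rewrite -(nmulr_lgt0 _ lt12); lra.
  have a0 : a < 0 by rewrite -(nmulr_lgt0 _ lt21); lra.
  have : 0 < a * dot u3 e1 by rewrite nmulr_rgt0.
  have : 0 < b * dot u3 e2 by rewrite nmulr_rgt0.
  lra.
Qed.

Lemma flat_edges_width P x d K : polytope_o P -> x != 0 -> bdd K ->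
  (forall E, flat_edges P x E -> E `<=` K) -> K !=set0 ->
  \sum_(E \in flat_edges P x) width E d <= 2 * width K d.
Proof.
move=> hP x0 bK EK K0; apply: fsum_le2.
- exact: flat_edges_finite.
- exact: width_ge0.
- move=> E hE; apply: width_mono; [|exact: EK|exact: bK].
  exact: polytope_neq0 (edge_polytope hP hE.1).
- exact: flat_edges_card.
Qed.

Lemma flat_edges_1dim P x E : polytope_o P -> ~ affdim_ge (slice P x) 2 ->
  flat_edges P x E -> E = slice P x.
Proof.
move=> hP h [hE f]; have pE := edge_polytope hP hE.
move/(edges_oP _ hP): hE => [u [_ np EE d1]].
have [e [Ee e0 line]] := edge_line pE.2 d1.
have ES : E `<=` slice P x by move=> y Ey; split; [move: Ey; rewrite EE => -[]|exact: f].
have pS := slice_polytope x hP.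
have S1 : affdim_eq (slice P x) 1.
  by split => //; apply/(affdim1P pS.2); exists e => //; exact: ES.
have [e' [Se' e0' line']] := edge_line pS.2 S1.
have [t eE] := line' _ (ES _ Ee).
have t0 : t != 0 by apply/eqP => t0; rewrite eE t0 scale0r eqxx in e0.
have ue' : dot u e' = 0.
  have : dot u e = 0 by move: Ee; rewrite EE => -[].
  by rewrite eE dotZr => /eqP; rewrite mulf_eq0 (negbTE t0) => /eqP.
apply/seteqP; split => // y Sy; rewrite EE; split; first exact: Sy.1.
by have [k ->] := line' _ Sy; rewrite /= dotZr ue' mulr0.
Qed.

(* Rotating the supporting plane [u] of an edge about the edge, towards the side where
   [x] is negative, until it supports a facet. *)
Lemma facet_at_edge P E u x q : polytope_o P -> nonpos P u -> E = slice P u -> affdim_eq E 1 ->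
  E `<=` [set y | dot x y = 0] -> P q -> dot x q < 0 -> (forall t, 0 < t -> u != t *: x) ->
  exists F, [/\ facets_o P F, nonpos F x & slice F x = E].
Proof.
move=> hP np EE d1 fE Pq xq ut; have [[s sE] _] := hP.
have sP v : v \in s -> P v by rewrite sE; exact: conv_mem.
have pE : polytope_o E by rewrite EE; exact: slice_polytope.
have [e [Ee e0 line]] := edge_line pE.2 d1.
pose r v := dot u v / dot x v.
(* The generator that the rotating plane meets first. *)
have [v0 v0W vmin] : exists2 a, a \in [seq v <- s | dot x v < 0] &
    forall v, v \in [seq v <- s | dot x v < 0] -> r a <= r v.
  have [v vs v0] : exists2 v, v \in s & dot x v < 0.
    have Pq' := Pq; rewrite sE in Pq'; have [v [vs _ h]] := conv_max (- x) (conv_neq0 Pq').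
    exists v => //; have := h _ Pq'; rewrite !dotNl; lra.
  have: v \in [seq v <- s | dot x v < 0] by rewrite mem_filter v0.
  elim: [seq v <- s | dot x v < 0] v {vs v0} => // b U IH v _; have [->|] := eqVneq U [::].
    by exists b; rewrite ?mem_head // => w; rewrite mem_seq1 => /eqP ->.
  case: U IH => // c U IH _; have [a aU h] := IH c (mem_head _ _).
  have [l|l] := leP (r a) (r b).
    by exists a => [|w]; rewrite inE ?aU ?orbT // => /orP[/eqP ->//|/h].
  exists b => [|w]; rewrite inE ?eqxx // => /orP[/eqP ->//|/h h'].
  exact: le_trans (ltW l) h'.
move: (v0W); rewrite mem_filter => /andP[x0 v0s].
have u0 : dot u v0 < 0.
  rewrite lt_neqAle np ?andbT; last exact: sP.
  apply/eqP => uv; have : E v0 by rewrite EE; split => //; exact: sP.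
  by move=> /fE /= xv; rewrite xv ltxx in x0.
have r0 : 0 < r v0 by rewrite /r -mulrNN -invrN divr_gt0 // oppr_gt0.
have [k kE] : exists k, k = u - r v0 *: x by eexists.
have kdot v : dot k v = dot u v - r v0 * dot x v by rewrite kE dotBl dotZl.
have k0 : k != 0 by rewrite kE subr_eq0 ut.
have npk : nonpos P k.
  rewrite sE => y; apply: conv_le => v vs; rewrite kdot.
  have uv := np _ (sP _ vs).
  have [xv|xv] := ltP (dot x v) 0; last first.
    have : 0 <= r v0 * dot x v by rewrite mulr_ge0 // ltW.
    lra.
  have : r v0 <= r v by apply: vmin; rewrite mem_filter xv.
  by rewrite {2}/r ler_ndivlMr // => h; lra.
have kv0 : dot k v0 = 0 by rewrite kdot /r divfK ?subrr // lt_eqF.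
have xe := fE _ Ee; have ue : dot u e = 0 by move: Ee; rewrite EE => -[].
have Fe : slice P k e.
  by split; [move: Ee; rewrite EE => -[]|rewrite /= kdot ue xe mulr0 subr0].
have Fv : slice P k v0 by split => //; exact: sP.
have F0 : slice P k 0 by split; rewrite /= ?dot0r //; exact: hP.2.
exists (slice P k); split.
- apply/(facets_oP _ hP); exists k; split => //; apply/(affdim2P F0); exists e, v0; split => //.
  apply/eqP => c0; have := cross_eq0 e0 c0 => v0E.
  by move: x0; rewrite v0E dotZr xe mulr0 ltxx.
- rewrite sE slice_conv -?sE // => y; apply: conv_le => v; rewrite mem_filter => /andP[/eqP kv vs].
  rewrite leNgt; apply/negP => xv; have := np _ (sP _ vs).
  have : 0 < r v0 * dot x v by rewrite mulr_gt0.
  by rewrite kdot in kv; lra.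
- rewrite EE; apply/seteqP; split=> y.
    by move=> [[Py +] xy]; rewrite /= kdot xy mulr0 subr0.
  move=> Ey; have xy : dot x y = 0 by apply: fE; rewrite EE.
  by split => //; split; [exact: Ey.1|rewrite /= kdot xy (Ey.2 : dot u y = 0) mulr0 subr0].
Qed.

Definition kink3 P x d : R := \sum_(F \in facets_o P) width (top F x) d -
  \sum_(E \in edges_o P) width (top E x) d.

Section Kink3.
Variables (P : set (vec R)) (x d : vec R).
Hypotheses (hP : polytope_o P) (d3 : affdim_ge P 3) (x0 : x != 0).
Let fin := facets_finite hP.

Lemma neg_point : nonpos P x -> exists2 q, P q & dot x q < 0.
Proof.
move=> np; apply: contrapT => h; move/eqP: x0; apply; apply: (full_dot0 hP.2 d3) => y Py.
apply/eqP; rewrite eq_le np //= leNgt; apply/negP => xy; apply: h; by exists y.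
Qed.

Let wF_ge0 F y : facets_o P F -> 0 <= width (top F y) d.
Proof. by move=> hF; apply: width_top_ge0; exact: facet_polytope hF. Qed.

(** By [facet_at_edge] every edge in the plane [x = 0] is cut out by this plane from a facet on
    which [x <= 0], so the edge widths are among the facet widths. *)
Lemma kink3_mixed p q : P p -> 0 < dot x p -> P q -> dot x q < 0 -> 0 <= kink3 P x d.
Proof.
move=> Pp xp Pq xq; rewrite /kink3 sum_edges_top // subr_ge0.
have fin' : finite_set (facets_o P `&` [set F | nonpos F x]) by apply: sub_finite_set fin; exact: subIsetl.
apply: le_trans (fsum_subset (g := fun F => width (top F x) d) (@subIsetl _ _ [set F | nonpos F x]) fin _); last first.
  by move=> F hF; exact: wF_ge0.
have -> : \sum_(F \in facets_o P `&` [set F | nonpos F x]) width (top F x) d =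
    \sum_(F \in facets_o P `&` [set F | nonpos F x]) width (slice F x) d.
  apply: eq_fsbigr => F /set_mem [hF np].
  by rewrite top_polytope0 //; exact: facet_polytope hF.
apply: (@fsum_le_image _ _ _ _ (fun F => slice F x) (fun E => width E d)) => //.
  move=> F [hF np]; rewrite -top_polytope0 //; [exact: wF_ge0|exact: facet_polytope hF].
move=> E [hE f]; move/(edges_oP _ hP): hE => [u [u0 np EE d1]].
have [|F [hF npF sF]] := facet_at_edge hP np EE d1 f Pq xq.
  move=> t t0; apply/eqP => uE; have := np _ Pp; rewrite uE dotZl.
  by rewrite leNgt mulr_gt0.
by exists F.
Qed.

(** Facets have to pay for the flat edges and for one more copy of the slice. A slice of dimension 2
    is a facet itself, and its edges belong to other facets; a slice of dimension 1 is the only flat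
    edge, and two facets meet in it; a slice of dimension 0 has width 0. *)
Lemma kink3_nonpos : nonpos P x -> width (slice P x) d <= kink3 P x d.
Proof.
move=> np; have [q Pq xq] := neg_point np.
rewrite /kink3 sum_edges_top // lerBrDr.
have npF F : facets_o P F -> nonpos F x.
  by move=> /(facets_oP _ hP) [u [_ _ -> _]] y [/np].
have sumE : \sum_(F \in facets_o P) width (top F x) d = \sum_(F \in facets_o P) width (slice F x) d.
  by apply: eq_fsbigr => F /set_mem hF; rewrite top_polytope0 ?npF //; [exact: facet_polytope hF|exact: npF].
have wS F : facets_o P F -> 0 <= width (slice F x) d.
  by move=> hF; rewrite -top_polytope0 ?npF //; [exact: wF_ge0|exact: facet_polytope hF|exact: npF].
have pS := slice_polytope x hP.
rewrite sumE.
have [s2|s2] := pselect (affdim_ge (slice P x) 2).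
  have hS : facets_o P (slice P x) by apply/(facets_oP _ hP); exists x.
  rewrite (fsbigID [set slice P x] (facets_o P)) //= (_ : facets_o P `&` [set slice P x] = [set slice P x]); last first.
    by apply/setIidPr => _ ->.
  rewrite fsbig_set1 (_ : slice (slice P x) x = slice P x); last by rewrite /slice -setIA setIid.
  rewrite lerD2l; apply: (@fsum_le_image _ _ _ _ (fun F => slice F x) (fun E => width E d)).
  - by apply: sub_finite_set fin; exact: subIsetl.
  - by move=> F [/wS].
  move=> E [hE f]; move/(edges_oP _ hP): hE => [u [u0 npu EE d1]].
  have Ene : E <> slice P x by move=> e; case: d1 => _; rewrite e.
  have [|F [hF npF' sF]] := facet_at_edge hP npu EE d1 f Pq xq.
    move=> t t0; apply/eqP => uE; apply: Ene; rewrite EE uE; apply/seteqP; split=> y [Py].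
      by rewrite /= dotZl => /eqP; rewrite mulf_eq0 (gt_eqF t0) => /eqP.
    by move=> h; split => //; rewrite /= dotZl h mulr0.
  exists F => //; split => // FE; apply: Ene; rewrite -sF FE /slice -setIA setIid //.
have [s1|s1] := pselect (affdim_ge (slice P x) 1); last first.
  have z y : slice P x y -> y = 0.
    move=> sy; apply/eqP/negPn/negP => y0; apply: s1; by apply/(affdim1P pS.2); exists y.
  rewrite (width_set1 d pS.2 z) add0r (_ : flat_edges P x = set0).
    by rewrite fsbig_set0; apply: fsumr_ge0.
  apply/seteqP; split=> // E hE; have EE := flat_edges_1dim hP s2 hE.
  by case: hE => /(edges_oP _ hP) [u [_ _ _ [d1 _]]] _; apply: s1; rewrite -EE.
have hS : flat_edges P x (slice P x).
  by split; [apply/(edges_oP _ hP); exists x|move=> y []].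
have -> : flat_edges P x = [set slice P x].
  apply/seteqP; split=> [E hE|_ -> //]; exact: flat_edges_1dim hE.
rewrite fsbig_set1.
have [e [Se e0 line]] := edge_line pS.2 (conj s1 s2).
have [p1 [p2 [p3 [P1 P2 P3 dp]]]] := (affdim3P hP.2).1 d3.
pose c := p1 + p2 + p3.
have xc : dot x c != 0.
  apply/eqP; rewrite /c !dotDr => h.
  have := np _ P1; have := np _ P2; have := np _ P3 => h3 h2 h1.
  by move/eqP: x0; apply; apply: (dot_basis_eq0 dp); lra.
(* Orthogonal to the edge and with sum 0 on [p1], [p2], [p3], the functional [y] takes both signs on
   [P]. Rotating towards either sign gives the two facets. *)
have [y yE] : exists y, y = cross e c by eexists.
have ye : dot y e = 0 by rewrite yE dot_crossl.
have yc : dot y p1 + dot y p2 + dot y p3 = 0 by rewrite -!dotDr yE dot_crossr.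
have y0 : y != 0.
  apply/eqP => y0; have cE := cross_eq0 e0 (etrans (esym yE) y0).
  by move/eqP: xc; apply; rewrite cE dotZr (Se.2 : dot x e = 0) mulr0.
have ny : ~ [/\ dot y p1 = 0, dot y p2 = 0 & dot y p3 = 0].
  by move=> [z1 z2 z3]; move/eqP: y0; apply; exact: dot_basis_eq0 dp z1 z2 z3.
have [a Pa ya] : exists2 a, P a & dot y a < 0.
  have [h1|h1] := ltP (dot y p1) 0; first by exists p1.
  have [h2|h2] := ltP (dot y p2) 0; first by exists p2.
  have [h3|h3] := ltP (dot y p3) 0; first by exists p3.
  by exfalso; apply: ny; split; lra.
have [b Pb yb] : exists2 a, P a & 0 < dot y a.
  have [h1|h1] := ltP 0 (dot y p1); first by exists p1.
  have [h2|h2] := ltP 0 (dot y p2); first by exists p2.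
  have [h3|h3] := ltP 0 (dot y p3); first by exists p3.
  by exfalso; apply: ny; split; lra.
have flat (k : vec R) : dot k e = 0 -> slice P x `<=` [set z | dot k z = 0].
  by move=> ke z /line [t ->]; rewrite /= dotZr ke mulr0.
have [|F1 [hF1 np1 sF1]] := facet_at_edge hP np erefl (conj s1 s2) (flat _ ye) Pa ya.
  move=> t t0; apply/eqP => xE; have := np _ Pb; rewrite xE dotZl leNgt mulr_gt0 //.
have yne : dot (- y) e = 0 by rewrite dotNl ye oppr0.
have ynb : dot (- y) b < 0 by rewrite dotNl oppr_lt0.
have [|F2 [hF2 np2 sF2]] := facet_at_edge hP np erefl (conj s1 s2) (flat _ yne) Pb ynb.
  move=> t t0; apply/eqP => xE; have := np _ Pa; rewrite xE dotZl leNgt mulr_gt0 //.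
  by rewrite dotNl oppr_gt0.
have F12 : F1 <> F2.
  move=> e12; have d2 : affdim_ge F1 2 by move/(facets_oP _ hP): hF1 => [u [_ _ _]].
  apply: s2; rewrite -sF1; rewrite (_ : slice F1 y = F1) //.
  apply/seteqP; split=> z; first by case.
  move=> Fz; split => //; apply/eqP; rewrite eq_le np1 //=.
  by rewrite -oppr_le0 -dotNl np2 // -e12.
have sx F y' : facets_o P F -> slice F y' = slice P x -> slice F x = slice P x.
  move=> hF sF; apply/seteqP; split=> z.
    move=> [Fz xz]; split => //; move/(facets_oP _ hP): hF => [u [_ _ FE _]].
    by move: Fz; rewrite FE => -[].
  move=> sz; have : slice F y' z by rewrite sF.
  by case=> Fz _; split; last exact: sz.2.
have -> : width (slice P x) d + width (slice P x) d =
    \sum_(F \in [set F1] `|` [set F2]) width (slice F x) d.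
  rewrite fsbigU0; [|exact: finite_set1|exact: finite_set1|by move=> F [-> /= /F12]].
  by rewrite !fsbig_set1 (sx _ _ hF1 sF1) (sx _ _ hF2 sF2).
by apply: fsum_subset => // F [-> |->].
Qed.

(** At most two edges are flat, each no wider than the slice. If the slice is a facet, it pays for
    one of them; otherwise there is at most one. *)
Lemma kink3_nonneg : nonpos P x -> - width (slice P x) d <= kink3 P (- x) d.
Proof.
move=> np; rewrite /kink3 sum_edges_top // lerBrDr.
have -> : flat_edges P (- x) = flat_edges P x.
  apply/seteqP; split=> E [hE f]; split => // y /f /=; rewrite dotNl.
    by move=> /eqP; rewrite oppr_eq0 => /eqP.
  by move=> ->; rewrite oppr0.
have pS := slice_polytope x hP.
have [s2|s2] := pselect (affdim_ge (slice P x) 2).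
  have hS : facets_o P (slice P x) by apply/(facets_oP _ hP); exists x.
  have h1 : \sum_(E \in flat_edges P x) width E d <= 2 * width (slice P x) d.
    apply: flat_edges_width => //; [exact: polytope_bdd|move=> E [hE f] y Ey|exact: polytope_neq0].
    split; last exact: f.
    by move/(edges_oP _ hP): hE => [u [_ _ EE _]]; move: Ey; rewrite EE => -[].
  have h2 : width (slice P x) d <= \sum_(F \in facets_o P) width (top F (- x)) d.
    have <- : \sum_(F \in [set slice P x]) width (top F (- x)) d = width (slice P x) d.
      rewrite fsbig_set1 width_top_flat // => y [_ /=].
      by rewrite dotNl => ->; rewrite oppr0.
    by apply: fsum_subset => // [_ ->|F hF] //; exact: wF_ge0.
  lra.
have h1 : \sum_(E \in flat_edges P x) width E d <= width (slice P x) d.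
  have <- : \sum_(F \in [set slice P x]) width F d = width (slice P x) d by rewrite fsbig_set1.
  apply: fsum_subset; [by move=> E hE; exact: flat_edges_1dim hE|exact: finite_set1|].
  by move=> _ ->; apply: width_ge0; [exact: polytope_neq0|exact: polytope_bdd].
have : 0 <= \sum_(F \in facets_o P) width (top F (- x)) d by apply: fsumr_ge0 => F hF; exact: wF_ge0.
lra.
Qed.

End Kink3.
End Kinks.

(** * Kinks of planar polytopes and one-sided slopes *)

Section Kink2.
Variable R : realType.
Implicit Types (x y u v w n m e p q d : vec R) (c t : R) (A E F K P : set (vec R)) (s : seq (vec R)).

(** The one-sided derivative of [gsum P] at [x] in the direction [d]. *)
Definition gslope P x d : R :=
  if `[< affdim_ge P 3 >] then
    \sum_(F \in facets_o P) supp (top F x) d - \sum_(E \in edges_o P) supp (top E x) d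
  else if `[< affdim_ge P 2 >] then
    2 * supp (top P x) d - \sum_(E \in edges_o P) supp (top E x) d
  else 0.

Definition gkink P x d := gslope P x d + gslope P x (- d).

Definition kink2 P x d : R := 2 * width (top P x) d - \sum_(E \in edges_o P) width (top E x) d.

Lemma gkinkE P x d : polytope_o P -> gkink P x d =
  if `[< affdim_ge P 3 >] then kink3 P x d else if `[< affdim_ge P 2 >] then kink2 P x d else 0.
Proof.
move=> hP; rewrite /gkink /gslope /kink3 /kink2 /width.
rewrite (fsumD _ _ (facets_finite hP)) (fsumD _ _ (edges_finite hP)).
case: ifP => _; first by rewrite addrACA opprD.
case: ifP => _; last by rewrite addr0.
by rewrite addrACA opprD mulrDr.
Qed.

Section Planar.
Variables (P : set (vec R)) (x d m : vec R).
Hypotheses (hP : polytope_o P) (x0 : x != 0) (m0 : m != 0) (mP : forall y, P y -> dot m y = 0).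
Hypothesis d2 : affdim_ge P 2.
Let P0 : P 0 := hP.2.

Lemma slice_lt2 : ~ (forall y, P y -> dot x y = 0) -> ~ affdim_ge (slice P x) 2.
Proof.
move=> h /(affdim2P (slice_polytope x hP).2) [e1 [e2 [[P1 x1] [P2 x2] c0]]]; apply: h => y Py.
have [k xk] := parallel_normals c0 m0 (mP P1) (mP P2) x1 x2.
by rewrite xk dotZl mP // mulr0.
Qed.

(** [P] is its own face in both directions and has at most two edges at the origin, neither wider
    than [P]. *)
Lemma kink2_flat : (forall y, P y -> dot x y = 0) -> 0 <= kink2 P x d /\ 0 <= kink2 P (- x) d.
Proof.
move=> h; have hN y : P y -> dot (- x) y = 0 by move=> /h; rewrite dotNl => ->; rewrite oppr0.
rewrite /kink2 !sum_edges_top // !subr_ge0 !width_top_flat //.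
have bP := polytope_bdd hP; have nP := polytope_neq0 hP.
have sub y E : flat_edges P y E -> E `<=` P.
  by move=> [/(edges_oP _ hP) [u [_ _ -> _]] _]; exact: slice_sub.
by split; apply: flat_edges_width; rewrite ?oppr_eq0 //; exact: sub.
Qed.

(** A line with points of [P] strictly on both sides carries no edge. *)
Lemma kink2_mixed p q : P p -> 0 < dot x p -> P q -> dot x q < 0 -> 0 <= kink2 P x d.
Proof.
move=> Pp xp Pq xq; rewrite /kink2 sum_edges_top //.
rewrite (_ : flat_edges P x = set0).
  by rewrite fsbig_set0 subr0 mulr_ge0 // width_top_ge0.
apply/seteqP; split=> // E hE.
have nx : ~ (forall y, P y -> dot x y = 0) by move=> h; rewrite h // ltxx in xp.
have EE := flat_edges_1dim hP (slice_lt2 nx) hE.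
have [/(edges_oP _ hP) [u [u0 np EE' d1]] _] := hE.
have pos : meets_pos P x by exists p.
have neg : meets_pos P (- x) by exists q => //; rewrite dotNl oppr_gt0.
have us y : slice P x y -> dot u y = 0 by rewrite -EE EE' => -[].
have [k hk] := slice_vanish (polytope_convex hP) pos neg us.
have h1 := np _ Pp; have h2 := np _ Pq; rewrite hk // in h1; rewrite hk // in h2.
rewrite pmulr_lle0 // in h1; rewrite nmulr_lle0 // in h2.
have k0 : k = 0 by apply/eqP; rewrite eq_le h1 h2.
case: d1 => _; apply; rewrite EE' (_ : slice P u = P) //.
apply/seteqP; split=> y; first by case.
by move=> Py; split; rewrite //= hk // k0 mul0r.
Qed.

(** The slice lies on a line, so it is the only possible flat edge. *)
Lemma kink2_nonpos : nonpos P x -> ~ (forall y, P y -> dot x y = 0) ->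
  width (top P x) d <= kink2 P x d /\ - width (top P x) d <= kink2 P (- x) d.
Proof.
move=> np nx; rewrite /kink2 !sum_edges_top //.
have -> : flat_edges P (- x) = flat_edges P x.
  apply/seteqP; split=> E [hE f]; split => // y /f /=; rewrite dotNl.
    by move=> /eqP; rewrite oppr_eq0 => /eqP.
  by move=> ->; rewrite oppr0.
have h1 : \sum_(E \in flat_edges P x) width E d <= width (slice P x) d.
  have <- : \sum_(F \in [set slice P x]) width F d = width (slice P x) d by rewrite fsbig_set1.
  have pS := slice_polytope x hP.
  apply: fsum_subset; [move=> E hE|exact: finite_set1|].
    by apply: flat_edges_1dim hE => //; exact: slice_lt2.
  by move=> _ ->; apply: width_ge0; [exact: polytope_neq0|exact: polytope_bdd].
have := width_top_ge0 (- x) d hP.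
rewrite (@top_polytope0 _ P x) //; split; lra.
Qed.

End Planar.

(** The face sum alone can fail to be convex only where the plane of [x] supports [P]. There the
    kink on one side may drop to minus the width of the supported face, but on the other side it is
    at least that width, which the mixed inequalities between the coefficients exploit. *)
Lemma gkink_cases P x d : polytope_o P -> x != 0 ->
  [\/ 0 <= gkink P x d /\ 0 <= gkink P (- x) d,
      width (top P x) d <= gkink P x d /\ - width (top P x) d <= gkink P (- x) d |
      width (top P (- x)) d <= gkink P (- x) d /\ - width (top P (- x)) d <= gkink P x d].
Proof.
move=> hP x0; have P0 := hP.2; rewrite !gkinkE //.
have xN0 : - x != 0 by rewrite oppr_eq0.
have xq' q : dot x q < 0 -> 0 < dot (- x) q by rewrite dotNl oppr_gt0.
have xp' q : 0 < dot x q -> dot (- x) q < 0 by rewrite dotNl oppr_lt0.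
have sgn : [\/ exists p q, [/\ P p, 0 < dot x p, P q & dot x q < 0], nonpos P x | nonpos P (- x)].
  have [[p Pp xp]|h] := pselect (meets_pos P x); last by constructor 2; exact: not_meets_pos.
  have [[q Pq xq]|h] := pselect (meets_pos P (- x)); last by constructor 3; exact: not_meets_pos.
  by constructor 1; exists p, q; split => //; rewrite -oppr_gt0 -dotNl.
have [d3|d3] := pselect (affdim_ge P 3); rewrite ?(asboolT d3) ?(asboolF d3).
  case: sgn => [[p [q [Pp xp Pq xq]]]|np|np].
  - constructor 1; split; first exact: kink3_mixed xp Pq xq.
    exact: kink3_mixed (xq' q xq) Pp (xp' p xp).
  - constructor 2; rewrite top_polytope0 //.
    by split; [exact: kink3_nonpos|exact: kink3_nonneg].
  - constructor 3; rewrite top_polytope0 //.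
    by split; [exact: kink3_nonpos|rewrite -[x in kink3 _ x]opprK; exact: kink3_nonneg].
have [d2|d2] := pselect (affdim_ge P 2); rewrite ?(asboolT d2) ?(asboolF d2); last by constructor 1.
have [m m0 mP] := not_affdim3 P0 d3.
have [flat|nflat] := pselect (forall y, P y -> dot x y = 0).
  by constructor 1; exact: kink2_flat.
case: sgn => [[p [q [Pp xp Pq xq]]]|np|np].
- constructor 1; split; first exact: (kink2_mixed _ hP m0 mP d2 Pp xp Pq xq).
  exact: (kink2_mixed _ hP m0 mP d2 Pq (xq' q xq) Pp (xp' p xp)).
- constructor 2; exact: kink2_nonpos m0 mP np nflat.
- constructor 3; have nflat' : ~ (forall y, P y -> dot (- x) y = 0).
    move=> h; apply: nflat => y /h; rewrite dotNl => /eqP.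
    by rewrite oppr_eq0 => /eqP.
  by have := kink2_nonpos d hP m0 mP np nflat'; rewrite opprK.
Qed.

Lemma gsum_local P x d : polytope_o P -> exists2 eps : R, 0 < eps & forall t, 0 <= t <= eps ->
  supp P (x + t *: d) = supp P x + t * supp (top P x) d /\
  gsum P (x + t *: d) = gsum P x + t * gslope P x d.
Proof.
move=> hP; have [[s sE] _] := hP; have [eps e0 H] := local_supp s x d.
exists eps => // t t01.
have HF F : face P F /\ F 0 -> supp F (x + t *: d) = supp F x + t * supp (top F x) d.
  move=> [fF F0]; have [u [u0 np FE]] := (face_oP F hP).1 (conj fF F0).
  have FE' : F = conv [seq v <- s | dot u v == 0] by rewrite FE sE slice_conv -?sE.
  rewrite FE'; apply: H => //; last by move=> v; rewrite mem_filter => /andP[].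
  by apply: (@conv_neq0 _ _ 0); rewrite -FE'.
have sP : supp P (x + t *: d) = supp P x + t * supp (top P x) d.
  by rewrite sE; apply: H => //; apply: (@conv_neq0 _ _ 0); rewrite -sE; exact: hP.2.
split=> //; rewrite /gsum /gslope.
have sumE (Fs : set (set (vec R))) : finite_set Fs -> (forall F, Fs F -> face P F /\ F 0) ->
    \sum_(F \in Fs) supp F (x + t *: d) =
    \sum_(F \in Fs) supp F x + t * \sum_(F \in Fs) supp (top F x) d.
  move=> fin h; rewrite -fsumZ // -fsumD //; apply: eq_fsbigr => F /set_mem hF.
  by rewrite HF //; exact: h.
have eF : \sum_(F \in facets_o P) supp F (x + t *: d) =
    \sum_(F \in facets_o P) supp F x + t * \sum_(F \in facets_o P) supp (top F x) d.
  by apply: sumE; [exact: facets_finite|move=> F [? [_ ?]]].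
have eE : \sum_(F \in edges_o P) supp F (x + t *: d) =
    \sum_(F \in edges_o P) supp F x + t * \sum_(F \in edges_o P) supp (top F x) d.
  by apply: sumE; [exact: edges_finite|move=> F [? [_ ?]]].
case: ifP => _; first by rewrite eF eE mulrBr opprD addrACA.
case: ifP => _; last by rewrite mulr0 addr0.
by rewrite sP eE mulrBr opprD addrACA mulrDr mulrCA.
Qed.

Lemma gsum_homog P c x : polytope_o P -> 0 <= c -> gsum P (c *: x) = c * gsum P x.
Proof.
move=> hP c0; rewrite /gsum.
have sumE (Fs : set (set (vec R))) : finite_set Fs -> (forall F, Fs F -> polytope_o F) ->
    \sum_(F \in Fs) supp F (c *: x) = c * \sum_(F \in Fs) supp F x.
  move=> fin h; rewrite -fsumZ //; apply: eq_fsbigr => F /set_mem /h hF.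
  by rewrite suppZ //; [exact: polytope_neq0|exact: polytope_bdd].
have eF : \sum_(F \in facets_o P) supp F (c *: x) = c * \sum_(F \in facets_o P) supp F x.
  by apply: sumE; [exact: facets_finite|move=> F; exact: facet_polytope].
have eE : \sum_(F \in edges_o P) supp F (c *: x) = c * \sum_(F \in edges_o P) supp F x.
  by apply: sumE; [exact: edges_finite|move=> F; exact: edge_polytope].
case: ifP => _; first by rewrite eF eE mulrBr.
case: ifP => _; last by rewrite mulr0.
by rewrite eE suppZ ?mulrBr 1?mulrCA //; [exact: polytope_neq0|exact: polytope_bdd].
Qed.

End Kink2.

(** * From local to global convexity *)

Section LocalConvexity.
Variable R : realType.

(* Maximum principle: [f] minus its chord, perturbed by [e t^2], has no interior maximum. *)
Lemma local_midpoint (f : R -> R) : continuous f ->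
  (forall t, exists2 eps : R, 0 < eps & forall h, 0 <= h <= eps -> 2 * f t <= f (t + h) + f (t - h)) ->
  2 * f (1 / 2) <= f 0 + f 1.
Proof.
move=> cf loc; rewrite leNgt; apply/negP => lt.
pose D := 2 * f (1 / 2) - f 0 - f 1.
have D0 : 0 < D by rewrite /D; lra.
(* The term [D / 4 t^2] leaves [g (1/2) = 9 D / 16] above [g 0 = 0] and [g 1 = D / 4], and makes the
   local midpoint inequality strict at the maximum. *)
pose g t := f t - (f 0 + (f 1 - f 0) * t) + D / 4 * (t * t).
have cid : continuous (fun t : R => t) by move=> t; exact: cvg_id.
have cg : continuous g.
  move=> t; have i := cid t.
  have k c : {for t, continuous (fun=> c : R)} by exact: cst_continuous.
  exact: (continuousD (continuousB (cf t) (continuousD (k (f 0)) (continuousM (k (f 1 - f 0)) i)))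
    (continuousM (k (D / 4)) (continuousM i i))).
have [|c c01 cmax] := @EVT_max R g 0 1 ler01.
  by apply: continuous_subspaceT.
rewrite in_itv /= in c01; case/andP: c01 => c0 c1.
have half01 : (1 / 2 : R) \in `[0, 1] by rewrite in_itv /=; apply/andP; split; lra.
have gh : g (1 / 2) = D * (9 / 16) by rewrite /g /D; field.
have gc := cmax _ half01; rewrite gh in gc.
have cn0 : c != 0.
  by apply/eqP => e; rewrite e (_ : g 0 = 0) in gc; [lra|rewrite /g; ring].
have cn1 : c != 1.
  by apply/eqP => e; rewrite e (_ : g 1 = D / 4) in gc; [lra|rewrite /g; ring].
have cp : 0 < c by rewrite lt_neqAle eq_sym cn0.
have cl : c < 1 by rewrite lt_neqAle cn1.
have [eps e0 he] := loc c.
pose h := Num.min eps (Num.min c (1 - c)).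
have h0 : 0 < h by rewrite !lt_min e0 cp subr_gt0 cl.
have h1 : h <= eps by rewrite ge_min lexx.
have h2 : h <= c by rewrite !ge_min lexx orbT.
have h3 : h <= 1 - c by rewrite !ge_min lexx !orbT.
have m1 : g (c + h) <= g c by apply: cmax; rewrite in_itv /=; apply/andP; split; lra.
have m2 : g (c - h) <= g c by apply: cmax; rewrite in_itv /=; apply/andP; split; lra.
have := he h; rewrite (ltW h0) h1 => /(_ isT) hc.
have hh : 0 < D / 4 * (h * h) by rewrite !mulr_gt0 // divr_gt0.
move: m1 m2; rewrite /g => m1 m2.
have : D / 4 * ((c + h) * (c + h)) + D / 4 * ((c - h) * (c - h)) =
  2 * (D / 4 * (c * c)) + 2 * (D / 4 * (h * h)) by ring.
have : (f 1 - f 0) * (c + h) + (f 1 - f 0) * (c - h) = 2 * ((f 1 - f 0) * c) by ring.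
lra.
Qed.

Lemma le_of_perturbation (a b c e : R) : 0 < e ->
  (forall t, 0 < t -> t <= e -> a <= b + t * c) -> a <= b.
Proof.
move=> e0 H; rewrite leNgt; apply/negP => lt.
have C0 : 0 < 1 + `|c| by rewrite ltr_pwDl.
pose t := Num.min e ((a - b) / (2 * (1 + `|c|))).
have t0 : 0 < t by rewrite lt_min e0 divr_gt0 ?subr_gt0 // mulr_gt0.
have t1 : t <= e by rewrite ge_min lexx.
have t2 : t * (2 * (1 + `|c|)) <= a - b.
  by rewrite -ler_pdivlMr ?mulr_gt0 // ge_min lexx orbT.
have h := H t t0 t1.
have h1 : t * c <= t * `|c| by rewrite ler_wpM2l ?(ltW t0) // ler_norm.
have e2 : t * (2 * (1 + `|c|)) = 2 * t + 2 * (t * `|c|) by ring.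
have := mulr_ge0 (ltW t0) (normr_ge0 c); lra.
Qed.

End LocalConvexity.

(** * Sublinearity of the weighted combination *)

Section Sublinearity.
Variable R : realType.
Variables a1 a2 b1 b2 : R.
Hypotheses (a10 : 0 <= a1) (b10 : 0 <= b1) (a12 : a1 <= a2) (b12 : b1 <= b2).
Hypotheses (ab : a2 - a1 <= b2) (ba : b2 - b1 <= a2).
Variable P : set (vec R).
Hypothesis hP : polytope_o P.
Let h x := hD a1 a2 b1 b2 P x.

Definition hDslope x d : R := a1 * supp (top P x) d + (a2 - a1) * gslope P x d +
  b1 * supp (top P (- x)) (- d) + (b2 - b1) * gslope P (- x) (- d).

Lemma hD_local x d : exists2 eps : R, 0 < eps & forall t, 0 <= t <= eps ->
  h (x + t *: d) = h x + t * hDslope x d.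
Proof.
have [e1 e10 H1] := gsum_local x d hP; have [e2 e20 H2] := gsum_local (- x) (- d) hP.
exists (Num.min e1 e2); first by rewrite lt_min e10.
move=> t /andP[t0]; rewrite le_min => /andP[t1 t2].
have [|A1 A2] := H1 t; first by rewrite t0.
have [|B1 B2] := H2 t; first by rewrite t0.
rewrite /h !hD_gsum opprD -scalerN A1 A2 B1 B2 /hDslope.
by move: (supp (top P x) d) (gslope P x d) (supp (top P (- x)) (- d)) (gslope P (- x) (- d)) => *; ring.
Qed.

Lemma hD_kink x d : x != 0 -> 0 <= hDslope x d + hDslope x (- d).
Proof.
move=> x0.
have -> : hDslope x d + hDslope x (- d) = a1 * width (top P x) d + (a2 - a1) * gkink P x d +
    b1 * width (top P (- x)) d + (b2 - b1) * gkink P (- x) d.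
  rewrite /hDslope /width /gkink opprK.
  move: (supp (top P x) d) (supp (top P x) (- d)) (gslope P x d) (gslope P x (- d)).
  move: (supp (top P (- x)) d) (supp (top P (- x)) (- d)) (gslope P (- x) d) (gslope P (- x) (- d)).
  by move=> *; ring.
have w1 := width_top_ge0 x d hP; have w2 := width_top_ge0 (- x) d hP.
have := gkink_cases d hP x0.
move: (width (top P x) d) (width (top P (- x)) d) (gkink P x d) (gkink P (- x) d) w1 w2.
move=> p q k l p0 q0.
have sa : 0 <= a2 - a1 by rewrite subr_ge0.
have sb : 0 <= b2 - b1 by rewrite subr_ge0.
have h1 : 0 <= a1 * p by rewrite mulr_ge0.
have h2 : 0 <= b1 * q by rewrite mulr_ge0.
case=> [[k0 l0]|[kp lp]|[lq kq]].
- by rewrite !addr_ge0 // mulr_ge0.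
(* With [k >= p] and [l >= - p] the sum regroups so that [p] is left with the coefficient
   [a2 - (b2 - b1)]; the case after this one leaves [q] with [b2 - (a2 - a1)]. *)
- have h3 : 0 <= (a2 - a1) * (k - p) by rewrite mulr_ge0 // subr_ge0.
  have h4 : 0 <= (b2 - b1) * (l + p) by rewrite mulr_ge0 //; lra.
  have h5 : 0 <= (a2 - (b2 - b1)) * p by rewrite mulr_ge0 // subr_ge0.
  rewrite (_ : _ + _ = (a2 - a1) * (k - p) + (b2 - b1) * (l + p) + (a2 - (b2 - b1)) * p + b1 * q); last ring.
  by rewrite !addr_ge0.
- have h3 : 0 <= (b2 - b1) * (l - q) by rewrite mulr_ge0 // subr_ge0.
  have h4 : 0 <= (a2 - a1) * (k + q) by rewrite mulr_ge0 //; lra.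
  have h5 : 0 <= (b2 - (a2 - a1)) * q by rewrite mulr_ge0 // subr_ge0.
  rewrite (_ : _ + _ = (b2 - b1) * (l - q) + (a2 - a1) * (k + q) + (b2 - (a2 - a1)) * q + a1 * p); last ring.
  by rewrite !addr_ge0.
Qed.

Lemma line_continuous (f : R -> R) :
  (forall t, exists2 eps : R, 0 < eps & exists c c', forall k, 0 <= k <= eps ->
     f (t + k) = f t + k * c /\ f (t - k) = f t + k * c') -> continuous f.
Proof.
move=> H t; have [eps e0 [c [c' hc]]] := H t.
apply/cvgrPdist_le => /= e ep.
have K0 : 0 < 1 + `|c| + `|c'| by rewrite -addrA ltr_pwDl // addr_ge0.
near=> s.
have d1 : `|t - s| <= eps by near: s; exact: (cvgr_dist_le id t cvg_id).
have d2 : `|t - s| <= e / (1 + `|c| + `|c'|) by near: s; apply: (cvgr_dist_le id t cvg_id); rewrite divr_gt0.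
rewrite ler_pdivlMr // in d2.
have n1 := normr_ge0 c; have n2 := normr_ge0 c'.
have [ts|st] := leP t s.
  have kr : 0 <= s - t <= eps by rewrite subr_ge0 ts -(@ger0_norm _ (s - t)) ?subr_ge0 // distrC.
  have [e1 _] := hc _ kr; have -> : s = t + (s - t) by ring.
  rewrite e1 opprD addrA subrr sub0r normrN normrM distrC.
  by apply: le_trans d2; rewrite ler_wpM2l //; lra.
have kr : 0 <= t - s <= eps by rewrite subr_ge0 (ltW st) -(@ger0_norm _ (t - s)) ?subr_ge0 // ltW.
have [_ e1] := hc _ kr; have -> : s = t - (t - s) by ring.
rewrite e1 opprD addrA subrr sub0r normrN normrM.
by apply: le_trans d2; rewrite ler_wpM2l //; lra.
Unshelve. all: by end_near. Qed.

Lemma hD_homog c x : 0 <= c -> h (c *: x) = c * h x.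
Proof.
move=> c0; have nP := polytope_neq0 hP; have bP := polytope_bdd hP.
rewrite /h !hD_gsum -scalerN !suppZ // !gsum_homog //.
by move: (supp P x) (gsum P x) (supp P (- x)) (gsum P (- x)) => *; ring.
Qed.

(** On a line that avoids the origin the function is locally linear on both sides of each point,
    with nonnegative kinks, so [local_midpoint] applies; homogeneity turns the midpoint into the
    sum. *)
Lemma hD_subadd_off x y : (forall t, x + t *: (y - x) != 0) -> h (x + y) <= h x + h y.
Proof.
move=> nz; pose f t := h (x + t *: (y - x)).
have two t : exists2 eps : R, 0 < eps & exists c c', [/\ 0 <= c + c' & forall k, 0 <= k <= eps ->
     f (t + k) = f t + k * c /\ f (t - k) = f t + k * c'].
  have [e1 e10 H1] := hD_local (x + t *: (y - x)) (y - x).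
  have [e2 e20 H2] := hD_local (x + t *: (y - x)) (- (y - x)).
  exists (Num.min e1 e2); first by rewrite lt_min e10.
  exists (hDslope (x + t *: (y - x)) (y - x)), (hDslope (x + t *: (y - x)) (- (y - x))).
  split; first exact: hD_kink.
  move=> k /andP[k0]; rewrite le_min => /andP[k1 k2].
  by rewrite /f -H1 ?k0 // -H2 ?k0 // scalerDl scalerBl scalerN addrA addrA.
have cf : continuous f.
  apply: line_continuous => t; have [e e0 [c [c' [_ H]]]] := two t.
  by exists e => //; exists c, c'.
have := local_midpoint cf _.
have -> : f (1 / 2) = (1 / 2) * h (x + y).
  rewrite /f -hD_homog; last lra.
  by congr h; apply: vec_eq; rewrite !mxE; field.
have -> : f 0 = h x by rewrite /f scale0r addr0.
have -> : f 1 = h y by rewrite /f scale1r addrC subrK.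
rewrite mulrA (_ : 2 * (1 / 2) = 1) ?mul1r; last by field.
apply=> t; have [e e0 [c [c' [cc H]]]] := two t; exists e => // k k01.
have [-> ->] := H k k01; case/andP: k01 => k0 _.
have : 0 <= k * (c + c') by rewrite mulr_ge0.
lra.
Qed.

Lemma hD_sublin : sublin h.
Proof.
split; last exact: hD_homog.
move=> x y; have [nz|] := pselect (forall t, x + t *: (y - x) != 0); first exact: hD_subadd_off.
move=> /existsNP [t /negP/negPn/eqP xE].
have [v [v' [vw _ c0]]] := orthogonal_pair (y - x).
(* The segment passes through the origin; shift it by a small orthogonal vector. *)
have [v0 v00 v0w] : exists2 v, v != 0 & dot v (y - x) = 0.
  have [w0|w0] := eqVneq (y - x) 0.
    exists (bvec R o0); last by rewrite w0 dot0r.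
    by apply/eqP => /(congr1 (fun N => fun_of_matrix N ord0 o0)); rewrite !mxE /= => /eqP; rewrite oner_eq0.
  by exists v => //; apply: contra (c0 w0) => /eqP ->; rewrite cross0l.
have off eta : 0 < eta -> h (x + y + (2 * eta) *: v0) <= h (x + eta *: v0) + h (y + eta *: v0).
  move=> eta0; rewrite (_ : x + y + (2 * eta) *: v0 = (x + eta *: v0) + (y + eta *: v0)); last first.
    by apply: vec_eq; rewrite !mxE; ring.
  apply: hD_subadd_off => s; apply/eqP => e.
  have := congr1 (fun z : vec R => dot v0 z) e.
  rewrite (_ : y + eta *: v0 - (x + eta *: v0) = y - x); last by apply: vec_eq; rewrite !mxE; ring.
  have xw : x = - t *: (y - x) by rewrite scaleNr; apply/eqP; rewrite -addr_eq0 xE.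
  rewrite {1}xw !dotDr !dotZr v0w !mulr0 add0r addr0 dot0r => /eqP.
  by rewrite mulf_eq0 (gt_eqF eta0) (gt_eqF (dot_gt0 v00)).
have [e1 e10 H1] := hD_local (x + y) v0.
have [e2 e20 H2] := hD_local x v0; have [e3 e30 H3] := hD_local y v0.
set c1 := hDslope _ _ in H1; set c2 := hDslope _ _ in H2; set c3 := hDslope _ _ in H3.
apply: (@le_of_perturbation _ _ _ (c2 + c3 - 2 * c1) (Num.min (e1 / 2) (Num.min e2 e3))).
  by rewrite !lt_min divr_gt0 // e20.
move=> eta eta0; rewrite !le_min => /and3P[l1 l2 l3].
have := off eta eta0; rewrite H1 ?H2 ?H3 ?(ltW eta0) //=.
  set A := h (x + y); set B := h x; set C := h y => le.
  rewrite -subr_ge0; rewrite -subr_ge0 in le; apply: le_trans le _.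
  by rewrite le_eqVlt; apply/orP; left; apply/eqP; ring.
by rewrite mulr_ge0 ?(ltW eta0) //= mulrC -ler_pdivlMr.
Qed.

End Sublinearity.

(** * Moment bodies *)
Section Transvections.
Variable R : realType.
Implicit Types (u v w : vec R) (c : R).

Definition transvection (i j : 'I_3) c : 'M[R]_3 := 1%:M + c *: delta_mx i j.

Lemma transvection_row i j c (A : 'M[R]_3) k :
  row k (transvection i j c *m A) = row k A + (c * (k == i)%:R) *: row j A.
Proof.
rewrite /transvection mulmxDl mul1mx linearD /= -scalemxAl linearZ /=; congr (_ + _).
apply/rowP => l; rewrite !mxE (bigD1 j) //= !mxE eqxx andbT big1 ?addr0 ?mulrA //.
by move=> m /negbTE mj; rewrite !mxE mj andbF mul0r.
Qed.

Section Generation.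
Variable Q : 'M[R]_3 -> Prop.
Hypothesis Q1 : Q 1%:M.
Hypothesis QM : forall A B, Q A -> Q B -> Q (A *m B).
Hypothesis Qt : forall i j c, i != j -> Q (transvection i j c).
Let Q3 u v w := Q (mx3 u v w).

Lemma transvectionK i j c (A : 'M[R]_3) : i != j ->
  transvection i j (- c) *m (transvection i j c *m A) = A.
Proof.
move=> ij; apply/row_matrixP => k; rewrite !transvection_row.
rewrite [j == i]eq_sym (negbTE ij) mulr0 scale0r addr0 mulNr scaleNr.
by rewrite addrK.
Qed.

Lemma Q_transvection i j c A : i != j -> Q (transvection i j c *m A) -> Q A.
Proof. by move=> ij QA; rewrite -(transvectionK c A ij); apply: QM => //; exact: Qt. Qed.

Lemma mx3_rows (A : 'M[R]_3) : A = mx3 (row o0 A) (row o1 A) (row o2 A).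
Proof.
have [e0 e1 e2] := row_mx3 (row o0 A) (row o1 A) (row o2 A).
by apply/row_matrixP; apply: ord3P; rewrite ?e0 ?e1 ?e2.
Qed.

Lemma Q_op01 c u v w : Q3 (u + c *: v) v w -> Q3 u v w.
Proof.
move=> H; apply: (@Q_transvection o0 o1 c) => //; rewrite [X in Q X]mx3_rows !transvection_row.
by have [-> -> ->] := row_mx3 u v w; rewrite /= mulr1 !mulr0 !scale0r !addr0.
Qed.
Lemma Q_op02 c u v w : Q3 (u + c *: w) v w -> Q3 u v w.
Proof.
move=> H; apply: (@Q_transvection o0 o2 c) => //; rewrite [X in Q X]mx3_rows !transvection_row.
by have [-> -> ->] := row_mx3 u v w; rewrite /= mulr1 !mulr0 !scale0r !addr0.
Qed.
Lemma Q_op10 c u v w : Q3 u (v + c *: u) w -> Q3 u v w.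
Proof.
move=> H; apply: (@Q_transvection o1 o0 c) => //; rewrite [X in Q X]mx3_rows !transvection_row.
by have [-> -> ->] := row_mx3 u v w; rewrite /= mulr1 !mulr0 !scale0r !addr0.
Qed.
Lemma Q_op12 c u v w : Q3 u (v + c *: w) w -> Q3 u v w.
Proof.
move=> H; apply: (@Q_transvection o1 o2 c) => //; rewrite [X in Q X]mx3_rows !transvection_row.
by have [-> -> ->] := row_mx3 u v w; rewrite /= mulr1 !mulr0 !scale0r !addr0.
Qed.
Lemma Q_op20 c u v w : Q3 u v (w + c *: u) -> Q3 u v w.
Proof.
move=> H; apply: (@Q_transvection o2 o0 c) => //; rewrite [X in Q X]mx3_rows !transvection_row.
by have [-> -> ->] := row_mx3 u v w; rewrite /= mulr1 !mulr0 !scale0r !addr0.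
Qed.
Lemma Q_op21 c u v w : Q3 u v (w + c *: v) -> Q3 u v w.
Proof.
move=> H; apply: (@Q_transvection o2 o1 c) => //; rewrite [X in Q X]mx3_rows !transvection_row.
by have [-> -> ->] := row_mx3 u v w; rewrite /= mulr1 !mulr0 !scale0r !addr0.
Qed.

Lemma det3_add01 c u v w : det3 (u + c *: v) v w = det3 u v w.
Proof. by rewrite !det3E !mxE; ring. Qed.
Lemma det3_add10 c u v w : det3 u (v + c *: u) w = det3 u v w.
Proof. by rewrite !det3E !mxE; ring. Qed.
Lemma det3_add12 c u v w : det3 u (v + c *: w) w = det3 u v w.
Proof. by rewrite !det3E !mxE; ring. Qed.
Lemma det3_add20 c u v w : det3 u v (w + c *: u) = det3 u v w.
Proof. by rewrite !det3E !mxE; ring. Qed.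
Lemma det3_add21 c u v w : det3 u v (w + c *: v) = det3 u v w.
Proof. by rewrite !det3E !mxE; ring. Qed.

Lemma SL3_transvections (A : 'M[R]_3) : \det A = 1 -> Q A.
Proof.
suff: det3 (row o0 A) (row o1 A) (row o2 A) = 1 -> Q3 (row o0 A) (row o1 A) (row o2 A).
  by rewrite /Q3 -mx3_rows det_det3.
move: (row o0 A) (row o1 A) (row o2 A) => u v w d1.
(* Gauss–Jordan elimination with row transvections only. *)
have step5 u' v' w' : det3 u' v' w' = 1 -> u' ord0 o0 = 1 -> v' ord0 o0 = 0 -> w' ord0 o0 = 0 ->
    u' ord0 o1 = 0 -> v' ord0 o1 = 1 -> w' ord0 o1 = 0 -> Q3 u' v' w'.
  move=> d u0 v0 w0 u1 v1 w1.
  have w2 : w' ord0 o2 = 1 by move: d; rewrite det3E u0 v0 w0 u1 v1 w1; lra.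
  apply: (@Q_op02 (- u' ord0 o2)); apply: (@Q_op12 (- v' ord0 o2)).
  rewrite /Q3 (_ : mx3 _ _ _ = 1%:M) //; apply/matrixP => i j; rewrite !mxE.
  move: i; apply: ord3P => /=; rewrite ?mxE; move: j; apply: ord3P => /=;
    rewrite ?u0 ?v0 ?w0 ?u1 ?v1 ?w1 ?w2 ?mulr0 ?addr0 ?mulr1 ?subrr //.
have step4 u' v' w' : det3 u' v' w' = 1 -> u' ord0 o0 = 1 -> v' ord0 o0 = 0 -> w' ord0 o0 = 0 ->
    v' ord0 o1 = 1 -> Q3 u' v' w'.
  move=> d u0 v0 w0 v1; apply: (@Q_op01 (- u' ord0 o1)); apply: (@Q_op21 (- w' ord0 o1)).
  apply: step5; rewrite ?det3_add21 ?det3_add01 // !mxE ?u0 ?v0 ?w0 ?v1; ring.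
have step3 u' v' w' : det3 u' v' w' = 1 -> u' ord0 o0 = 1 -> v' ord0 o0 = 0 -> w' ord0 o0 = 0 ->
    Q3 u' v' w'.
  move=> d u0 v0 w0.
  have key v'' w'' : det3 u' v'' w'' = 1 -> v'' ord0 o0 = 0 -> w'' ord0 o0 = 0 ->
      w'' ord0 o1 != 0 -> Q3 u' v'' w''.
    move=> d' v0' w0' w1; apply: (@Q_op12 ((1 - v'' ord0 o1) / w'' ord0 o1)).
    by apply: step4; rewrite ?det3_add12 // !mxE ?v0' ?w0' ?divfK //; ring.
  have [w1|w1] := eqVneq (w' ord0 o1) 0; last exact: key.
  have v1 : v' ord0 o1 != 0.
    apply/eqP => v1; move: d; rewrite det3E u0 v0 w0 w1 v1.
    by rewrite !(mulr0, mul0r, subrr, addr0) => /esym/eqP; rewrite oner_eq0.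
  (* A vanishing pivot is made nonzero by first adding another row. *)
  apply: (@Q_op21 1); apply: key; rewrite ?det3_add21 // !mxE ?v0 ?w0 ?w1 ?mulr0 ?addr0 //.
  by rewrite mul1r add0r.
have step2 u' v' w' : det3 u' v' w' = 1 -> u' ord0 o0 = 1 -> Q3 u' v' w'.
  move=> d u0; apply: (@Q_op10 (- v' ord0 o0)); apply: (@Q_op20 (- w' ord0 o0)).
  by apply: step3; rewrite ?det3_add20 ?det3_add10 // !mxE u0; ring.
have step1 u' v' w' : det3 u' v' w' = 1 -> v' ord0 o0 != 0 -> Q3 u' v' w'.
  move=> d v0; apply: (@Q_op01 ((1 - u' ord0 o0) / v' ord0 o0)).
  by apply: step2; rewrite ?det3_add01 // !mxE divfK //; ring.
have [v0|v0] := eqVneq (v ord0 o0) 0; last exact: step1.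
have [w0|w0] := eqVneq (w ord0 o0) 0; last first.
  apply: (@Q_op12 1); apply: step1; rewrite ?det3_add12 // !mxE v0 mul1r add0r //.
have u0 : u ord0 o0 != 0.
  apply/eqP => u0; move: d1; rewrite det3E u0 v0 w0.
  by rewrite !(mulr0, mul0r, subrr, addr0) => /esym/eqP; rewrite oner_eq0.
by apply: (@Q_op10 1); apply: step1; rewrite ?det3_add10 // !mxE v0 mul1r add0r.
Qed.

End Generation.
End Transvections.

(** * Measure-preserving maps and shears of products *)

Section Preserving.
Context d (T : measurableType d) (R : realType).
Implicit Types (mu : set T -> \bar R) (f g : T -> T).

Definition preserving mu f := measurable_fun setT f /\
  forall A, measurable A -> mu (f @^-1` A) = mu A.

Lemma preserving_comp mu f g : preserving mu f -> preserving mu g -> preserving mu (g \o f).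
Proof.
move=> [mf pf] [mg pg]; split; first exact: measurableT_comp.
move=> A mA; rewrite comp_preimage pf ?pg //.
by rewrite -[_ @^-1` _]setTI; exact: mg.
Qed.

Lemma preserving_id mu : preserving mu id.
Proof. by split => // A mA. Qed.

End Preserving.

Section ProductPreserving.
Context d1 d2 (T1 : measurableType d1) (T2 : measurableType d2) (R : realType).
Variable m1 : {sigma_finite_measure set T1 -> \bar R}.
Variable m2 : {sigma_finite_measure set T2 -> \bar R}.

(** The product measure integrates the measures of sections, and the section over [x] is moved by
    [tau x], which preserves [m2]. *)
Lemma product_shear_snd (tau : T1 -> T2 -> T2) :
  measurable_fun setT (fun p : T1 * T2 => (p.1, tau p.1 p.2)) ->
  (forall x A, measurable A -> m2 (tau x @^-1` A) = m2 A) ->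
  preserving (m1 \x m2)%E (fun p : T1 * T2 => (p.1, tau p.1 p.2)).
Proof.
move=> mf pt; split => // A mA; apply: eq_integral => x _ /=.
have <- : m2 (tau x @^-1` xsection A x) = m2 (xsection A x).
  by apply: pt; exact: measurable_xsection.
by [].
Qed.

(** The product measure is defined through sections over the first factor; Tonelli's theorem gives
    the other order, needed for shears of the first factor. *)
Lemma product_ysection A : measurable A -> (m1 \x m2)%E A = (\int[m2]_y m1 (ysection A y))%E.
Proof.
move=> mA; have := indic_fubini_tonelli m1 m2 mA.
by rewrite indic_fubini_tonelli_FE // indic_fubini_tonelli_GE.
Qed.

Lemma product_shear_fst (tau : T2 -> T1 -> T1) :
  measurable_fun setT (fun p : T1 * T2 => (tau p.2 p.1, p.2)) ->
  (forall x A, measurable A -> m1 (tau x @^-1` A) = m1 A) ->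
  preserving (m1 \x m2)%E (fun p : T1 * T2 => (tau p.2 p.1, p.2)).
Proof.
move=> mf pt; split => // A mA; rewrite !product_ysection //; last first.
  by rewrite -[_ @^-1` _]setTI; exact: mf.
apply: eq_integral => y _ /=.
have <- : m1 (tau y @^-1` ysection A y) = m1 (ysection A y).
  by apply: pt; exact: measurable_ysection.
by [].
Qed.

End ProductPreserving.

(** * SL(3) invariance of the volume *)

Section LebesgueSpace.
Variable R : realType.
Local Notation mR := (measurableTypeR R).
Local Notation leb := (@lebesgue_measure R).
Local Notation T3 := ((mR * mR) * mR)%type.

(** Lebesgue measure is determined by its values on half-open intervals. *)
Lemma lebesgue_translation (a : R) (A : set mR) : measurable A ->
  leb ((fun x : R => x + a) @^-1` A) = leb A.
Proof.
move=> mA.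
have mf : measurable_fun setT (fun x : R => (x + a : mR)).
  by apply: measurable_funD => //; exact: measurable_cst.
suff : pushforward leb (fun x : R => (x + a : mR)) A = leb A by [].
apply/esym/lebesgue_measure_unique => //= _ [[b c]] _ <-.
rewrite /pushforward (_ : _ @^-1` _ = `]b - a, c - a]%classic); last first.
  by apply/seteqP; split=> y /=; rewrite !in_itv /= ltrBlDr lerBrDr.
rewrite !lebesgue_measure_itv /= !lte_fin ltrD2r.
by case: ifP => // _; rewrite -!EFinB; congr (_%:E); ring.
Qed.

Lemma linear_measurable (a b c : R) :
  measurable_fun setT (fun p : T3 => (a * p.1.1 + b * p.1.2 + c * p.2 : mR)).
Proof.
have m1 : measurable_fun setT (fun p : T3 => (p.1 : mR * mR)) by exact: measurable_fst.
have m2 : measurable_fun setT (fun p : T3 => (p.2 : mR)) by exact: measurable_snd.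
have m11 : measurable_fun setT (fun p : T3 => (p.1.1 : mR)).
  exact: (measurableT_comp measurable_fst m1).
have m12 : measurable_fun setT (fun p : T3 => (p.1.2 : mR)).
  exact: (measurableT_comp measurable_snd m1).
apply: measurable_funD; [apply: measurable_funD|]; apply: measurable_funM => //; exact: measurable_cst.
Qed.

Lemma linear_measurable2 (a b : R) :
  measurable_fun setT (fun p : mR * mR => (a * p.1 + b * p.2 : mR)).
Proof.
have m1 : measurable_fun setT (fun p : mR * mR => (p.1 : mR)) by exact: measurable_fst.
have m2 : measurable_fun setT (fun p : mR * mR => (p.2 : mR)) by exact: measurable_snd.
by apply: measurable_funD; apply: measurable_funM => //; exact: measurable_cst.
Qed.

Definition coords (y : vec R) : T3 := ((y ord0 o0, y ord0 o1), y ord0 o2).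

Lemma v3K (p : T3) : coords (v3 p) = p.
Proof. by case: p => [[a b] c]; rewrite /coords !mxE. Qed.

Lemma coordsK (y : vec R) : v3 (coords y) = y.
Proof. by apply: vec_eq; rewrite !mxE. Qed.

Definition lin_act (phi : 'M[R]_3) (p : T3) : T3 := coords (v3 p *m phi).

Lemma lin_act_measurable phi : measurable_fun setT (lin_act phi).
Proof.
have m (j : 'I_3) : measurable_fun setT (fun p : T3 => ((v3 p *m phi) ord0 j : mR)).
  rewrite (_ : (fun p : T3 => _) =
    fun p : T3 => phi o0 j * p.1.1 + phi o1 j * p.1.2 + phi o2 j * p.2).
    exact: linear_measurable.
  by apply/funext => p; rewrite mxE sum3E !mxE /= ![_ * phi _ _]mulrC.
by apply: measurable_fun_pair => //; apply: measurable_fun_pair.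
Qed.

Lemma lin_act_mul phi psi : lin_act (phi *m psi) = lin_act psi \o lin_act phi.
Proof. by apply/funext => p; rewrite /lin_act /= coordsK mulmxA. Qed.

Lemma mul_transvection (y : vec R) i j c :
  y *m transvection i j c = y + (c * y ord0 i) *: bvec R j.
Proof.
rewrite /transvection mulmxDr mulmx1 -scalemxAr -scalerA; congr (_ + _ *: _).
apply/rowP => k; rewrite !mxE (bigD1 i) //= !mxE eqxx big1 ?addr0; last first.
  by move=> m /negbTE mi; rewrite !mxE mi mulr0.
by rewrite /= eq_sym.
Qed.

Lemma preserving_shear2_snd (c : R) :
  preserving (leb \x leb)%E (fun p : mR * mR => (p.1, (p.2 + c * p.1 : mR))).
Proof.
have H := @product_shear_snd _ _ mR mR R leb leb (fun x y => (y + c * x : mR)); apply: H.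
  apply: measurable_fun_pair; first exact: measurable_fst.
  rewrite (_ : (fun p : mR * mR => _) = fun p : mR * mR => c * p.1 + 1 * p.2).
    exact: linear_measurable2.
  by apply/funext => p; rewrite mul1r addrC.
by move=> x A mA; exact: lebesgue_translation.
Qed.

Lemma preserving_shear2_fst (c : R) :
  preserving (leb \x leb)%E (fun p : mR * mR => ((p.1 + c * p.2 : mR), p.2)).
Proof.
have H := @product_shear_fst _ _ mR mR R leb leb (fun y x => (x + c * y : mR)); apply: H.
  apply: measurable_fun_pair; last exact: measurable_snd.
  rewrite (_ : (fun p : mR * mR => _) = fun p : mR * mR => 1 * p.1 + c * p.2).
    exact: linear_measurable2.
  by apply/funext => p; rewrite mul1r.
by move=> x A mA; exact: lebesgue_translation.
Qed.

Lemma preserving_trans2_fst (a : R) :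
  preserving (leb \x leb)%E (fun p : mR * mR => ((p.1 + a : mR), p.2)).
Proof.
have H := @product_shear_fst _ _ mR mR R leb leb (fun y x => (x + a : mR)); apply: H.
  apply: measurable_fun_pair; last exact: measurable_snd.
  by apply: measurable_funD; [exact: measurable_fst|exact: measurable_cst].
by move=> x A mA; exact: lebesgue_translation.
Qed.

Lemma preserving_trans2_snd (a : R) :
  preserving (leb \x leb)%E (fun p : mR * mR => (p.1, (p.2 + a : mR))).
Proof.
have H := @product_shear_snd _ _ mR mR R leb leb (fun x y => (y + a : mR)); apply: H.
  apply: measurable_fun_pair; first exact: measurable_fst.
  by apply: measurable_funD; [exact: measurable_snd|exact: measurable_cst].
by move=> x A mA; exact: lebesgue_translation.
Qed.

(** The plane measure gets a name so that it can carry a sigma-finite structure and serve as a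
    factor. *)
Definition leb2 : set (mR * mR)%type -> \bar R := (leb \x leb)%E.

HB.instance Definition _ := Measure.copy leb2 (leb \x leb)%E.

Lemma leb2_sigma_finite : sigma_finite setT leb2.
Proof.
have /sigma_finiteP[F [TF ndF Foo]] := sigma_finiteT leb.
exists (fun n => F n `*` F n).
  apply/seteqP; split=> // -[x y] _.
  have : (\bigcup_n F n) x by rewrite -TF.
  have : (\bigcup_n F n) y by rewrite -TF.
  move=> [k _ Fy] [n _ Fx]; exists (maxn n k) => //; split.
    by apply: (subsetPset _ _ (ndF _ _ (leq_maxl n k))).
  by apply: (subsetPset _ _ (ndF _ _ (leq_maxr n k))).
move=> k; have [mF Fk] := Foo k; split; first exact: measurableX.
rewrite /leb2 product_measure1E // lte_mul_pinfty // ge0_fin_numE //.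
Qed.

HB.instance Definition _ := Measure_isSigmaFinite.Build _ _ _ leb2 leb2_sigma_finite.

Lemma preserving_fst (tau : mR -> mR * mR -> mR * mR) phi :
  (forall z, preserving (leb \x leb)%E (tau z)) ->
  (forall p : T3, lin_act phi p = (tau p.2 p.1, p.2)) -> preserving (@leb3 R) (lin_act phi).
Proof.
move=> h e; have E : lin_act phi = fun p : T3 => (tau p.2 p.1, p.2) by apply/funext.
rewrite E; have H := @product_shear_fst _ _ (mR * mR)%type mR R leb2 leb tau; apply: H.
  by rewrite -E; exact: lin_act_measurable.
by move=> z A mA; exact: (h z).2.
Qed.

Lemma preserving_snd (tau : mR * mR -> mR) phi :
  (forall p : T3, lin_act phi p = (p.1, (p.2 + tau p.1 : mR))) -> preserving (@leb3 R) (lin_act phi).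
Proof.
move=> e; have E : lin_act phi = fun p : T3 => (p.1, (p.2 + tau p.1 : mR)) by apply/funext.
rewrite E; have H := @product_shear_snd _ _ (mR * mR)%type mR R leb2 leb (fun p z => (z + tau p : mR)); apply: H.
  by rewrite -E; exact: lin_act_measurable.
by move=> z A mA; exact: lebesgue_translation.
Qed.

Lemma lin_act_transvection i j c (p : T3) : lin_act (transvection i j c) p =
  coords (v3 p + (c * v3 p ord0 i) *: bvec R j).
Proof. by rewrite /lin_act mul_transvection. Qed.

(** Three-space is the plane times a line. A change of the last coordinate is a translation over
    each point of the plane; a change of the first two is a shear or a translation of the plane with
    the last coordinate as parameter. *)
Lemma preserving_transvection i j c : i != j -> preserving (@leb3 R) (lin_act (transvection i j c)).
Proof.
move: i j; apply: ord3P; apply: ord3P => ij; try by move: ij; rewrite eqxx.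
- apply: (@preserving_fst (fun z p => (p.1, (p.2 + c * p.1 : mR)))) => [z|[[a b] z]].
    exact: preserving_shear2_snd.
  by rewrite lin_act_transvection /coords !mxE /= !mulr0 !addr0 mulr1.
- apply: (@preserving_snd (fun p => c * p.1)) => -[[a b] z].
  by rewrite lin_act_transvection /coords !mxE /= !mulr0 !addr0 mulr1.
- apply: (@preserving_fst (fun z p => ((p.1 + c * p.2 : mR), p.2))) => [z|[[a b] z]].
    exact: preserving_shear2_fst.
  by rewrite lin_act_transvection /coords !mxE /= !mulr0 !addr0 mulr1.
- apply: (@preserving_snd (fun p => c * p.2)) => -[[a b] z].
  by rewrite lin_act_transvection /coords !mxE /= !mulr0 !addr0 mulr1.
- apply: (@preserving_fst (fun z p => ((p.1 + c * z : mR), p.2))) => [z|[[a b] z]].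
    exact: preserving_trans2_fst.
  by rewrite lin_act_transvection /coords !mxE /= !mulr0 !addr0 mulr1.
- apply: (@preserving_fst (fun z p => (p.1, (p.2 + c * z : mR)))) => [z|[[a b] z]].
    exact: preserving_trans2_snd.
  by rewrite lin_act_transvection /coords !mxE /= !mulr0 !addr0 mulr1.
Qed.

Lemma preserving_SL3 phi : \det phi = 1 -> preserving (@leb3 R) (lin_act phi).
Proof.
apply: (@SL3_transvections _ (fun phi => preserving (@leb3 R) (lin_act phi))).
- rewrite (_ : lin_act 1%:M = id); first exact: preserving_id.
  by apply/funext => p; rewrite /lin_act mulmx1 v3K.
- by move=> A B hA hB; rewrite lin_act_mul; exact: preserving_comp.
- by move=> i j c; exact: preserving_transvection.
Qed.

End LebesgueSpace.

(** * Support functions of the moment bodies *)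

Section MomentBodies.
Variable R : realType.
Implicit Types (K P : set (vec R)) (x y : vec R).
Local Notation mR := (measurableTypeR R).
Local Notation leb := (@lebesgue_measure R).
Local Notation T3 := ((mR * mR) * mR)%type.

HB.instance Definition _ := Measure.copy (@leb3 R) (@leb2 R \x leb)%E.

Definition ptset K : set T3 := [set p | K (v3 p)].

Definition kernel x : T3 -> \bar R := fun p => (Num.max (dot x (v3 p)) 0)%:E.

Definition moment K x : \bar R := (\int[@leb3 R]_(p in ptset K) kernel x p)%E.

Lemma hMplusE K x : hMplus K x = fine (moment K x).
Proof. by []. Qed.

Lemma hMminusE K x : hMminus K x = hMplus K (- x).
Proof. by rewrite /hMminus /hMplus; congr fine; apply: eq_integral => p _; rewrite dotNl. Qed.

Lemma dot_v3_measurable x : measurable_fun setT (fun p : T3 => (dot x (v3 p) : mR)).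
Proof.
rewrite (_ : (fun p : T3 => _) = fun p : T3 =>
    x ord0 o0 * p.1.1 + x ord0 o1 * p.1.2 + x ord0 o2 * p.2).
  exact: linear_measurable.
by apply/funext => p; rewrite dotE !mxE.
Qed.

Lemma kernel_measurable x D : measurable_fun D (kernel x).
Proof.
apply: (@measurable_funS _ _ _ _ setT) => //.
apply/measurable_EFinP; apply: measurable_maxr; first exact: dot_v3_measurable.
exact: measurable_cst.
Qed.

Lemma kernel_ge0 x p : (0 <= kernel x p)%E.
Proof. by rewrite lee_fin le_max lexx orbT. Qed.

Lemma ptset_halfspace u c : measurable (ptset [set y | dot u y <= c]).
Proof.
have := dot_v3_measurable u measurableT (measurable_itv `]-oo, c]).
by rewrite setTI; congr measurable; apply/seteqP; split=> p /=; rewrite in_itv.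
Qed.

Lemma ptset_measurable P : polytope_o P -> measurable (ptset P).
Proof.
move=> /polytope_hrep [L [LP _]].
rewrite (_ : ptset P = ptset (poly_sys L)); last first.
  by apply/seteqP; split=> p; rewrite /ptset /= LP.
elim: L {LP} => [|[u c] L IH].
  rewrite (_ : ptset _ = setT); first exact: measurableT.
  by apply/seteqP; split=> p.
rewrite (_ : ptset _ = ptset [set y | dot u y <= c] `&` ptset (poly_sys L)).
  by apply: measurableI => //; exact: ptset_halfspace.
apply/seteqP; split=> p /=.
  move=> h; split; first by have := h (u, c) (mem_head _ _).
  by move=> q qL; apply: h; rewrite inE qL orbT.
by move=> [h1 h2] q; rewrite inE => /orP[/eqP ->|/h2].
Qed.

Definition box (a b : R) : set T3 := (`[a, b] `*` `[a, b]) `*` `[a, b].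

Lemma box_measurable a b : measurable (box a b).
Proof. by apply: measurableX => //; apply: measurableX. Qed.

Lemma box_measure a b : a < b -> @leb3 R (box a b) = (((b - a) * (b - a)) * (b - a))%:E.
Proof.
move=> ab; have mI : measurable (`[a, b]%classic : set mR) by exact: measurable_itv.
have e1 : leb `[a, b]%classic = (b - a)%:E.
  by rewrite lebesgue_measure_itv /= lte_fin ab.
have e2 : (leb \x leb)%E (`[a, b] `*` `[a, b]) = (leb `[a, b]%classic * leb `[a, b]%classic)%E.
  exact: (product_measure1E leb leb mI mI).
have e3 : @leb3 R (box a b) = ((leb \x leb)%E (`[a, b] `*` `[a, b]) * leb `[a, b]%classic)%E.
  exact: (product_measure1E (@leb2 R) leb (measurableX mI mI) mI).
by rewrite e3 e2 e1 -!EFinM.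
Qed.

Lemma bdd_box K : bdd K -> exists2 M, 0 < M & ptset K `<=` box (- M) M.
Proof.
move=> bK.
have cb j : exists c, forall y, K y -> - c <= y ord0 j <= c.
  have [c hc] := bK (bvec R j); have [c' hc'] := bK (- bvec R j).
  exists (Num.max c c') => y Ky; have := hc y Ky; have := hc' y Ky.
  have -> : dot (bvec R j) y = y ord0 j.
    rewrite /dot (bigD1 j) //= mxE !eqxx mul1r big1 ?addr0 // => i ij.
    by rewrite mxE (negbTE ij) andbF mul0r.
  rewrite dotNl.
  have -> : dot (bvec R j) y = y ord0 j.
    rewrite /dot (bigD1 j) //= mxE !eqxx mul1r big1 ?addr0 // => i ij.
    by rewrite mxE (negbTE ij) andbF mul0r.
  by move=> h1 h2; rewrite lerNl !le_max h1 h2 orbT.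
have [c0 h0] := cb o0; have [c1 h1] := cb o1; have [c2 h2] := cb o2.
pose M := 1 + `|c0| + `|c1| + `|c2|.
have n0 := normr_ge0 c0; have n1 := normr_ge0 c1; have n2 := normr_ge0 c2.
have l0 := ler_norm c0; have l1 := ler_norm c1; have l2 := ler_norm c2.
exists M; first by rewrite /M; lra.
move=> p /= Kp; have := h0 _ Kp; have := h1 _ Kp; have := h2 _ Kp; rewrite !mxE /=.
move=> /andP[a0 a1] /andP[a2 a3] /andP[a4 a5].
by split; [split|]; rewrite /= in_itv /= /M; apply/andP; split; lra.
Qed.

Lemma moment_ge0 K x : (0 <= moment K x)%E.
Proof. by apply: integral_ge0 => p _; exact: kernel_ge0. Qed.

(** Finiteness matters because [fine] sends infinite values to 0. The kernel is bounded on [P],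
    which lies in a box. *)
Lemma moment_fin P x : polytope_o P -> moment P x \is a fin_num.
Proof.
move=> hP; rewrite ge0_fin_numE ?moment_ge0 //.
have [M M0 PM] := bdd_box (polytope_bdd hP).
have [c hc] := polytope_bdd hP x.
have mP := ptset_measurable hP.
have c0 : 0 <= c by have := hc 0 hP.2; rewrite dotC dot0l.
have h1 : (moment P x <= \int[@leb3 R]_(p in ptset P) cst c%:E p)%E.
  apply: ge0_le_integral => //; first by move=> p _; exact: kernel_ge0.
    exact: kernel_measurable.
  by move=> p Pp; rewrite lee_fin ge_max c0 andbT; exact: hc.
apply: (le_lt_trans h1); rewrite integral_cst //.
apply: (@le_lt_trans _ _ (c%:E * @leb3 R (box (- M) M))%E).
  apply: lee_wpmul2l; first by rewrite lee_fin.
  by apply: le_measure; rewrite ?inE //; exact: box_measurable.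
by rewrite box_measure ?ltry //; lra.
Qed.

Lemma hMplus_ge0 K x : 0 <= hMplus K x.
Proof. by rewrite hMplusE fine_ge0 // moment_ge0. Qed.

Lemma hMplus_sublin P : polytope_o P -> sublin (hMplus P).
Proof.
move=> hP; have mP := ptset_measurable hP; split=> [x y|c x c0].
  rewrite !hMplusE -lee_fin EFinD !fineK ?moment_fin //.
  rewrite /moment; have g0 z p : ptset P p -> (0 <= kernel z p)%E by move=> _; exact: kernel_ge0.
  have H := ge0_integralD (@leb3 R) mP (g0 x) (@kernel_measurable _ _)
              (g0 y) (@kernel_measurable _ _).
  rewrite -[leRHS]H.
  apply: ge0_le_integral => //.
  - by move=> p _; exact: kernel_ge0.
  - exact: kernel_measurable.
  - by apply: emeasurable_funD; exact: kernel_measurable.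
  move=> p _; rewrite /kernel -EFinD lee_fin dotDl ge_max; apply/andP; split.
    by apply: lerD; rewrite le_max lexx.
  by apply: addr_ge0; rewrite le_max lexx orbT.
rewrite !hMplusE; have -> : moment P (c *: x) = (c%:E * moment P x)%E.
  have g0 p : ptset P p -> (0 <= kernel x p)%E by move=> _; exact: kernel_ge0.
  have H := ge0_integralZl_EFin (@leb3 R) mP g0 (@kernel_measurable _ _) c0.
  rewrite /moment -[RHS]H.
  by apply: eq_integral => p _; rewrite /kernel -EFinM dotZl maxr_pMr // mulr0.
by rewrite fineM // moment_fin.
Qed.

Lemma moment_split K L x : measurable (ptset K) -> measurable (ptset L) ->
  (moment (K `|` L) x + moment (K `&` L) x = moment K x + moment L x)%E.
Proof.
move=> mK mL.
have mD : measurable (ptset L `\` ptset K) by exact: measurableD.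
have mI : measurable (ptset L `&` ptset K) by exact: measurableI.
rewrite /moment.
rewrite (_ : ptset (K `|` L) = ptset K `|` (ptset L `\` ptset K)); last first.
  by rewrite setUDr; apply/seteqP; split=> p /=; rewrite /ptset /=; tauto.
rewrite (_ : ptset (K `&` L) = ptset L `&` ptset K); last by rewrite setIC.
rewrite -[in RHS](setUIDK (ptset L) (ptset K)).
have g0 (A : set T3) p : A p -> (0 <= kernel x p)%E by move=> _; exact: kernel_ge0.
rewrite ge0_integral_setU //; [|exact: kernel_measurable|exact: g0|].
  rewrite ge0_integral_setU //; [|exact: kernel_measurable|exact: g0|].
    by rewrite -addeA [X in (_ + X)%E]addeC.
  by apply/disj_setPS => p [[_ a] [_ b]].
by apply/disj_setPS => p [a [_ b]].
Qed.

Lemma hMplus_cut x : cut_additive (fun P => hMplus P x).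
Proof.
apply: valuation_cut => K L hK hL hU hI; rewrite !hMplusE -!fineD ?moment_fin //.
by rewrite moment_split //; exact: ptset_measurable.
Qed.

Lemma linimg_ptset (phi psi : 'M[R]_3) K : phi *m psi = 1%:M -> psi *m phi = 1%:M ->
  ptset (linimg phi K) = lin_act psi @^-1` ptset K.
Proof.
move=> e1 e2; apply/seteqP; split=> p /=; rewrite /ptset /= coordsK.
  by move=> [a Ka <-]; rewrite -mulmxA e1 mulmx1.
by move=> h; exists (v3 p *m psi) => //; rewrite -mulmxA e2 mulmx1.
Qed.

(** Change of variables by the inverse map, which preserves volume. *)
Lemma hMplus_covariant (phi : 'M[R]_3) P x : \det phi = 1 -> polytope_o P ->
  hMplus (linimg phi P) x = hMplus P (x *m phi^T).
Proof.
move=> d1 hP; have mP := ptset_measurable hP.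
have u : phi \in unitmx by rewrite unitmxE d1 unitr1.
have [mf pf] : preserving (@leb3 R) (lin_act (invmx phi)).
  by apply: preserving_SL3; rewrite det_inv d1 invr1.
rewrite !hMplusE /moment (linimg_ptset P (mulmxV u) (mulVmx u)); congr fine.
have -> : (\int[@leb3 R]_(p in ptset P) kernel (x *m phi^T) p =
    \int[pushforward (@leb3 R) (lin_act (invmx phi))]_(p in ptset P) kernel (x *m phi^T) p)%E.
  by apply: eq_measure_integral => A mA _; apply/esym; exact: pf.
rewrite ge0_integral_pushforward //; last first.
- by move=> p _; exact: kernel_ge0.
- exact: kernel_measurable.
apply: eq_integral => p _; rewrite /kernel /= coordsK -dot_mulmx -mulmxA mulVmx //.
by rewrite mulmx1.
Qed.

(** The sections in the last coordinate are contained in [{0}], a null set. *)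
Lemma hMplus_flat P x : polytope_o P -> (forall y, P y -> y ord0 o2 = 0) -> hMplus P x = 0.
Proof.
move=> hP h0; have mP := ptset_measurable hP; rewrite hMplusE /moment null_set_integral //.
  exact: kernel_measurable.
rewrite /leb3 /product_measure1; apply: integral0_eq => p _ /=.
apply/eqP; rewrite eq_le measure_ge0 andbT -(lebesgue_measure_set1 (0 : R)).
apply: le_measure; rewrite ?inE //; first exact: measurable_xsection.
by move=> z; rewrite /xsection /= inE => /h0; rewrite !mxE.
Qed.

Lemma hMplus_eq0 P x : (forall y, P y -> dot x y <= 0) -> hMplus P x = 0.
Proof.
move=> h; rewrite hMplusE /moment integral0_eq // => p Pp.
by rewrite /kernel max_r //; exact: h.
Qed.

Lemma hMplus_gt0 P x a b e : polytope_o P -> a < b -> 0 < e ->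
  (forall y, (forall i, a <= y ord0 i <= b) -> P y /\ e <= dot x y) -> 0 < hMplus P x.
Proof.
move=> hP ab e0 h; have mP := ptset_measurable hP; have mB := box_measurable a b.
have hB p : box a b p -> P (v3 p) /\ e <= dot x (v3 p).
  move=> [[/= p0 p1] p2]; apply: h; apply: ord3P; rewrite !mxE /=.
  - by move: p0; rewrite in_itv.
  - by move: p1; rewrite in_itv.
  - by move: p2; rewrite in_itv.
have : (e%:E * @leb3 R (box a b) <= moment P x)%E.
  rewrite -integral_cst //.
  apply: (@le_trans _ _ (\int[@leb3 R]_(p in box a b) kernel x p)%E).
    apply: ge0_le_integral => //.
    - by move=> p _; rewrite lee_fin ltW.
    - exact: kernel_measurable.
    - by move=> p /hB[_ ?]; rewrite lee_fin le_max; apply/orP; left.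
  apply: ge0_subset_integral => //.
  - exact: kernel_measurable.
  - by move=> p _; exact: kernel_ge0.
  - by move=> p /hB[].
rewrite box_measure // -EFinM -(fineK (moment_fin x hP)) lee_fin -hMplusE; apply: lt_le_trans.
by rewrite !mulr_gt0 // subr_gt0.
Qed.

End MomentBodies.

(** * Covariant functionals on simplices *)

Section LinearImages.
Variable R : realType.
Implicit Types (A K P F : set (vec R)) (x y u v : vec R) (phi psi : 'M[R]_3).

Lemma linimgK phi psi A : phi *m psi = 1%:M -> linimg psi (linimg phi A) = A.
Proof.
move=> e; apply/seteqP; split=> [_ [_ [y Ay <-] <-]|y Ay].
  by rewrite -mulmxA e mulmx1.
by exists (y *m phi); [exists y|rewrite -mulmxA e mulmx1].
Qed.

Lemma linimg_inj phi psi A A' : phi *m psi = 1%:M -> linimg phi A = linimg phi A' -> A = A'.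
Proof. by move=> e h; rewrite -(linimgK A e) h linimgK. Qed.

Lemma linimg_sub phi A A' : A `<=` A' -> linimg phi A `<=` linimg phi A'.
Proof. by move=> s _ [y Ay <-]; exists y => //; exact: s. Qed.

Lemma linimg_convex phi A : convex A -> convex (linimg phi A).
Proof.
move=> cA _ _ t [a Aa <-] [b Ab <-] t01; exists ((1 - t) *: a + t *: b); first exact: cA.
by rewrite mulmxDl -!scalemxAl.
Qed.

Lemma linimg_bdd phi A : bdd A -> bdd (linimg phi A).
Proof.
move=> bA x; have [c hc] := bA (x *m phi^T).
by exists c => _ [a Aa <-]; rewrite dot_mulmx; exact: hc.
Qed.

Lemma linimg_conv phi (s : seq (vec R)) : linimg phi (conv s) = conv [seq v *m phi | v <- s].
Proof.
apply/seteqP; split=> [_ [y sy <-]|].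
  have c : convex [set z | conv [seq v *m phi | v <- s] (z *m phi)].
    move=> a b t ca cb t01 /=; rewrite mulmxDl -!scalemxAl; exact: conv_convex.
  by apply: (conv_sub c) sy => v vs; apply: conv_mem; exact: map_f.
apply: conv_sub; first by apply: linimg_convex; exact: conv_convex.
by move=> _ /mapP[v vs ->]; exists v => //; exact: conv_mem.
Qed.

Lemma linimg_polytope phi P : polytope_o P -> polytope_o (linimg phi P).
Proof.
move=> [[s ->] P0]; split; first by rewrite linimg_conv; eexists.
by exists 0 => //; rewrite mul0mx.
Qed.

Section Invertible.
Variables phi psi : 'M[R]_3.
Hypotheses (e1 : phi *m psi = 1%:M) (e2 : psi *m phi = 1%:M).

Lemma affdim_ge_linimg A k : affdim_ge A k -> affdim_ge (linimg phi A) k.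
Proof.
move=> [p [M [Ap [AM fM]]]]; exists (p *m phi), (M *m phi); split; first by exists p.
have uphi : phi \in unitmx by case/mulmx1_unit: e1.
split; first by move=> i; exists (p + row i M) => //; rewrite mulmxDl row_mul.
by rewrite /row_free mxrankMfree // row_free_unit.
Qed.

Lemma face_linimg P F : face P F -> face (linimg phi P) (linimg phi F).
Proof.
move=> [u [u0 ->]]; exists (u *m psi^T); split.
  apply: contraNneq u0 => h; rewrite -(mulmx1 u) -trmx1 -e1 trmx_mul mulmxA h mul0mx //.
have ds y : dot (u *m psi^T) (y *m phi) = dot u y.
  by rewrite dot_mulmx -mulmxA -trmx_mul e1 trmx1 mulmx1.
have ss : supp (linimg phi P) (u *m psi^T) = supp P u.
  by rewrite supp_linimg -mulmxA -trmx_mul e1 trmx1 mulmx1.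
apply/seteqP; split=> [_ [y [Py e] <-]|_ [[y Py <-]]]; last first.
  by rewrite ds ss => h; exists y.
by split; [exists y|rewrite ds ss].
Qed.
End Invertible.

Lemma affdim_eq_linimg phi psi A k : phi *m psi = 1%:M -> psi *m phi = 1%:M ->
  affdim_eq A k -> affdim_eq (linimg phi A) k.
Proof.
move=> e1 e2 [h1 h2]; split; first exact: affdim_ge_linimg e1 _ _ h1.
by move=> /(affdim_ge_linimg e2); rewrite (linimgK _ e1).
Qed.

Lemma facets_linimg phi psi P : phi *m psi = 1%:M -> psi *m phi = 1%:M ->
  facets_o (linimg phi P) = [set linimg phi F | F in facets_o P].
Proof.
move=> e1 e2; have H f g A F : f *m g = 1%:M -> g *m f = 1%:M ->
    facets_o A F -> facets_o (linimg f A) (linimg f F).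
  move=> f1 f2 [fF [dF F0]]; split; first exact: face_linimg f1 _ _ fF.
  by split; [exact: affdim_eq_linimg f1 f2 dF|exists 0 => //; rewrite mul0mx].
apply/seteqP; split=> [F hF|_ [F hF <-]]; last exact: H e1 e2 hF.
exists (linimg psi F); last by rewrite linimgK.
by rewrite -(linimgK P e1); exact: H e2 e1 hF.
Qed.

Lemma edges_linimg phi psi P : phi *m psi = 1%:M -> psi *m phi = 1%:M ->
  edges_o (linimg phi P) = [set linimg phi F | F in edges_o P].
Proof.
move=> e1 e2; have H f g A F : f *m g = 1%:M -> g *m f = 1%:M ->
    edges_o A F -> edges_o (linimg f A) (linimg f F).
  move=> f1 f2 [fF [dF F0]]; split; first exact: face_linimg f1 _ _ fF.
  by split; [exact: affdim_eq_linimg f1 f2 dF|exists 0 => //; rewrite mul0mx].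
apply/seteqP; split=> [F hF|_ [F hF <-]]; last exact: H e1 e2 hF.
exists (linimg psi F); last by rewrite linimgK.
by rewrite -(linimgK P e1); exact: H e2 e1 hF.
Qed.

Lemma gsum_linimg phi P x : phi \in unitmx -> gsum (linimg phi P) x = gsum P (x *m phi^T).
Proof.
move=> u; have e1 := mulmxV u; have e2 := mulVmx u.
have dE k : `[< affdim_ge (linimg phi P) k >] = `[< affdim_ge P k >].
  apply/asboolP/asboolP; last exact: affdim_ge_linimg e1 _ _.
  by move/(affdim_ge_linimg e2); rewrite (linimgK _ e1).
rewrite /gsum !dE supp_linimg (facets_linimg _ e1 e2) (edges_linimg _ e1 e2).
have sE (S : set (set (vec R))) : \sum_(F \in [set linimg phi F | F in S]) supp F x =
    \sum_(F \in S) supp F (x *m phi^T).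
  rewrite fsbig_image; first by apply: eq_fsbigr => F _; rewrite supp_linimg.
  by move=> F F' _ _; exact: linimg_inj e1.
by rewrite !sE.
Qed.

Lemma hD_linimg a1 a2 b1 b2 phi P x : phi \in unitmx ->
  hD a1 a2 b1 b2 (linimg phi P) x = hD a1 a2 b1 b2 P (x *m phi^T).
Proof. by move=> u; rewrite !hD_gsum !gsum_linimg // !supp_linimg mulNmx. Qed.

End LinearImages.

(** * Segments and the standard triangle *)

Section SmallFaces.
Variable R : realType.
Implicit Types (x y u v : vec R).

Lemma supp_seg v x : supp (conv [:: 0; v]) x = Num.max 0 (dot x v).
Proof.
have [h|h] := leP 0 (dot x v).
  apply: supp_eq; first by apply: conv_mem; rewrite !inE eqxx orbT.
  by apply: conv_le => w; rewrite !inE => /orP[]/eqP -> //; rewrite dot0r.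
rewrite -(dot0r x); apply: supp_eq; first by apply: conv_mem; rewrite inE eqxx.
by apply: conv_le => w; rewrite !inE => /orP[]/eqP -> //; rewrite dot0r ltW.
Qed.

Lemma polytope_seg s : polytope_o (conv (0 :: s : seq (vec R))).
Proof. by split; [eexists|apply: conv_mem; rewrite inE eqxx]. Qed.

Lemma seg_line v y : conv [:: 0; v] y -> exists t, y = t *: v.
Proof.
have c : convex [set y | exists t, y = t *: v].
  move=> a b t [p ->] [q ->] _; exists ((1 - t) * p + t * q).
  by rewrite [RHS]scalerDl !scalerA.
apply: (conv_sub c) => w; rewrite !inE => /orP[]/eqP ->; first by exists 0; rewrite scale0r.
by exists 1; rewrite scale1r.
Qed.

Lemma gsum_seg v x : gsum (conv [:: 0; v]) x = 0.
Proof.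
have sg := @seg_line v.
have d2 : ~ affdim_ge (conv [:: 0; v]) 2.
  move=> /(affdim2P (polytope_seg [:: v]).2) [a [b [/sg[s ->] /sg[t ->]]]].
  by rewrite crossZl crossZr crossxx !scaler0 eqxx.
rewrite /gsum (asboolF d2) asboolF // => /(affdim3P (polytope_seg [:: v]).2) [a [b [c [/sg[s ->] /sg[t ->] _]]]].
by rewrite /det3 crossZl crossZr crossxx !scaler0 dot0l eqxx.
Qed.

Local Notation e0 := (bvec R o0).
Local Notation e1 := (bvec R o1).

Lemma affdim_eq_seg v : v != 0 -> affdim_eq (conv [:: 0; v]) 1.
Proof.
move=> v0; have z := (polytope_seg [:: v]).2; split.
  by apply/(affdim1P z); exists v => //; apply: conv_mem; rewrite !inE eqxx orbT.
have sg := @seg_line v.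
move=> /(affdim2P z) [a [b [/sg[s ->] /sg[t ->]]]].
by rewrite crossZl crossZr crossxx !scaler0 eqxx.
Qed.

Lemma dot_bvec u i : dot u (bvec R i) = u ord0 i.
Proof.
rewrite /dot (bigD1 i) //= mxE !eqxx mulr1 big1 ?addr0 // => j ij.
by rewrite mxE (negbTE ij) andbF mulr0.
Qed.

Lemma bvec_neq0 i : bvec R i != 0.
Proof.
by apply/eqP => /rowP/(_ i); rewrite !mxE !eqxx => /eqP; rewrite oner_eq0.
Qed.

Definition triangle : set (vec R) := conv [:: 0; e0; e1].

(** A supporting plane at the origin selects those of [e0], [e1] at which [u] vanishes; dimension 1
    means that exactly one is selected. *)
Lemma edges_triangle : edges_o triangle = [set conv [:: 0; e0]] `|` [set conv [:: 0; e1]].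
Proof.
have hT : polytope_o triangle by exact: polytope_seg.
apply/seteqP; split=> E.
  move=> /(edges_oP _ hT) [u [u0 np -> [d1 d2]]].
  have n0 : u ord0 o0 <= 0 by rewrite -dot_bvec; apply: np; apply: conv_mem; rewrite !inE eqxx orbT.
  have n1 : u ord0 o1 <= 0 by rewrite -dot_bvec; apply: np; apply: conv_mem; rewrite !inE eqxx !orbT.
  have := slice_conv hT np; rewrite /= dot0r eqxx !dot_bvec.
  case: eqP => z0; case: eqP => z1 sE.
  - exfalso; apply: d2; apply/affdim2P; first by rewrite sE; apply: conv_mem; rewrite inE eqxx.
    exists e0, e1; split.
    + by rewrite sE; apply: conv_mem; rewrite !inE eqxx orbT.
    + by rewrite sE; apply: conv_mem; rewrite !inE eqxx !orbT.
    apply/eqP => /rowP /(_ o2); rewrite !mxE /= => /eqP.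
    by rewrite !(mul0r, mulr1, subr0) oner_eq0.
  - by left.
  - by right.
  - exfalso; move: d1; rewrite -/(slice _ _) sE => /(affdim1P (polytope_seg [::]).2) [e he]; case/eqP.
    have c : convex [set y : vec R | y = 0].
      by move=> a b t /= -> -> _; rewrite !scaler0 addr0.
    by apply: (conv_sub c) he => w; rewrite inE => /eqP.
have cj (i : 'I_3) : (i = o0 \/ i = o1) -> edges_o triangle (conv [:: 0; bvec R i]).
  move=> i01; apply/(edges_oP _ hT).
  pose u : vec R := - (if i == o0 then e1 else e0).
  have np : nonpos triangle u.
    move=> y; apply: conv_le => v; rewrite !inE => /or3P[]/eqP ->; rewrite ?dot0r //.
      by rewrite dot_bvec /u; case: ifP => _; rewrite !mxE /= ?oppr0 // oppr_le0 ler01.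
    by rewrite dot_bvec /u; case: ifP => _; rewrite !mxE /= ?oppr0 // oppr_le0 ler01.
  exists u; split => //.
  - by rewrite /u oppr_eq0; case: ifP => _; exact: bvec_neq0.
  - rewrite slice_conv //= dot0r eqxx !dot_bvec /u; case: i01 => ->; rewrite /= !mxE /=.
      by rewrite oppr0 eqxx oppr_eq0 oner_eq0.
    by rewrite oppr0 eqxx oppr_eq0 oner_eq0.
  - by apply: affdim_eq_seg; exact: bvec_neq0.
by case=> ->; apply: cj; [left|right].
Qed.

Lemma gsum_triangle x : gsum triangle x =
  2 * supp triangle x - (Num.max 0 (x ord0 o0) + Num.max 0 (x ord0 o1)).
Proof.
have z := (polytope_seg [:: e0; e1]).2.
have d2 : affdim_ge triangle 2.
  apply/(affdim2P z); exists e0, e1; split.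
  - by apply: conv_mem; rewrite !inE eqxx orbT.
  - by apply: conv_mem; rewrite !inE eqxx !orbT.
  apply/eqP => /rowP /(_ o2); rewrite !mxE /= => /eqP.
  by rewrite !(mul0r, mulr1, subr0) oner_eq0.
have d3 : ~ affdim_ge triangle 3.
  move=> /(affdim3P z) [a [b [c [ha hb hc]]]]; case/eqP.
  have pl y : triangle y -> y ord0 o2 = 0.
    move=> hy; rewrite -dot_bvec dotC.
    have h1 : dot (bvec R o2) y <= 0.
      by apply: conv_le hy => v; rewrite !inE => /or3P[]/eqP ->; rewrite ?dot0r // dot_bvec mxE.
    have h2 : dot (- bvec R o2) y <= 0.
      by apply: conv_le hy => v; rewrite !inE => /or3P[]/eqP ->;
         rewrite ?dot0r // dotNl dot_bvec mxE /= oppr0.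
    by apply/eqP; rewrite eq_le h1 /= -oppr_le0 -dotNl.
  by rewrite det3E !pl //; ring.
rewrite /gsum (asboolF d3) (asboolT d2) edges_triangle; congr (_ - _).
rewrite fsbigU0 //; last first.
  move=> E [/= e1E e2E].
  have : conv [:: 0; e1] e0.
    by rewrite -[X in X _]e2E e1E; apply: conv_mem; rewrite !inE eqxx orbT.
  have h : forall y, conv [:: 0; e1] y -> dot e0 y <= 0.
    by apply: conv_le => v; rewrite !inE => /orP[]/eqP ->; rewrite ?dot0r // dot_bvec mxE.
  by move=> /h; rewrite dot_bvec mxE /= ler10.
by rewrite !fsbig_set1 !supp_seg !dot_bvec.
Qed.

Lemma supp_triangle x i : (i = o0 \/ i = o1) -> 0 <= x ord0 i ->
  x ord0 o0 <= x ord0 i -> x ord0 o1 <= x ord0 i -> supp triangle x = x ord0 i.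
Proof.
move=> i01 h h0 h1; rewrite -dot_bvec; apply: supp_eq.
  by apply: conv_mem; case: i01 => ->; rewrite !inE eqxx ?orbT.
by apply: conv_le => v; rewrite !inE => /or3P[]/eqP ->; rewrite ?dot0r // !dot_bvec.
Qed.

Lemma supp_triangle_neg x : x ord0 o0 <= 0 -> x ord0 o1 <= 0 -> supp triangle x = 0.
Proof.
move=> h0 h1; rewrite -(dot0r x); apply: supp_eq; first exact: (polytope_seg [:: e0; e1]).2.
by apply: conv_le => v; rewrite !inE => /or3P[]/eqP ->; rewrite ?dot0r // !dot_bvec.
Qed.

End SmallFaces.

(** * Splitting simplices *)

Section Splitting.
Variable R : realType.
Implicit Types (x y u v w m : vec R) (B : 'I_3 -> vec R) (z : set (vec R) -> R).

Definition B3 u v w (i : 'I_3) : vec R := if i == o0 then u else if i == o1 then v else w.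

Lemma basis_B3 u v w : det3 u v w != 0 -> basis (B3 u v w).
Proof.
move=> d; exists (fun i => (det3 u v w)^-1 *: B3 (cross v w) (cross w u) (cross u v) i).
have cx a b c : dot (cross a b) c = det3 a b c by [].
have d1 : det3 v w u = det3 u v w by rewrite -det3_rot.
have d2 : det3 w u v = det3 u v w by rewrite det3_rot.
have z1 a b : det3 a b a = 0 by rewrite det3E; ring.
have z2 a b : det3 a b b = 0 by rewrite det3E; ring.
by apply: ord3P; apply: ord3P; rewrite /B3 /= dotZl cx ?z1 ?z2 ?d1 ?d2 ?mulr0 ?mulVf.
Qed.

Lemma basis_det3 B : basis B -> det3 (B o0) (B o1) (B o2) != 0.
Proof.
move=> [D BD]; apply/eqP => d0.
pose MB : 'M[R]_3 := \matrix_i B i; pose MD : 'M[R]_3 := \matrix_i D i.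
have e : MD *m MB^T = 1%:M.
  apply/matrixP => i j; rewrite !mxE -BD /dot; apply: eq_bigr => k _.
  by rewrite !mxE.
have [_ uB] := mulmx1_unit e; move: uB; rewrite unitmx_tr unitmxE unitfE det_det3 !rowK.
by rewrite d0 eqxx.
Qed.

(** [l] equals 1 on the generators and on [w], so the cone and all its pieces are truncated by the
    same plane. *)
Lemma simplex_split z B (I : 'I_3 -> bool) i j (t : R) : cut_additive z -> basis B ->
  I i -> I j -> i != j -> 0 < t < 1 -> let w := (1 - t) *: B i + t *: B j in
  z (simplex B I) + z (simplex (upd B j w) (fun k => I k && (k != i))) =
  z (simplex (upd B j w) I) + z (simplex (upd B i w) I).
Proof.
move=> zc bB Ii Ij ij /andP[t0 t1] w.
have s0 : 0 < 1 - t by rewrite subr_gt0.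
have [_ _ [m [c1 c2 c3]]] := edge_split bB Ii Ij ij s0 t0; rewrite -/w in c1 c2 c3.
have [D BD] := bB; pose l := D o0 + D o1 + D o2.
have lB k : dot l (B k) = 1.
  rewrite /l !dotDl !BD; move: k; apply: ord3P; rewrite /=; ring.
have lw : dot l w = 1 by rewrite /w dotDr !dotZr !lB; ring.
have lu k i' : dot l (upd B k w i') = 1 by rewrite /upd; case: ifP.
have := zc (simplex B I) m (simplex_polytope B I).
rewrite (@simplexE _ B I l) // (@simplexE _ (upd B j w) I l) //.
rewrite (@simplexE _ (upd B i w) I l) // (@simplexE _ (upd B j w) _ l) //.
by rewrite -c1 -c2 -c3 ![_ `&` _ `&` [set x | dot l x <= 1]]setIAC.
Qed.

Lemma tet_split z u v w (t : R) : cut_additive z -> det3 u v w != 0 -> 0 < t < 1 ->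
  let m := (1 - t) *: u + t *: v in
  z (conv [:: 0; u; v; w]) + z (conv [:: 0; m; w]) =
  z (conv [:: 0; u; m; w]) + z (conv [:: 0; m; v; w]).
Proof.
move=> zc d t01 m.
exact: (@simplex_split z (B3 u v w) predT o0 o1 t zc (basis_B3 d) isT isT isT t01).
Qed.

Lemma tri_split z u v (t : R) : cut_additive z -> cross u v != 0 -> 0 < t < 1 ->
  let m := (1 - t) *: u + t *: v in
  z (conv [:: 0; u; v]) + z (conv [:: 0; m]) =
  z (conv [:: 0; u; m]) + z (conv [:: 0; m; v]).
Proof.
(* The cross product completes the two vectors to a basis, and [predC1 o2] leaves it out of the
   simplex. *)
move=> zc c t01 m; have d : det3 u v (cross u v) != 0 by rewrite /det3 gt_eqF // dot_gt0.
exact: (@simplex_split z (B3 u v _) (predC1 o2) o0 o1 t zc (basis_B3 d) isT isT isT t01).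
Qed.

End Splitting.

(** * Covariant functionals and their normal forms on simplices *)

Section Natural.
Variable R : realType.
Implicit Types (P : set (vec R)) (x y u v w d : vec R) (z : set (vec R) -> vec R -> R).

(** A difference of support functions is not sublinear; homogeneity and a Lipschitz bound in each
    direction are the traces of sublinearity that survive subtraction. *)
Record natural z : Prop := Natural {
  natural_cut : forall x, cut_additive (fun P => z P x);
  natural_cov : forall (phi : 'M[R]_3) P x, \det phi = 1 -> polytope_o P ->
    z (linimg phi P) x = z P (x *m phi^T);
  natural_homog : forall P c x, polytope_o P -> 0 <= c -> z P (c *: x) = c * z P x;
  natural_lip : forall P d, polytope_o P ->
    exists C, forall x t, 0 <= t -> `|z P (x + t *: d) - z P x| <= t * C }.

Lemma natural_lin z1 z2 c : natural z1 -> natural z2 ->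
  natural (fun P x => z1 P x + c * z2 P x).
Proof.
move=> [cut1 cov1 hom1 lip1] [cut2 cov2 hom2 lip2]; split.
- by move=> x; apply: cut_additiveD; last exact: cut_additiveZ.
- by move=> phi P x d1 hP; rewrite cov1 // cov2.
- by move=> P a x hP a0; rewrite hom1 // hom2 // mulrDr mulrCA.
move=> P d hP; have [C1 h1] := lip1 P d hP; have [C2 h2] := lip2 P d hP.
exists (C1 + `|c| * C2) => x t t0; have a1 := h1 x t t0; have a2 := h2 x t t0.
have -> : z1 P (x + t *: d) + c * z2 P (x + t *: d) - (z1 P x + c * z2 P x) =
  (z1 P (x + t *: d) - z1 P x) + c * (z2 P (x + t *: d) - z2 P x) by ring.
apply: (le_trans (ler_normD _ _)); rewrite [leRHS]mulrDr; apply: lerD => //.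
by rewrite normrM mulrCA; apply: ler_wpM2l.
Qed.

Lemma natural_opp z : natural z -> natural (fun P x => z P (- x)).
Proof.
move=> [cut cov hom lip]; split.
- by move=> x; exact: cut.
- by move=> phi P x d1 hP; rewrite cov // mulNmx.
- by move=> P c x hP c0; rewrite -scalerN hom.
move=> P d hP; have [C h] := lip P (- d) hP; exists C => x t t0.
by rewrite opprD -scalerN; exact: h.
Qed.

(** Subadditivity bounds the change along [t d] by [t] times the values at [d] and [- d]. *)
Lemma natural_sublin z : (forall x, cut_additive (fun P => z P x)) ->
  (forall (phi : 'M[R]_3) P x, \det phi = 1 -> polytope_o P ->
    z (linimg phi P) x = z P (x *m phi^T)) ->
  (forall P, polytope_o P -> sublin (z P)) -> natural z.
Proof.
move=> cut cov sub; split=> // [P c x hP c0|P d hP]; first by rewrite (sub P hP).2.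
have [sD sZ] := sub P hP; exists (`|z P d| + `|z P (- d)|) => x t t0.
have h1 := sD x (t *: d); have h2 := sD (x + t *: d) (t *: - d).
rewrite scalerN addrK -scalerN in h2; rewrite !sZ // in h1 h2.
have n1 := ler_norm (z P d); have n2 := ler_norm (z P (- d)).
have p1 := normr_ge0 (z P d); have p2 := normr_ge0 (z P (- d)).
have m1 : t * z P d <= t * (`|z P d| + `|z P (- d)|) by rewrite ler_wpM2l //; lra.
have m2 : t * z P (- d) <= t * (`|z P d| + `|z P (- d)|) by rewrite ler_wpM2l //; lra.
rewrite ler_norml; apply/andP; split; lra.
Qed.

Lemma natural_ext z z' : natural z -> (forall P x, z P x = z' P x) -> natural z'.
Proof.
move=> nz e; have -> : z' = z by apply/funext => P; apply/funext => x.
by [].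
Qed.

Lemma mulmx_mx3 x u v w : x *m (mx3 u v w)^T = mkv (dot x u) (dot x v) (dot x w).
Proof.
have [r0 r1 r2] := row_mx3 u v w.
have h i : (x *m (mx3 u v w)^T) ord0 i = dot x (row i (mx3 u v w)).
  by rewrite !mxE /dot; apply: eq_bigr => k _; rewrite !mxE.
by apply: vec_eq; rewrite h ?mkv0 ?mkv1 ?mkv2 ?r0 ?r1 ?r2.
Qed.

Lemma bvec_mulmx i (phi : 'M[R]_3) : bvec R i *m phi = row i phi.
Proof. by rewrite rowE. Qed.

Local Notation e0 := (bvec R o0).
Local Notation e1 := (bvec R o1).
Local Notation e2 := (bvec R o2).

(** Normal forms: by covariance the value on a simplex depends only on its determinant and on the
    products of [x] with its vertices. In [tet_fun] the entry [c / V] makes the product with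
    [V *: e2] equal to [c]. *)
Definition seg_fun z (a : R) := z (conv [:: 0; e0]) (mkv a 0 0).
Definition tri_fun z (a b : R) := z (conv [:: 0; e0; e1]) (mkv a b 0).
Definition tet_fun z (V a b c : R) := z (conv [:: 0; e0; e1; V *: e2]) (mkv a b (c / V)).

Section Values.
Variable z : set (vec R) -> vec R -> R.
Hypothesis nz : natural z.

Lemma mkvZ (c a0 a1 a2 : R) : c *: mkv a0 a1 a2 = mkv (c * a0) (c * a1) (c * a2).
Proof. by apply: vec_eq; rewrite !mxE. Qed.

Lemma mkv000 : mkv (0 : R) 0 0 = 0.
Proof. by apply: vec_eq; rewrite !mxE. Qed.

Lemma natural0 P : polytope_o P -> z P 0 = 0.
Proof. by move=> hP; rewrite -[0](scale0r (0 : vec R)) (natural_homog nz) // mul0r. Qed.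

Lemma natural_frame u v w x (s : seq (vec R)) : det3 u v w = 1 ->
  z (conv (0 :: [seq y *m mx3 u v w | y <- s])) x =
  z (conv (0 :: s)) (mkv (dot x u) (dot x v) (dot x w)).
Proof.
move=> d1; rewrite -mulmx_mx3 -(natural_cov nz) ?det_mx3 //; last exact: polytope_seg.
by rewrite linimg_conv /= mul0mx.
Qed.

Lemma tri_frame u v w x : det3 u v w = 1 ->
  z (conv [:: 0; u; v]) x = z (conv [:: 0; e0; e1]) (mkv (dot x u) (dot x v) (dot x w)).
Proof.
move=> d1; rewrite -(natural_frame x [:: e0; e1] d1) /= !bvec_mulmx.
by have [-> -> _] := row_mx3 u v w.
Qed.

Lemma seg_frame u v w x : det3 u v w = 1 ->
  z (conv [:: 0; u]) x = z (conv [:: 0; e0]) (mkv (dot x u) (dot x v) (dot x w)).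
Proof.
move=> d1; rewrite -(natural_frame x [:: e0] d1) /= !bvec_mulmx.
by have [-> _ _] := row_mx3 u v w.
Qed.

Lemma det3Zr u v w c : det3 u v (c *: w) = c * det3 u v w.
Proof. by rewrite /det3 dotZr. Qed.

Lemma det3_bvec : det3 e0 e1 e2 = 1.
Proof. by rewrite det3E !mxE /=; ring. Qed.

Lemma exists_orth x : x != 0 -> exists2 v, v != 0 & dot x v = 0.
Proof.
move=> x0; have [i xi] : exists i, cross x (bvec R i) != 0.
  apply: contrapT => h; case/eqP: x0; have c i : cross x (bvec R i) = 0.
    by apply: contrapT => /eqP hi; apply: h; exists i.
  have := c o0; have := c o1 => /rowP c1 /rowP c0.
  have := c1 o0; have := c1 o2; have := c0 o1; have := c0 o2; rewrite !mxE /=.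
  by rewrite ?(mulr0, mulr1, sub0r, subr0) => a1 a2 a3 a4; apply: vec_eq; rewrite !mxE; lra.
by exists (cross x (bvec R i)) => //; rewrite dotC dot_crossl.
Qed.

(** If [x.u] is nonzero, the frame is completed by vectors orthogonal to [x]. Otherwise a map of
    determinant 1 fixes the segment and doubles [x], so the value equals its double and vanishes. *)
Lemma seg_value u x : u != 0 -> z (conv [:: 0; u]) x = seg_fun z (dot x u).
Proof.
move=> u0; have [->|x0] := eqVneq x 0.
  by rewrite dot0l /seg_fun mkv000 !natural0 //; exact: polytope_seg.
have uu := dot_gt0 u0; have xx := dot_gt0 x0.
have [xu|xu] := eqVneq (dot x u) 0; last first.
  have [v v0 xv] := exists_orth x0.
  have vv := dot_gt0 v0.
  have d : det3 u v (cross x v) = dot v v * dot x u.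
    transitivity (dot v v * dot x u - dot u v * dot x v); last by rewrite xv mulr0 subr0.
    by rewrite !dotE det3E /cross !mkv0 !mkv1 !mkv2; ring.
  have dn0 : det3 u v (cross x v) != 0 by rewrite d mulf_neq0 // gt_eqF.
  rewrite (@seg_frame u v ((det3 u v (cross x v))^-1 *: cross x v)) ?det3Zr ?mulVf //.
  by rewrite xv dotZr [dot x (cross _ _)]dotC dot_crossl mulr0.
rewrite xu /seg_fun mkv000 natural0; last exact: polytope_seg.
have d : det3 u (cross x u) x = dot u u * dot x x.
  transitivity (dot u u * dot x x - dot x u * dot x u); last by rewrite xu mulr0 subr0.
  by rewrite !dotE det3E /cross !mkv0 !mkv1 !mkv2; ring.
have dn0 : det3 u (cross x u) x != 0 by rewrite d mulf_neq0 // gt_eqF.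
rewrite (@seg_frame u (cross x u) ((det3 u (cross x u) x)^-1 *: x)) ?det3Zr ?mulVf //.
rewrite xu [dot x (cross _ _)]dotC dot_crossl; move: (dot _ _) => c.
have d2 : det3 e0 (2^-1 *: e1) (2 *: e2) = 1 by rewrite det3E !mxE /=; field.
have := seg_frame (mkv 0 0 c) d2; rewrite !dotZr !dot_bvec mkv0 mkv1 mkv2 mulr0.
have -> : mkv 0 0 (2 * c) = 2 *: mkv 0 0 c by rewrite mkvZ mulr0.
rewrite (natural_homog nz) //; last exact: polytope_seg.
by lra.
Qed.

(** A shear along [u] or [v] removes the product of [x] with the third frame vector, unless [x] is
    orthogonal to both. Then bisection gives two triangles that maps of determinant 1 turn into the
    original one with [x] doubled, so the value is four times itself. *)
Lemma tri_value u v x : cross u v != 0 ->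
  z (conv [:: 0; u; v]) x = tri_fun z (dot x u) (dot x v).
Proof.
move=> c0; have cc := dot_gt0 c0.
have [w d1] : exists w, det3 u v w = 1.
  by exists ((dot (cross u v) (cross u v))^-1 *: cross u v); rewrite det3Zr mulVf // gt_eqF.
have [xu|xu] := eqVneq (dot x u) 0; last first.
  have d2 : det3 u v (w + (- (dot x w / dot x u)) *: u) = 1 by rewrite det3_add20.
  rewrite (tri_frame _ d2) /tri_fun; congr (z _ (mkv _ _ _)).
  by rewrite dotDr dotZr mulNr divfK // subrr.
have [xv|xv] := eqVneq (dot x v) 0; last first.
  have d2 : det3 u v (w + (- (dot x w / dot x v)) *: v) = 1 by rewrite det3_add21.
  rewrite (tri_frame _ d2) /tri_fun; congr (z _ (mkv _ _ _)).
  by rewrite dotDr dotZr mulNr divfK // subrr.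
rewrite (tri_frame _ d1) xu xv /tri_fun mkv000 natural0; last exact: polytope_seg.
move: (dot x w) => c.
have [mn0 m0] : (2^-1 *: e0 + 2^-1 *: e1 != 0 :> vec R) /\
    dot (mkv 0 0 c) (2^-1 *: e0 + 2^-1 *: e1) = 0.
  split; last by rewrite dotDr !dotZr !dot_bvec mkv0 mkv1 mulr0 addr0.
  apply/eqP => /rowP /(_ o0); rewrite !mxE /= => /eqP.
  by rewrite mulr1 mulr0 addr0 invr_eq0 pnatr_eq0.
have t12 : 0 < (2^-1 : R) < 1 by apply/andP; split; lra.
have h2 : 1 - 2^-1 = 2^-1 :> R by field.
have ce : cross e0 e1 != 0.
  by apply/eqP => /rowP /(_ o2); rewrite !mxE /= !(mul0r, mulr1, subr0) => /eqP; rewrite oner_eq0.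
have := tri_split (natural_cut nz (mkv 0 0 c)) ce t12; rewrite /= h2.
set m := _ + _ in mn0 m0 *.
have da : det3 e0 m (2 *: e2) = 1 by rewrite det3E /m !mxE /=; field.
have db : det3 m e1 (2 *: e2) = 1 by rewrite det3E /m !mxE /=; field.
rewrite (tri_frame _ da) (tri_frame _ db) seg_value // m0 dotZr !dot_bvec mkv0 mkv1 mkv2.
rewrite /seg_fun mkv000 natural0; last exact: polytope_seg.
have -> : mkv 0 0 (2 * c) = 2 *: mkv 0 0 c by rewrite mkvZ mulr0.
rewrite (natural_homog nz) //; last exact: polytope_seg.
by lra.
Qed.

Lemma tet_value u v w x : 0 < det3 u v w ->
  z (conv [:: 0; u; v; w]) x = tet_fun z (det3 u v w) (dot x u) (dot x v) (dot x w).
Proof.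
set V := det3 u v w => V0; have Vn0 : V != 0 by rewrite gt_eqF.
have d1 : det3 u v (V^-1 *: w) = 1 by rewrite det3Zr mulVf.
have := natural_frame x [:: e0; e1; V *: e2] d1; rewrite /= -scalemxAl !bvec_mulmx.
have [-> -> ->] := row_mx3 u v (V^-1 *: w); rewrite scalerA divff // scale1r => ->.
by rewrite dotZr [V^-1 * _]mulrC.
Qed.

Lemma seg_fun0 : seg_fun z 0 = 0.
Proof. by rewrite /seg_fun mkv000 natural0 //; exact: polytope_seg. Qed.

Lemma seg_funZ c a : 0 <= c -> seg_fun z (c * a) = c * seg_fun z a.
Proof.
move=> c0; rewrite /seg_fun -(natural_homog nz) //; last exact: polytope_seg.
by rewrite mkvZ mulr0.
Qed.

Lemma tri_funZ c a b : 0 <= c -> tri_fun z (c * a) (c * b) = c * tri_fun z a b.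
Proof.
move=> c0; rewrite /tri_fun -(natural_homog nz) //; last exact: polytope_seg.
by rewrite mkvZ mulr0.
Qed.

Lemma tet_funZ V c a0 a1 a2 : 0 <= c ->
  tet_fun z V (c * a0) (c * a1) (c * a2) = c * tet_fun z V a0 a1 a2.
Proof.
move=> c0; rewrite /tet_fun -(natural_homog nz) //; last exact: polytope_seg.
by rewrite mkvZ mulrA.
Qed.

Lemma cross_e01 : cross e0 e1 != 0.
Proof.
by apply/eqP => /rowP /(_ o2); rewrite !mxE /= !(mul0r, mulr1, subr0) => /eqP; rewrite oner_eq0.
Qed.

Lemma tri_funC a b : tri_fun z a b = tri_fun z b a.
Proof.
have c0 : cross e1 e0 != 0 by rewrite crossN oppr_eq0 cross_e01.
have := tri_value (mkv a b 0) c0; rewrite !dot_bvec mkv0 mkv1 => <-.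
by rewrite /tri_fun; congr (z _ _); apply: conv_eqi => y; rewrite !inE [(y == e1) || _]orbC.
Qed.

Lemma tri_fun_split a b t : 0 < t < 1 -> let m := (1 - t) * a + t * b in
  tri_fun z a b + seg_fun z m = tri_fun z a m + tri_fun z m b.
Proof.
move=> t01 m; have := tri_split (natural_cut nz (mkv a b 0)) cross_e01 t01.
rewrite /=; set p := _ *: e0 + _; move: t01 => /andP[t0 t1].
have pm : dot (mkv a b 0) p = m by rewrite /p dotDr !dotZr !dot_bvec mkv0 mkv1.
have cz (q c : R) u v : 0 < c -> cross u v = c *: cross e0 e1 -> cross u v != 0.
  by move=> c0 ->; rewrite scaler_eq0 negb_or cross_e01 gt_eqF.
have c1 : cross e0 p != 0.
  apply: (cz 0 t) => //; rewrite /p crossDr !crossZr crossxx scaler0 add0r //.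
have c2 : cross p e1 != 0.
  apply: (cz 0 (1 - t)); first by rewrite subr_gt0.
  by rewrite /p crossDl !crossZl crossxx scaler0 addr0.
have p0 : p != 0 by apply: contraNneq c1 => ->; rewrite cross0r.
rewrite (tri_value _ c1) (tri_value _ c2) (seg_value _ p0) pm !dot_bvec mkv0 mkv1.
by rewrite /tri_fun.
Qed.

Lemma tet_fun_cyc V a b c : 0 < V -> tet_fun z V a b c = tet_fun z V b c a.
Proof.
move=> V0; have d : det3 e1 (V *: e2) e0 = V by rewrite det3E !mxE /=; ring.
have d0 : 0 < det3 e1 (V *: e2) e0 by rewrite d.
have := tet_value (mkv a b (c / V)) d0; rewrite d dotZr !dot_bvec mkv0 mkv1 mkv2.
rewrite [V * _]mulrC divfK ?gt_eqF // => <-; rewrite /tet_fun; congr (z _ _).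
apply: conv_eqi => y; rewrite !inE; case: (y == 0) => //=.
by rewrite orbC -orbA.
Qed.

Lemma tet_fun_split V a b c t : 0 < V -> 0 < t < 1 -> let m := (1 - t) * a + t * b in
  tet_fun z V a b c + tri_fun z m c = tet_fun z (t * V) a m c + tet_fun z ((1 - t) * V) m b c.
Proof.
move=> V0 t01 m.
have d : det3 e0 e1 (V *: e2) = V by rewrite det3Zr det3_bvec mulr1.
have dn0 : det3 e0 e1 (V *: e2) != 0 by rewrite d gt_eqF.
have := tet_split (natural_cut nz (mkv a b (c / V))) dn0 t01.
rewrite /=; set p := _ *: e0 + _; move: t01 => /andP[t0 t1].
have pm : dot (mkv a b (c / V)) p = m by rewrite /p dotDr !dotZr !dot_bvec mkv0 mkv1.
have d1 : det3 e0 p (V *: e2) = t * V by rewrite det3E /p !mxE /=; ring.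
have d2 : det3 p e1 (V *: e2) = (1 - t) * V by rewrite det3E /p !mxE /=; ring.
have q1 : 0 < det3 e0 p (V *: e2) by rewrite d1 mulr_gt0.
have q2 : 0 < det3 p e1 (V *: e2) by rewrite d2 mulr_gt0 // subr_gt0.
have c1 : cross p (V *: e2) != 0.
  by apply: contraTneq q2 => h; rewrite det3_rot det3_rot /det3 crossN h oppr0 dot0l ltxx.
rewrite (tet_value _ q1) (tet_value _ q2) (tri_value _ c1) pm d1 d2 dotZr !dot_bvec mkv0 mkv1 mkv2.
by rewrite [V * _]mulrC divfK ?gt_eqF // /tet_fun.
Qed.

Lemma tet_fun_lip V b c : exists C, forall a t, 0 <= t ->
  `|tet_fun z V (a + t) b c - tet_fun z V a b c| <= t * C.
Proof.
have [C h] := natural_lip nz e0 (polytope_seg [:: e0; e1; V *: e2]).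
exists C => a t t0; have := h (mkv a b (c / V)) t t0; rewrite /tet_fun.
by have -> : mkv a b (c / V) + t *: e0 = mkv (a + t) b (c / V)
  by apply: vec_eq; rewrite !mxE /=; ring.
Qed.

End Values.
End Natural.

(** * Functional equations *)

Section FunctionalEquations.
Variable R : realType.

(** A negative value is excluded because its multiples are unbounded below. Hence [phi] is monotone,
    and comparison with integers makes the additive function linear. *)
Lemma positive_linear (phi : R -> R) (K : R) :
  (forall V t, 0 < V -> 0 < t < 1 -> phi V = phi (t * V) + phi ((1 - t) * V)) ->
  (forall V, 0 < V -> - K <= phi V) ->
  exists2 c, 0 <= c & forall V, 0 < V -> phi V = c * V.
Proof.
move=> split bound.
have add V W : 0 < V -> 0 < W -> phi (V + W) = phi V + phi W.
  move=> V0 W0; have VW0 : 0 < V + W by rewrite addr_gt0.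
  rewrite (split (V + W) (V / (V + W))) //; last first.
    by rewrite divr_gt0 //= ltr_pdivrMr // mul1r ltrDl.
  congr (phi _ + phi _); first by rewrite divfK ?gt_eqF.
  by rewrite mulrBl mul1r divfK ?gt_eqF //; ring.
have muln V n : 0 < V -> phi (n.+1%:R * V) = n.+1%:R * phi V.
  move=> V0; elim: n => [|n IH]; first by rewrite !mul1r.
  rewrite -[n.+2]addn1 natrD !mulrDl !mul1r add ?IH // mulr_gt0 //.
have pos V : 0 < V -> 0 <= phi V.
  move=> V0; rewrite leNgt; apply/negP => n0.
  have Vn : 0 < - phi V by rewrite oppr_gt0.
  have := archi_boundP (normr_ge0 (K / - phi V)); set n := Num.bound _ => hn.
  have n1 : 0 < n.+1%:R :> R by rewrite ltr0n.
  have := bound (n.+1%:R * V) (mulr_gt0 n1 V0); rewrite muln //.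
  have : K / - phi V < n.+1%:R.
    by apply: (le_lt_trans (ler_norm _)); apply: (lt_trans hn); rewrite ltr_nat.
  by rewrite ltr_pdivrMr // => h; lra.
have mono V W : 0 < V -> V <= W -> phi V <= phi W.
  move=> V0; rewrite le_eqVlt => /orP[/eqP -> //|VW].
  have W0 : 0 < W - V by rewrite subr_gt0.
  have -> : W = V + (W - V) by ring.
  by rewrite (add _ _ V0 W0) lerDl pos.
exists (phi 1); first exact: pos.
move=> V V0.
have p1 := pos 1 ltr01.
(* With [N = n.+1] and [k] the integer part of [N V], both [N phi V] and [N V phi 1] lie between
   [k phi 1] and [(k + 1) phi 1]. *)
have near n : `|phi V - phi 1 * V| * n.+1%:R <= phi 1 * 2.
  have n1 : 0 < n.+1%:R :> R by rewrite ltr0n.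
  have nV : 0 < n.+1%:R * V by rewrite mulr_gt0.
  have /andP[k1 k2] := truncn_itv (ltW nV); set k := Num.truncn _ in k1 k2.
  have u : phi (n.+1%:R * V) <= k.+1%:R * phi 1.
    by rewrite -(muln 1 k ltr01) mulr1; apply: mono => //; rewrite ltW.
  have l : k%:R * phi 1 <= phi (n.+1%:R * V).
    case: k k1 {k2 u} => [|k] k1; first by rewrite mul0r; exact: pos.
    by rewrite -(muln 1 k ltr01) mulr1; apply: mono => //; rewrite ltr0n.
  rewrite muln // in u l.
  have ub : n.+1%:R * V * phi 1 <= k.+1%:R * phi 1 by rewrite ler_wpM2r // ltW.
  have lb : k%:R * phi 1 <= n.+1%:R * V * phi 1 by rewrite ler_wpM2r.
  have kS : k.+1%:R = k%:R + 1 :> R by rewrite -addn1 natrD.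
  rewrite kS in u ub.
  rewrite -(ger0_norm (ltW n1)) -normrM ler_norml; apply/andP; split; lra.
apply/eqP; rewrite -subr_eq0 -normr_eq0; apply/eqP; apply: le_anti; rewrite normr_ge0 andbT.
rewrite leNgt; apply/negP => d0.
have := archi_boundP (normr_ge0 (phi 1 * 2 / `|phi V - phi 1 * V|)); set n := Num.bound _ => hn.
have := near n; apply/negP; rewrite -ltNge [ltRHS]mulrC -ltr_pdivrMr //.
by apply: (le_lt_trans (ler_norm _)); apply: (lt_trans hn); rewrite ltr_nat.
Qed.

Variable z : set (vec R) -> vec R -> R.
Hypothesis nz : natural z.
Local Notation s := (seg_fun z).
Local Notation f := (tri_fun z).
Local Notation g := (tet_fun z).

Lemma seg_fun_cases a : s a = if 0 <= a then a * s 1 else - a * s (- 1).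
Proof.
case: ifPn => [a0|]; first by rewrite -seg_funZ // mulr1.
by rewrite -ltNge => a0; rewrite -seg_funZ ?mulrN1 ?opprK // oppr_ge0 ltW.
Qed.

Lemma tri_fun_cases a : f a 0 = if 0 <= a then a * f 1 0 else - a * f (- 1) 0.
Proof.
case: ifPn => [a0|]; first by rewrite -tri_funZ // mulr1 mulr0.
by rewrite -ltNge => a0; rewrite -tri_funZ ?mulrN1 ?mulr0 ?opprK // oppr_ge0 ltW.
Qed.

Lemma tet_fun_cases V a : g V 0 0 a = if 0 <= a then a * g V 0 0 1 else - a * g V 0 0 (- 1).
Proof.
case: ifPn => [a0|]; first by rewrite -tet_funZ // mulr1 !mulr0.
by rewrite -ltNge => a0; rewrite -tet_funZ ?mulrN1 ?mulr0 ?opprK // oppr_ge0 ltW.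
Qed.

(** The parameters at which the segments from [a] to 0 and from 0 to [a] pass through [b]. *)
Lemma ratio_between (a b : R) : a != 0 -> 0 < b / a < 1 ->
  [/\ 0 < 1 - b / a < 1, (1 - (1 - b / a)) * a + (1 - b / a) * 0 = b &
      (1 - b / a) * 0 + b / a * a = b].
Proof.
move=> a0 /andP[h0 h1]; split; first by apply/andP; split; lra.
  by rewrite mulr0 addr0 opprB addrC subrK divfK.
by rewrite mulr0 add0r divfK.
Qed.

(** Either 0 separates [a] and [b], or one of them lies between 0 and the other. *)
Lemma same_sign_cases (a b : R) : a != 0 -> b != 0 -> a != b ->
  [\/ 0 < a / (a - b) < 1, 0 < b / a < 1 | 0 < a / b < 1].
Proof.
move=> a0 b0 ab.
case: (ltgtP 0 a) a0 => // ha _; case: (ltgtP 0 b) b0 => // hb _; case: (ltgtP a b) ab => // hab _.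
- by apply: Or33; rewrite divr_gt0 //= ltr_pdivrMr // mul1r.
- by apply: Or32; rewrite divr_gt0 //= ltr_pdivrMr // mul1r.
- lra.
- have h : 0 < a - b by lra.
  by apply: Or31; rewrite divr_gt0 //= ltr_pdivrMr // mul1r; lra.
- have h : 0 < b - a by lra.
  by apply: Or31; rewrite -mulrNN -invrN opprB divr_gt0 ?oppr_gt0 //= ltr_pdivrMr // mul1r; lra.
- lra.
- by apply: Or32; rewrite -mulrNN -invrN divr_gt0 ?oppr_gt0 //= ltr_pdivrMr ?oppr_gt0 // mul1r; lra.
- by apply: Or33; rewrite -mulrNN -invrN divr_gt0 ?oppr_gt0 //= ltr_pdivrMr ?oppr_gt0 // mul1r; lra.
Qed.

Lemma opposite_zero (a b : R) : a != b -> (1 - a / (a - b)) * a + a / (a - b) * b = 0.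
Proof.
by move=> ab; field; rewrite subr_eq0.
Qed.

Lemma tri_fun_eq0 : s =1 (fun=> 0) -> f 1 0 = 0 -> f (- 1) 0 = 0 -> forall a b, f a b = 0.
Proof.
move=> s0 f1 f2; have fa a : f a 0 = 0 by rewrite tri_fun_cases f1 f2 !mulr0; case: ifP.
have split a b t : 0 < t < 1 -> f a b = f a ((1 - t) * a + t * b) + f ((1 - t) * a + t * b) b.
  by move=> t01; rewrite -(tri_fun_split nz) // s0 addr0.
have small a b : a != 0 -> 0 < b / a < 1 -> f a b = 0.
  move=> a0 h; have [t01 e _] := ratio_between a0 h.
  by have := split a 0 _ t01; rewrite e !fa addr0 => <-.
move=> a b; have [->|a0] := eqVneq a 0; first by rewrite (tri_funC nz).
have [->//|b0] := eqVneq b 0.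
have [->|ab] := eqVneq a b.
  (* For [a = b] bisection gives twice the same value. *)
  have t12 : 0 < (2^-1 : R) < 1 by apply/andP; split; lra.
  have := split b b _ t12; have -> : (1 - 2^-1) * b + 2^-1 * b = b by field.
  by lra.
have [h|h|h] := same_sign_cases a0 b0 ab.
- by rewrite (split _ _ _ h) opposite_zero // fa (tri_funC nz) fa addr0.
- exact: small.
- by rewrite (tri_funC nz); exact: small.
Qed.

Section Solid.
Hypothesis f0 : forall a b, f a b = 0.

Lemma tet_fun_split0 V a b c t : 0 < V -> 0 < t < 1 ->
  g V a b c = g (t * V) a ((1 - t) * a + t * b) c + g ((1 - t) * V) ((1 - t) * a + t * b) b c.
Proof. by move=> V0 t01; rewrite -(tet_fun_split nz) // f0 addr0. Qed.

(** If 0 lies between [a] and [b], the cut is made there. If [b] lies between 0 and [a], the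
    relation is read backwards from [(a, 0)], with the volume enlarged so that the wanted piece has
    volume [V]. For [a = b] the relation only expresses additivity in [V], so this case is a limit
    of the others. *)
Lemma tet_fun_fill c : (forall V a, 0 < V -> g V a 0 c = 0) -> (forall V b, 0 < V -> g V 0 b c = 0) ->
  forall V a b, 0 < V -> g V a b c = 0.
Proof.
move=> ga gb; have off V a b : a != b -> 0 < V -> g V a b c = 0.
  move=> ab V0; have [->|a0] := eqVneq a 0; first exact: gb.
  have [->|b0] := eqVneq b 0; first exact: ga.
  have [h|h|h] := same_sign_cases a0 b0 ab.
  - have /andP[h0 h1] := h; have q0 := mulr_gt0 h0 V0.
    have q1 : 0 < (1 - a / (a - b)) * V by rewrite mulr_gt0 // subr_gt0.
    by rewrite (tet_fun_split0 _ _ _ V0 h) opposite_zero // ga // gb // addr0.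
  - have [t01 e _] := ratio_between a0 h; have /andP[t0 t1] := t01.
    have W0 : 0 < V / (1 - b / a) by rewrite divr_gt0.
    have q1 : 0 < (1 - (1 - b / a)) * (V / (1 - b / a)) by rewrite mulr_gt0 // subr_gt0.
    have := tet_fun_split0 a 0 c W0 t01; rewrite e (ga _ a) // (ga _ b) // addr0.
    by rewrite [_ * (V / _)]mulrC divfK ?gt_eqF.
  - have [t01 _ e] := ratio_between b0 h; have /andP[t0 t1] := t01; have /andP[h0 h1] := h.
    have W0 : 0 < V / (1 - a / b) by rewrite divr_gt0.
    have q1 : 0 < a / b * (V / (1 - a / b)) by rewrite mulr_gt0.
    have := tet_fun_split0 0 b c W0 h; rewrite e (gb _ b) // (gb _ a) // add0r.
    by rewrite [_ * (V / _)]mulrC divfK ?gt_eqF.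
move=> V a b V0; have [ab|] := eqVneq a b; last by move=> ab; exact: off.
have [C hC] := tet_fun_lip nz V b c.
have small t : 0 < t -> `|g V a b c| <= t * C.
  move=> t0; have := hC a t (ltW t0); rewrite off // ?sub0r ?normrN // ab.
  by rewrite -subr_eq0 addrAC subrr add0r gt_eqF.
apply/eqP; rewrite -normr_eq0; apply/eqP; apply: le_anti; rewrite normr_ge0 andbT.
by apply: (le_of_perturbation ltr01 (c := C)) => t t0 _; rewrite add0r; exact: small.
Qed.

(** The number of nonzero entries is raised from one to two and three by [tet_fun_fill] after cyclic
    shifts. *)
Lemma tet_fun_eq0 : (forall V, 0 < V -> g V 0 0 1 = 0) -> (forall V, 0 < V -> g V 0 0 (- 1) = 0) ->
  forall V a b c, 0 < V -> g V a b c = 0.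
Proof.
move=> gp gm; have g00 V c : 0 < V -> g V 0 0 c = 0.
  by move=> V0; rewrite tet_fun_cases gp // gm // !mulr0; case: ifP.
have gab0 V a b : 0 < V -> g V a b 0 = 0.
  apply: tet_fun_fill => V' a' V0'; first by rewrite (tet_fun_cyc nz) ?g00.
  by rewrite -(tet_fun_cyc nz) ?g00.
move=> V a b c; apply: tet_fun_fill => V' a' V0'.
  by rewrite -(tet_fun_cyc nz) ?gab0.
by rewrite (tet_fun_cyc nz) ?gab0.
Qed.

End Solid.

Lemma tet_fun_linear e K : (forall V, 0 < V -> - K <= g V 0 0 e) ->
  exists2 c, 0 <= c & forall V, 0 < V -> g V 0 0 e = f 0 e + c * V.
Proof.
move=> hK; have [||c c0 hc] := @positive_linear (fun V => g V 0 0 e - f 0 e) (K + f 0 e).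
- move=> V t V0 t01; have := tet_fun_split nz 0 0 e V0 t01.
  by rewrite /= !mulr0 addr0; lra.
- by move=> V V0; rewrite opprD lerD2r hK.
by exists c => // V V0; have := hc V V0; lra.
Qed.

End FunctionalEquations.

(** * Inequalities between the coefficients *)

Section Constraints.
Variable R : realType.
Variable z : set (vec R) -> vec R -> R.
Hypothesis nz : natural z.
Hypothesis sz : forall P, polytope_o P -> sublin (z P).
Hypothesis zpos : forall P x, polytope_o P -> 0 <= z P x.
Local Notation s := (seg_fun z).
Local Notation f := (tri_fun z).
Local Notation g := (tet_fun z).

Lemma mkvD (a b c a' b' c' : R) : mkv a b c + mkv a' b' c' = mkv (a + a') (b + b') (c + c').
Proof. by apply: vec_eq; rewrite !mxE. Qed.

Lemma tri_fun_subadd a b a' b' : f (a + a') (b + b') <= f a b + f a' b'.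
Proof.
have := (sz (polytope_seg [:: bvec R o0; bvec R o1])).1 (mkv a b 0) (mkv a' b' 0).
by rewrite mkvD addr0.
Qed.

Lemma tet_fun_subadd V a b c a' b' c' : g V (a + a') (b + b') (c + c') <= g V a b c + g V a' b' c'.
Proof.
rewrite /tet_fun mulrDl -mkvD.
exact: (sz (polytope_seg [:: bvec R o0; bvec R o1; V *: bvec R o2])).1.
Qed.

Lemma seg_fun_pos a : 0 <= a -> s a = a * s 1.
Proof. by move=> a0; rewrite seg_fun_cases // a0. Qed.

Lemma tri_fun_pos a : 0 <= a -> f a 0 = a * f 1 0.
Proof. by move=> a0; rewrite tri_fun_cases // a0. Qed.

(** The relation for [(a, 0)] cut at [b], solved for the first piece. The value is [a F - b (F - S)]
    with [F = f 1 0] and [S = s 1]. *)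
Lemma tri_fun_pos2 a b : 0 < b -> b < a -> f a b = (a - b) * f 1 0 + b * s 1.
Proof.
move=> b0 ba; have a0 : 0 < a by exact: lt_trans ba.
have h : 0 < b / a < 1 by rewrite divr_gt0 //= ltr_pdivrMr // mul1r.
have [t01 e _] := ratio_between (lt0r_neq0 a0) h.
have := tri_fun_split nz a 0 t01; rewrite /= e (tri_fun_pos (ltW a0)) (tri_fun_pos (ltW b0)).
by rewrite (seg_fun_pos (ltW b0)); lra.
Qed.

Lemma planar_constraint : f 1 0 - s 1 <= f (- 1) 0.
Proof.
(* The two points lie on either side of the kink at [b = 0], where the slope in [b] jumps from
   [- f (-1) 0] to [s 1 - f 1 0]. *)
have := tri_fun_subadd 2 1 2 (- 1); rewrite subrr.
have -> : 2 + 2 = 4 :> R by ring.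
have e21 : f 2 1 = (2 - 1) * f 1 0 + 1 * s 1 by apply: tri_fun_pos2; lra.
rewrite (tri_fun_pos (ler0n _ 4)) e21.
have t01 : 0 < (2 / 3 : R) < 1 by apply/andP; split; lra.
have := tri_fun_split nz 2 (- 1) t01; rewrite /=.
have -> : (1 - 2 / 3) * 2 + 2 / 3 * - 1 = 0 :> R by field.
rewrite seg_fun0 // addr0 => ->; rewrite (tri_fun_pos (ler0n _ 2)) (tri_funC nz 0) => h.
by move: h; lra.
Qed.

(* [g V a b c] is affine in the volume [V]; only its value [k] at [V = 0] matters below. *)
Definition limit_val a b c k := exists q, forall V, 0 < V -> g V a b c = k + q * V.

Lemma limit_cyc a b c k : limit_val a b c k -> limit_val c a b k.
Proof. by move=> [q h]; exists q => V V0; rewrite (tet_fun_cyc nz) // h. Qed.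

Lemma limit_vertex r : 0 < r -> limit_val 0 0 r (r * f 1 0).
Proof.
move=> r0; have hb V : 0 < V -> - 0 <= g V 0 0 r.
  by move=> V0; rewrite oppr0; apply: zpos; exact: polytope_seg.
have [c _ hc] := tet_fun_linear nz hb.
by exists c => V V0; rewrite hc // (tri_funC nz) tri_fun_pos // ltW.
Qed.

(** The relation for [(a, 0, c)] cut at [b], solved for the piece with entries [a], [b], [c]. The
    enlarged volume [V / t] affects the slope in [V] but not the limit. *)
Lemma limit_fst a b c k k' : 0 < b -> b < a -> limit_val a 0 c k -> limit_val b 0 c k' ->
  limit_val a b c (k + f b c - k').
Proof.
move=> b0 ba [q h] [q' h']; have a0 : 0 < a by exact: lt_trans ba.
have hr : 0 < b / a < 1 by rewrite divr_gt0 //= ltr_pdivrMr // mul1r.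
have [t01 e _] := ratio_between (lt0r_neq0 a0) hr; move: t01 e; set t := 1 - b / a => t01 e.
have /andP[t0 t1] := t01; have s0 : 0 < 1 - t by rewrite subr_gt0.
exists (q / t - q' * (1 - t) / t) => V V0; have W0 : 0 < V / t by rewrite divr_gt0.
have := tet_fun_split nz a 0 c W0 t01; rewrite /= e [t * _]mulrC divfK ?gt_eqF //.
have W1 := mulr_gt0 s0 W0; rewrite h // h' // => H.
have -> : g V a b c = k + q * (V / t) + f b c - (k' + q' * ((1 - t) * (V / t))) by rewrite H addrK.
by ring.
Qed.

Lemma limit_snd a b c k k' : 0 < b -> b < a -> limit_val 0 a c k -> limit_val 0 b c k' ->
  limit_val b a c (k + f b c - k').
Proof.
move=> b0 ba [q h] [q' h']; have a0 : 0 < a by exact: lt_trans ba.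
have hr : 0 < b / a < 1 by rewrite divr_gt0 //= ltr_pdivrMr // mul1r.
have [_ _ e] := ratio_between (lt0r_neq0 a0) hr; move: hr e; set t := b / a => t01 e.
have /andP[t0 t1] := t01; have s0 : 0 < 1 - t by rewrite subr_gt0.
exists (q / (1 - t) - q' * t / (1 - t)) => V V0; have W0 : 0 < V / (1 - t) by rewrite divr_gt0.
have := tet_fun_split nz 0 a c W0 t01; rewrite /= e [(1 - t) * (V / _)]mulrC divfK ?gt_eqF //.
have W1 := mulr_gt0 t0 W0; rewrite h // h' // => H.
have -> : g V b a c = k + q * (V / (1 - t)) + f b c - (k' + q' * (t * (V / (1 - t)))).
  by rewrite H addrAC subrr add0r.
by ring.
Qed.

Lemma limit_edge a b : 0 < b -> b < a -> limit_val b a 0 (a * f 1 0).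
Proof.
move=> b0 ba; have a0 : 0 < a by exact: lt_trans ba.
have v r : 0 < r -> limit_val 0 r 0 (r * f 1 0).
  by move=> r0; apply: limit_cyc; apply: limit_cyc; exact: limit_vertex.
have := limit_snd b0 ba (v a a0) (v b b0).
by rewrite (tri_fun_pos (ltW b0)) addrK.
Qed.

Lemma limit_edge' a b : 0 < b -> b < a -> limit_val a b 0 (a * f 1 0).
Proof.
move=> b0 ba; have a0 : 0 < a by exact: lt_trans ba.
have v r : 0 < r -> limit_val r 0 0 (r * f 1 0) by move=> r0; apply: limit_cyc; exact: limit_vertex.
have := limit_fst b0 ba (v a a0) (v b b0).
by rewrite (tri_fun_pos (ltW b0)) addrK.
Qed.

Lemma limit_val_632 : limit_val 6 3 2 (4 * f 1 0 + 2 * s 1).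
Proof.
have h1 : limit_val 6 0 2 (6 * f 1 0) by apply: limit_cyc; apply: limit_cyc; apply: limit_edge; lra.
have h2 : limit_val 3 0 2 (3 * f 1 0) by apply: limit_cyc; apply: limit_cyc; apply: limit_edge; lra.
have e : f 3 2 = (3 - 2) * f 1 0 + 2 * s 1 by apply: tri_fun_pos2; lra.
have := limit_fst _ _ h1 h2; rewrite e => H.
have := H (ltr0n _ 3) _; rewrite (_ : 4 * f 1 0 + 2 * s 1 =
  6 * f 1 0 + ((3 - 2) * f 1 0 + 2 * s 1) - 3 * f 1 0); last by ring.
by apply; lra.
Qed.

Lemma limit_val_613 : limit_val 6 1 3 (5 * f 1 0 + s 1).
Proof.
have h1 : limit_val 6 0 3 (6 * f 1 0) by apply: limit_cyc; apply: limit_cyc; apply: limit_edge; lra.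
have h2 : limit_val 1 0 3 (3 * f 1 0) by apply: limit_cyc; apply: limit_cyc; apply: limit_edge'; lra.
have e : f 3 1 = (3 - 1) * f 1 0 + 1 * s 1 by apply: tri_fun_pos2; lra.
have := limit_fst _ _ h1 h2; rewrite (tri_funC nz 1 3) e => H.
have := H ltr01 _; rewrite (_ : 5 * f 1 0 + s 1 =
  6 * f 1 0 + ((3 - 1) * f 1 0 + 1 * s 1) - 3 * f 1 0); last by ring.
by apply; lra.
Qed.

Lemma limit_val_1245 : limit_val 12 4 5 (8 * f 1 0 + 4 * s 1).
Proof.
have h1 : limit_val 12 0 5 (12 * f 1 0) by apply: limit_cyc; apply: limit_cyc; apply: limit_edge; lra.
have h2 : limit_val 4 0 5 (5 * f 1 0) by apply: limit_cyc; apply: limit_cyc; apply: limit_edge'; lra.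
have e : f 5 4 = (5 - 4) * f 1 0 + 4 * s 1 by apply: tri_fun_pos2; lra.
have := limit_fst _ _ h1 h2; rewrite (tri_funC nz 4 5) e => H.
have := H (ltr0n _ 4) _; rewrite (_ : 8 * f 1 0 + 4 * s 1 =
  12 * f 1 0 + ((5 - 4) * f 1 0 + 4 * s 1) - 5 * f 1 0); last by ring.
by apply; lra.
Qed.

(** In the three computed cases the limit is [F = f 1 0] times the largest entry minus [F - s 1]
    times the smallest. The largest entries add up, 6 + 6 = 12, but the smallest do not: 2 + 1 < 4,
    since the order of the last two entries changes. Subadditivity therefore leaves
    [F - s 1 >= 0]. *)
Lemma solid_constraint : s 1 <= f 1 0.
Proof.
have [q1 h1] := limit_val_632; have [q2 h2] := limit_val_613; have [q3 h3] := limit_val_1245.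
apply: (le_of_perturbation ltr01 (c := q1 + q2 - q3)) => V V0 _.
have := tet_fun_subadd V 6 3 2 6 1 3.
rewrite (_ : 6 + 6 = 12); last by ring.
rewrite (_ : 3 + 1 = 4); last by ring.
rewrite (_ : 2 + 3 = 5); last by ring.
rewrite h1 // h2 // h3 // mulrBr mulrDr !(mulrC V); move: (q1 * V) (q2 * V) (q3 * V) => *.
by lra.
Qed.

End Constraints.

(** * Classification *)

Section Classification.
Variable R : realType.
Implicit Types (P : set (vec R)) (x u v w : vec R).
Local Notation e0 := (bvec R o0).
Local Notation e1 := (bvec R o1).
Local Notation e2 := (bvec R o2).

Lemma natural_hMplus : natural (@hMplus R).
Proof.
apply: natural_sublin.
- exact: hMplus_cut.
- by move=> phi P x d1 hP; exact: hMplus_covariant.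
- exact: hMplus_sublin.
Qed.

Lemma natural_hD (a1 a2 b1 b2 : R) : 0 <= a1 -> 0 <= b1 -> a1 <= a2 -> b1 <= b2 ->
  a2 - a1 <= b2 -> b2 - b1 <= a2 -> natural (hD a1 a2 b1 b2).
Proof.
move=> h1 h2 h3 h4 h5 h6; apply: natural_sublin.
- exact: hD_cut.
- by move=> phi P x d1 hP; apply: hD_linimg; rewrite unitmxE d1 unitr1.
- by move=> P hP; exact: hD_sublin.
Qed.

Lemma seg_fun_hD (a1 a2 b1 b2 a : R) :
  seg_fun (hD a1 a2 b1 b2) a = a1 * Num.max 0 a + b1 * Num.max 0 (- a).
Proof.
rewrite /seg_fun hD_gsum !gsum_seg !supp_seg !mulr0 !addr0 dotNl dot_bvec mkv0 //.
Qed.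

Lemma mkvN (a b c : R) : - mkv a b c = mkv (- a) (- b) (- c).
Proof. by apply: vec_eq; rewrite !mxE. Qed.

Lemma triangle_values : [/\ supp (@triangle R) (mkv 1 0 0) = 1, supp (@triangle R) (mkv (- 1) 0 0) = 0,
  gsum (@triangle R) (mkv 1 0 0) = 1 & gsum (@triangle R) (mkv (- 1) 0 0) = 0].
Proof.
have s1 : supp (@triangle R) (mkv 1 0 0) = 1.
  by rewrite (@supp_triangle _ _ o0) ?mkv0 ?mkv1 //; left.
have s2 : supp (@triangle R) (mkv (- 1) 0 0) = 0.
  by rewrite supp_triangle_neg // ?mkv0 ?mkv1 // oppr_le0.
split=> //; rewrite gsum_triangle ?s1 ?s2 mkv0 mkv1 maxxx.
  by rewrite max_r //; ring.
by rewrite max_l ?oppr_le0 //; ring.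
Qed.

Lemma tri_fun_hD (a1 a2 b1 b2 : R) :
  tri_fun (hD a1 a2 b1 b2) 1 0 = a2 /\ tri_fun (hD a1 a2 b1 b2) (- 1) 0 = b2.
Proof.
have [s1 s2 g1 g2] := triangle_values.
rewrite /tri_fun -/(@triangle R) !hD_gsum !mkvN opprK !oppr0 s1 s2 g1 g2.
by split; ring.
Qed.

(** [hD] is covariant under all invertible maps, so the volume does not enter. *)
Lemma tet_fun_hD (a1 a2 b1 b2 V a b c : R) : 0 < V ->
  tet_fun (hD a1 a2 b1 b2) V a b c = tet_fun (hD a1 a2 b1 b2) 1 a b c.
Proof.
move=> V0; have Vn0 : V != 0 by rewrite gt_eqF.
have u : mx3 e0 e1 (V *: e2) \in unitmx.
  by rewrite unitmxE det_mx3 det3Zr det3_bvec mulr1 unitfE.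
have := hD_linimg a1 a2 b1 b2 (conv [:: 0; e0; e1; e2]) (mkv a b (c / V)) u.
rewrite linimg_conv /= mul0mx !bvec_mulmx; have [-> -> ->] := row_mx3 e0 e1 (V *: e2).
rewrite mulmx_mx3 dotZr !dot_bvec mkv0 mkv1 mkv2 [V * _]mulrC divfK // /tet_fun => ->.
by rewrite scale1r divr1.
Qed.

Lemma seg_fun_hMplus a : seg_fun (@hMplus R) a = 0.
Proof.
apply: hMplus_flat; first exact: polytope_seg.
by move=> y /seg_line[t ->]; rewrite !mxE /= mulr0.
Qed.

Lemma triangle_flat y : @triangle R y -> y ord0 o2 = 0.
Proof.
have c : convex [set y : vec R | y ord0 o2 = 0].
  by move=> p q t /= p0 q0 _; rewrite !mxE p0 q0 !mulr0 addr0.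
by apply: (conv_sub c) => v; rewrite !inE => /or3P[]/eqP ->; rewrite /= !mxE.
Qed.

Lemma tri_fun_hMplus a b : tri_fun (@hMplus R) a b = 0.
Proof. by apply: hMplus_flat; [exact: polytope_seg|exact: triangle_flat]. Qed.

Lemma tet_fun_hMplus : exists2 m, 0 < m & forall V, 0 < V ->
  tet_fun (@hMplus R) V 0 0 1 = m * V /\ tet_fun (@hMplus R) V 0 0 (- 1) = 0.
Proof.
have hb V : 0 < V -> - 0 <= tet_fun (@hMplus R) V 0 0 1.
  by move=> V0; rewrite oppr0; exact: hMplus_ge0.
have [m m0 hm] := tet_fun_linear natural_hMplus hb.
exists m => [|V V0]; last first.
  rewrite hm // tri_fun_hMplus add0r; split=> //; apply: hMplus_eq0.
  apply: conv_le => v; rewrite !inE => /or4P[]/eqP ->; rewrite ?dot0r // ?dotZr dot_bvec.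
  - by rewrite mkv0.
  - by rewrite mkv1.
  by rewrite mkv2 mulrC divfK ?gt_eqF // oppr_le0.
have -> : m = tet_fun (@hMplus R) 1 0 0 1 by rewrite hm // tri_fun_hMplus add0r mulr1.
rewrite /tet_fun scale1r divr1.
(* The cube with sides [[1/8, 1/4]] lies in the standard simplex, as coordinate sums are at most
   [3/4], and the functional is at least [1/8] on it. *)
have ab : 8^-1 < 4^-1 :> R by lra.
apply: (@hMplus_gt0 _ _ _ (8^-1) (4^-1) (8^-1)) => //; first exact: polytope_seg.
move=> y hy; split; last first.
  by rewrite dotC dotE mkv0 mkv1 mkv2 !mulr0 !add0r mulr1; have /andP[] := hy o2.
have -> : conv [:: 0; e0; e1; e2] = simplex (bvec R) predT by [].
rewrite (@simplexE _ _ _ (mkv 1 1 1)).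
  split; last first.
    rewrite /= dotE mkv0 mkv1 mkv2.
    by have /andP[_] := hy o0; have /andP[_] := hy o1; have /andP[_] := hy o2; lra.
  exists (fun i => y ord0 i); split=> //; last by rewrite sum3E -vecE.
  by move=> i; have /andP[h _] := hy i; apply: le_trans h; lra.
by apply: ord3P => _; rewrite dot_bvec mxE.
Qed.

Section Zero.
Variable z : set (vec R) -> vec R -> R.
Hypothesis nz : natural z.

(** Linear maps fix the origin. One of determinant 1 doubles an axis vector, so homogeneity gives
    the value 0 there, and every [x] can be moved to the axis. *)
Lemma natural_origin x : z (conv [:: 0]) x = 0.
Proof.
have hP := polytope_seg ([::] : seq (vec R)).
have frame u v w y : det3 u v w = 1 ->
    z (conv [:: 0]) y = z (conv [:: 0]) (mkv (dot y u) (dot y v) (dot y w)).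
  exact: (natural_frame nz y [::]).
have axis c : z (conv [:: 0]) (mkv c 0 0) = 0.
  have d : det3 (2 *: e0) (2^-1 *: e1) e2 = 1 by rewrite det3E !mxE /=; field.
  have := frame _ _ _ (mkv c 0 0) d; rewrite !dotZr !dot_bvec mkv0 mkv1 mkv2 mulr0.
  have -> : mkv (2 * c) 0 0 = 2 *: mkv c 0 0 by rewrite mkvZ mulr0.
  by rewrite (natural_homog nz) //; lra.
have [->|x0] := eqVneq x 0; first exact: natural0.
have [v v0 xv] := exists_orth x0.
have d : 0 < det3 x v (cross x v).
  rewrite /det3; apply: dot_gt0; apply: contraNneq v0 => h.
  by rewrite (cross_eq0 x0 h) xv mul0r scale0r.
have d1 : det3 x v ((det3 x v (cross x v))^-1 *: cross x v) = 1.
  by rewrite det3Zr mulVf // gt_eqF.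
by rewrite (frame _ _ _ _ d1) xv dotZr [dot x (cross _ _)]dotC dot_crossl mulr0 axis.
Qed.

Lemma natural_eq0 : (forall a, seg_fun z a = 0) -> tri_fun z 1 0 = 0 -> tri_fun z (- 1) 0 = 0 ->
  (forall V, 0 < V -> tet_fun z V 0 0 1 = 0) -> (forall V, 0 < V -> tet_fun z V 0 0 (- 1) = 0) ->
  forall P x, polytope_o P -> z P x = 0.
Proof.
move=> s0 f1 f2 g1 g2 P x; have f0 := tri_fun_eq0 nz s0 f1 f2.
have g0 := tet_fun_eq0 nz f0 g1 g2.
have segz u : u != 0 -> z (conv [:: 0; u]) x = 0 by move=> u0; rewrite seg_value.
have triz u v : cross u v != 0 -> z (conv [:: 0; u; v]) x = 0.
  by move=> c0; rewrite tri_value.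
move: P; apply: cut_additive_eq0; first exact: natural_cut.
move=> B I /basis_det3 d0.
have d1 : det3 (B o1) (B o2) (B o0) != 0 by rewrite -det3_rot.
have d2 : det3 (B o2) (B o0) (B o1) != 0 by rewrite det3_rot.
have cr u v w : det3 u v w != 0 -> cross u v != 0.
  by apply: contraNneq => h; rewrite /det3 h dot0l.
have c01 := cr _ _ _ d0; have c12 := cr _ _ _ d1.
have c02 : cross (B o0) (B o2) != 0 by rewrite crossN oppr_eq0 (cr _ _ _ d2).
have n0 : B o0 != 0 by apply: contraNneq c01 => ->; rewrite cross0l.
have n1 : B o1 != 0 by apply: contraNneq c01 => ->; rewrite cross0r.
have n2 : B o2 != 0 by apply: contraNneq c02 => ->; rewrite cross0r.
rewrite /simplex /=; case: (I o0); case: (I o1); case: (I o2); rewrite /= ?segz ?triz //; last first.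
  exact: natural_origin.
(* [tet_value] asks for positive orientation; otherwise two vertices are exchanged. *)
have [dp|dn] := ltP 0 (det3 (B o0) (B o1) (B o2)); first by rewrite tet_value // g0.
have dp : 0 < det3 (B o1) (B o0) (B o2).
  by rewrite det3_swap oppr_gt0 lt_neqAle d0 dn.
have -> : conv [:: 0; B o0; B o1; B o2] = conv [:: 0; B o1; B o0; B o2].
  apply: conv_eqi => y; rewrite !inE; case: (y == 0) => //=.
  by rewrite !orbA [(y == B o0) || _]orbC.
by rewrite tet_value // g0.
Qed.
End Zero.

Section Main.
Variable z : set (vec R) -> vec R -> R.
Hypothesis nz : natural z.
Hypothesis sz : forall P, polytope_o P -> sublin (z P).
Hypothesis zpos : forall P x, polytope_o P -> 0 <= z P x.

Lemma natural_classification : exists a1 a2 b1 b2 c1 c2 : R,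
  [/\ 0 <= a1, 0 <= a2, 0 <= b1 & 0 <= b2] /\ 0 <= c1 /\ 0 <= c2 /\
  [/\ a1 <= a2, b1 <= b2, a2 - a1 <= b2 & b2 - b1 <= a2] /\
  forall P x, polytope_o P ->
    z P x = c1 * hMplus P x + c2 * hMplus P (- x) + hD a1 a2 b1 b2 P x.
Proof.
(* The inequalities with the roles of the [a_i] and [b_i] exchanged come from the reflected
   functional. *)
pose z' P x := z P (- x).
have nz' : natural z' by exact: natural_opp.
have sz' P : polytope_o P -> sublin (z' P) by move=> hP; apply: sublin_opp; exact: sz.
have zpos' P x : polytope_o P -> 0 <= z' P x by move=> hP; exact: zpos.
have [a1 a1E] : exists a, a = seg_fun z 1 by eexists.
have [b1 b1E] : exists a, a = seg_fun z (- 1) by eexists.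
have [a2 a2E] : exists a, a = tri_fun z 1 0 by eexists.
have [b2 b2E] : exists a, a = tri_fun z (- 1) 0 by eexists.
have s'E a : seg_fun z' a = seg_fun z (- a) by rewrite /seg_fun /z' mkvN oppr0.
have f'E a : tri_fun z' a 0 = tri_fun z (- a) 0 by rewrite /tri_fun /z' mkvN oppr0.
have h12 : a1 <= a2 by rewrite a1E a2E; exact: solid_constraint.
have hb12 : b1 <= b2.
  by have := solid_constraint nz' sz' zpos'; rewrite s'E f'E b1E b2E.
have hab : a2 - a1 <= b2 by rewrite a1E a2E b2E; exact: planar_constraint.
have hba : b2 - b1 <= a2.
  by have := planar_constraint nz' sz'; rewrite !s'E !f'E opprK b1E b2E a2E.
have a10 : 0 <= a1 by rewrite a1E; apply: zpos; exact: polytope_seg.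
have b10 : 0 <= b1 by rewrite b1E; apply: zpos; exact: polytope_seg.
have hb e V : 0 < V -> - 0 <= tet_fun z V 0 0 e.
  by move=> V0; rewrite oppr0; apply: zpos; exact: polytope_seg.
have [c1 c10 hc1] := tet_fun_linear nz (hb 1).
have [c2 c20 hc2] := tet_fun_linear nz (hb (- 1)).
have [m m0 hm] := tet_fun_hMplus.
have nD := natural_hD a10 b10 h12 hb12 hab hba.
exists a1, a2, b1, b2, (c1 / m), (c2 / m).
split; first by split => //; lra.
do 2 (split; first by apply: divr_ge0 => //; exact: ltW).
split=> // P x hP.
pose M' P x := @hMplus R P (- x).
pose dz P x := z P x + (- 1) * hD a1 a2 b1 b2 P x + (- (c1 / m)) * hMplus P x + (- (c2 / m)) * M' P x.
have nM' : natural M' by apply: natural_opp; exact: natural_hMplus.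
have nd : natural dz.
  apply: natural_lin nM'; apply: natural_lin natural_hMplus; exact: natural_lin nz nD.
suff : dz P x = 0 by rewrite /dz /M'; lra.
have sM' a : seg_fun M' a = 0 by rewrite /seg_fun /M' mkvN oppr0; exact: seg_fun_hMplus.
have fM' a b : tri_fun M' a b = 0 by rewrite /tri_fun /M' mkvN oppr0; exact: tri_fun_hMplus.
have gM' V e : tet_fun M' V 0 0 e = tet_fun (@hMplus R) V 0 0 (- e).
  by rewrite /tet_fun /M' mkvN oppr0 mulNr.
have sE a : seg_fun dz a = seg_fun z a + (- 1) * seg_fun (hD a1 a2 b1 b2) a +
  (- (c1 / m)) * seg_fun (@hMplus R) a + (- (c2 / m)) * seg_fun M' a by [].
have fE a b : tri_fun dz a b = tri_fun z a b + (- 1) * tri_fun (hD a1 a2 b1 b2) a b +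
  (- (c1 / m)) * tri_fun (@hMplus R) a b + (- (c2 / m)) * tri_fun M' a b by [].
have gE V a b c : tet_fun dz V a b c = tet_fun z V a b c + (- 1) * tet_fun (hD a1 a2 b1 b2) V a b c +
  (- (c1 / m)) * tet_fun (@hMplus R) V a b c + (- (c2 / m)) * tet_fun M' V a b c by [].
have [fD1 fD2] := tri_fun_hD a1 a2 b1 b2.
(* As the volume does not matter for [D], the relation for the entries [(0, 0, e)] reads
   [g + f = g + g]. *)
have gD e : tri_fun (hD a1 a2 b1 b2) 0 e = tet_fun (hD a1 a2 b1 b2) 1 0 0 e.
  have t12 : 0 < (2^-1 : R) < 1 by apply/andP; split; lra.
  have := tet_fun_split nD 0 0 e ltr01 t12; rewrite /= !mulr0 addr0 !mulr1.
  by rewrite (@tet_fun_hD _ _ _ _ 2^-1) ?(@tet_fun_hD _ _ _ _ (1 - 2^-1)); lra.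
apply: (natural_eq0 nd) => //.
- move=> a; rewrite sE sM' seg_fun_hMplus seg_fun_hD (seg_fun_cases nz) -a1E -b1E.
  case: ifPn => [a0|].
    by rewrite max_r // max_l ?oppr_le0 //; ring.
  by rewrite -ltNge => /ltW a0; rewrite max_l // max_r ?oppr_ge0 //; ring.
- by rewrite fE fM' tri_fun_hMplus fD1 a2E; ring.
- by rewrite fE fM' tri_fun_hMplus fD2 b2E; ring.
- move=> V V0; have [m1 m2] := hm V V0.
  rewrite gE gM' m1 m2 tet_fun_hD // -gD hc1 // (tri_funC nD) fD1 (tri_funC nz) -a2E.
  by field; rewrite gt_eqF.
- move=> V V0; have [m1 m2] := hm V V0.
  rewrite gE gM' opprK m1 m2 tet_fun_hD // -gD hc2 // (tri_funC nD) fD2 (tri_funC nz) -b2E.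
  by field; rewrite gt_eqF.
Qed.
End Main.

End Classification.

(** * From support functions back to bodies *)

Section Bodies.
Variable R : realType.
Implicit Types (A B P K : set (vec R)) (x : vec R).

Lemma nonempty_dil (c : R) A : A !=set0 -> dil c A !=set0.
Proof. by move=> [y Ay]; exists (c *: y), y. Qed.

Section Representation.
Variables a1 a2 b1 b2 c1 c2 : R.
Hypotheses (a10 : 0 <= a1) (b10 : 0 <= b1) (c10 : 0 <= c1) (c20 : 0 <= c2).
Hypotheses (a12 : a1 <= a2) (b12 : b1 <= b2) (ab : a2 - a1 <= b2) (ba : b2 - b1 <= a2).

Definition rep_fun P x := c1 * hMplus P x + c2 * hMplus P (- x) + hD a1 a2 b1 b2 P x.
Definition rep_body P := mink_add (mink_add (dil c1 (Mplus P)) (dil c2 (Mminus P)))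
  (Dbody a1 a2 b1 b2 P).

Lemma natural_rep : natural rep_fun.
Proof.
have nM := natural_hMplus R; have nM' := natural_opp nM.
have nD := natural_hD a10 b10 a12 b12 ab ba.
apply: (natural_ext (natural_lin c2 (natural_lin c1 nD nM) nM')) => P x.
by rewrite /rep_fun; ring.
Qed.

Section Body.
Variable P : set (vec R).
Hypothesis hP : polytope_o P.

Lemma hMminus_sublin : sublin (hMminus P).
Proof.
rewrite (_ : hMminus P = fun x => hMplus P (- x)); last first.
  by apply/funext => x; rewrite hMminusE.
exact: sublin_opp (hMplus_sublin hP).
Qed.

Let sM := hMplus_sublin hP.
Let sD := hD_sublin a10 b10 a12 b12 ab ba hP.
Let nM : dil c1 (Mplus P) !=set0 := nonempty_dil c1 (body_of_neq0 sM).
Let nM' : dil c2 (Mminus P) !=set0 := nonempty_dil c2 (body_of_neq0 hMminus_sublin).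
Let nD : Dbody a1 a2 b1 b2 P !=set0 := body_of_neq0 sD.
Let kM : compact (dil c1 (Mplus P)) := dil_compact (@body_of_compact _ _).
Let kM' : compact (dil c2 (Mminus P)) := dil_compact (@body_of_compact _ _).
Let kD : compact (Dbody a1 a2 b1 b2 P) := @body_of_compact _ _.

Lemma rep_body_neq0 : rep_body P !=set0.
Proof. by do 2 (apply: mink_neq0 => //). Qed.

Lemma rep_body_compact : compact (rep_body P).
Proof. by do 2 (apply: mink_compact => //). Qed.

Lemma rep_body_convex : convex (rep_body P).
Proof.
by do 2 (apply: mink_convex; rewrite /Dbody; try exact: body_of_convex);
   apply: dil_convex; exact: body_of_convex.
Qed.

Lemma supp_rep_body x : supp (rep_body P) x = rep_fun P x.
Proof.
have bM := compact_bdd kM; have bM' := compact_bdd kM'; have bD := compact_bdd kD.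
rewrite supp_mink //; [|exact: mink_neq0|exact: mink_bdd]; rewrite supp_mink //.
rewrite !supp_dil //; try exact: body_of_bdd; try exact: body_of_neq0.
- by rewrite !supp_body_of // ?hMminusE //; exact: hMminus_sublin.
- exact: body_of_neq0 hMminus_sublin.
Qed.

End Body.
End Representation.

Section Operators.
Variable Z : set (vec R) -> set (vec R).
Hypothesis HZ : forall P, polytope_o P -> convex_body_o (Z P).

Let cZ P (hP : polytope_o P) : convex (Z P) := (HZ hP).1.
Let kZ P (hP : polytope_o P) : compact (Z P) := (HZ hP).2.1.
Let bZ P (hP : polytope_o P) : bdd (Z P) := compact_bdd (kZ hP).
Lemma operator_neq0 P : polytope_o P -> Z P !=set0.
Proof. by move=> hP; exists 0; exact: (HZ hP).2.2. Qed.
Let nZ := operator_neq0.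

Lemma natural_operator : minkowski_valuation Z -> SL3_covariant Z ->
  natural (fun P x => supp (Z P) x).
Proof.
move=> vZ sZ; apply: natural_sublin.
- move=> x; apply: valuation_cut => K L hK hL hU hI.
  rewrite -!supp_mink ?vZ //; try exact: bZ; exact: nZ.
- by move=> phi P x d1 hP; rewrite sZ // supp_linimg.
- by move=> P hP; apply: supp_sublin; [exact: nZ|exact: bZ].
Qed.

Lemma operator_valuation (h : set (vec R) -> vec R -> R) : natural h ->
  (forall P x, polytope_o P -> supp (Z P) x = h P x) -> minkowski_valuation Z.
Proof.
move=> nh hE K L hK hL hU hI.
apply: supp_inj; try (by apply: mink_convex; exact: cZ); try (by apply: mink_compact; exact: kZ);
  try (by apply: mink_neq0; exact: nZ).
move=> x; rewrite !supp_mink; try exact: nZ; try exact: bZ.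
rewrite !hE //; exact: (cut_additive_valuation (natural_cut nh x)).
Qed.

(** [supp_subset] asks for compactness of the larger set only, so images under linear maps merely
    have to be bounded; the second inclusion is pulled back by the inverse map. *)
Lemma operator_covariant (h : set (vec R) -> vec R -> R) : natural h ->
  (forall P x, polytope_o P -> supp (Z P) x = h P x) -> SL3_covariant Z.
Proof.
move=> nh hE phi d1 K hK; have hK' := linimg_polytope phi hK.
have u : phi \in unitmx by rewrite unitmxE d1 unitr1.
have sE x : supp (Z (linimg phi K)) x = supp (Z K) (x *m phi^T).
  by rewrite !hE // (natural_cov nh).
apply/seteqP; split; last first.
  apply: supp_subset; [exact: linimg_bdd (bZ hK)|exact: cZ|exact: kZ|exact: nZ|].
  by move=> x; rewrite supp_linimg sE.
rewrite -[X in X `<=` _](linimgK _ (mulVmx u)); apply: linimg_sub.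
apply: supp_subset; [exact: linimg_bdd (bZ hK')|exact: cZ|exact: kZ|exact: nZ|].
by move=> x; rewrite supp_linimg sE -mulmxA -trmx_mul mulmxV // trmx1 mulmx1.
Qed.

End Operators.
End Bodies.

Theorem theorem1p7 (R : realType) (Z : set (vec R) -> set (vec R))
  (HZ : forall P, polytope_o P -> convex_body_o (Z P)) :
  (minkowski_valuation Z /\ SL3_covariant Z) <->
  (exists a1 a2 b1 b2 c1 c2 : R,
     [/\ 0 <= a1, 0 <= a2, 0 <= b1 & 0 <= b2] /\ 0 <= c1 /\ 0 <= c2 /\
     [/\ a1 <= a2, b1 <= b2, a2 - a1 <= b2 & b2 - b1 <= a2] /\
     forall P, polytope_o P ->
       Z P = mink_add (mink_add (dil c1 (Mplus P)) (dil c2 (Mminus P))) (Dbody a1 a2 b1 b2 P)).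
Proof.
split=> [[vZ sZ]|].
  have nz := natural_operator HZ vZ sZ.
  have [||a1 [a2 [b1 [b2 [c1 [c2 [sg [c10 [c20 [cs hE]]]]]]]]]] := natural_classification nz.
  - move=> P hP; apply: supp_sublin; first exact: (operator_neq0 HZ hP).
    exact: compact_bdd (HZ _ hP).2.1.
  (* The origin lies in [Z P], which makes the support function nonnegative. *)
  - move=> P x hP; rewrite -(dot0r x); apply: supp_ge; last exact: (HZ _ hP).2.2.
    exact: compact_bdd (HZ _ hP).2.1.
  have [a10 _ b10 _] := sg; have [a12 b12 ab ba] := cs.
  exists a1, a2, b1, b2, c1, c2; do 4 (split=> //).
  move=> P hP; have [cP [kP P0]] := HZ _ hP.
  rewrite -/(rep_body a1 a2 b1 b2 c1 c2 P).
  apply: supp_inj => //; first exact: (operator_neq0 HZ hP).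
  - exact: rep_body_convex.
  - exact: rep_body_compact.
  - exact: rep_body_neq0.
  by move=> x; rewrite hE // supp_rep_body.
move=> [a1 [a2 [b1 [b2 [c1 [c2 [[a10 _ b10 _] [c10 [c20 [[a12 b12 ab ba] ZE]]]]]]]]]].
have nh := natural_rep c1 c2 a10 b10 a12 b12 ab ba.
have hE P x : polytope_o P -> supp (Z P) x = rep_fun a1 a2 b1 b2 c1 c2 P x.
  by move=> hP; rewrite ZE // -supp_rep_body.
by split; [exact: (operator_valuation HZ nh hE)|exact: (operator_covariant HZ nh hE)].
Qed.
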